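(* Let $n\in\mathbb{N}$, let $\Omega\subseteq\mathbb{R}^n$ be bounded and open and let $\mathrm{H}\in C(\mathbb{R}^{n\times n}_s)$ be a non-negative level-convex function. Suppose also that there exist $C_1,C_2,r>0$ such that $$\mathrm{H}(X)\ge C_1|X|^r-C_2,\qquad X\in\mathbb{R}^{n\times n}_s.$$ Then for any $g\in W^{2,\infty}(\Omega)$ there exist a function $u_\infty\in W^{2,\infty}_g(\Omega)$, a sequence $(u_p)_{p=1}^\infty\subseteq W^{2,\infty}_g(\Omega)$ and a subsequence $p_j\to\infty$ such that: (a) $u_\infty$ is a minimiser of $\mathrm{E}_\infty$ on $\Omega$, i.e. $\mathrm{E}_\infty(u_\infty,\Omega)\le\mathrm{E}_\infty(\psi,\Omega)$ for any $\psi\in W^{2,\infty}_g(\Omega)$. (b) $(u_p)$ is a sequence of approximate minimisers of $\mathrm{E}_p$ in the sense that $$\mathrm{E}_p(u_p,\Omega)^p\le 2^{-p^2}+\inf\big\{\mathrm{E}_p(v,\Omega)^p: v\in W^{2,\infty}_g(\Omega)\big\},$$ and for any $q\ge1$, $u_{p_j}\rightharpoonup u_\infty$ weakly in $W^{2,q}(\Omega)$ as $j\to\infty$. (c) For any measurable $B\subseteq\Omega$, $$\mathrm{E}_\infty(u_\infty,B)\le\liminf_{j\to\infty}\mathrm{E}_{p_j}(u_{p_j},B).$$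
   Context: $\mathbb{R}^{n\times n}_s$ is the space of real symmetric $n\times n$ matrices with Euclidean norm $|X|$. $\mathrm{H}$ is level-convex if for every $t\ge0$ the sublevel set $\{\mathrm{H}\le t\}$ is convex. For measurable $\mathcal{O}\subseteq\Omega$ and $p\in\mathbb{N}$, $$\mathrm{E}_\infty(u,\mathcal{O}):=\|\mathrm{H}(\mathrm{D}^2u)\|_{L^\infty(\mathcal{O})},\qquad \mathrm{E}_p(u,\mathcal{O}):=\Big(\frac{1}{|\mathcal{O}|}\int_{\mathcal{O}}\mathrm{H}(\mathrm{D}^2u(x))^p\,dx\Big)^{1/p}$$ (both are taken to be $0$ if $\mathcal{O}$ is a null set). $W^{2,\infty}_0(\Omega):=W^{2,\infty}(\Omega)\cap\bigcap_{1<p<\infty}W^{2,p}_0(\Omega)$ (functions with $v=0$, $\mathrm{D}v=0$ on $\partial\Omega$), and $W^{2,\infty}_g(\Omega):=g+W^{2,\infty}_0(\Omega)$. *)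

(* Defs.v *)
From HB Require Import structures.
From mathcomp Require Import all_boot all_order all_algebra.
From mathcomp Require Import all_classical all_reals all_analysis.

Set Implicit Arguments.
Unset Strict Implicit.
Unset Printing Implicit Defensive.

Import Order.TTheory GRing.Theory Num.Theory.
Import numFieldNormedType.Exports.

Local Open Scope classical_set_scope.
Local Open Scope ring_scope.

(* The sigma-algebra on R^n generated by the coordinates, i.e., the Borel
   sigma-algebra. *)
Section borel_rV.
Variables (R : realType) (n : nat).

Definition rV_coord (i : 'I_n) (x : 'rV[R]_n) : R := x ord0 i.

Let rV_measurable : set (set 'rV[R]_n) := g_sigma_preimage rV_coord.

Let rV_measurable0 : rV_measurable set0.
Proof. exact: sigma_algebra0. Qed.

Let rV_measurableC A : rV_measurable A -> rV_measurable (~` A).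
Proof. exact: sigma_algebraC. Qed.

Let rV_measurable_bigcup (F : (set 'rV[R]_n)^nat) :
  (forall i, rV_measurable (F i)) -> rV_measurable (\bigcup_i F i).
Proof. exact: sigma_algebra_bigcup. Qed.

HB.instance Definition _ :=
  @isMeasurable.Build default_measure_display 'rV[R]_n rV_measurable
    rV_measurable0 rV_measurableC rV_measurable_bigcup.

Lemma measurable_rV_coord i : measurable_fun [set: 'rV[R]_n] (rV_coord i).
Proof.
move=> _ Y mY; rewrite setTI; apply: sub_sigma_algebra => /=.
rewrite -bigcup_seq/=; exists i => /=; first by rewrite mem_index_enum.
by exists Y => //; rewrite setTI.
Qed.

Lemma measurable_fun_rVP d (T : measurableType d) (f : T -> 'rV[R]_n) :
  (forall i, measurable_fun [set: T] (rV_coord i \o f)) ->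
  measurable_fun [set: T] f.
Proof.
move=> mf.
suff /(_ _ _)/= H : g_sigma_preimage (fun i => rV_coord i \o f) `<=` measurable.
  move=> _ A mA; apply: H.
  by rewrite g_sigma_preimage_comp; exists A.
apply: smallest_sub; first exact: sigma_algebra_measurable.
elim/big_ind : _ => //.
- by move=> A B HA HB C [/HA|/HB].
- by move=> i _ A [B mB <-]; exact: mf.
Qed.

End borel_rV.

Section rV_cons.
Variables (R : realType) (n : nat).

Definition rV_cons (p : measurableTypeR R * 'rV[R]_n) : 'rV[R]_n.+1 :=
  \row_i oapp (p.2 ord0) p.1 (unlift ord0 i).

Definition rV_uncons (x : 'rV[R]_n.+1) : measurableTypeR R * 'rV[R]_n :=
  (x ord0 ord0, \row_i x ord0 (lift ord0 i)).

Lemma rV_unconsK : cancel rV_uncons rV_cons.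
Proof.
by move=> x; apply/rowP => i; rewrite mxE; case: unliftP => [j|] -> //=; rewrite mxE.
Qed.

Lemma rV_consK : cancel rV_cons rV_uncons.
Proof.
move=> [a x]; rewrite /rV_uncons /rV_cons mxE unlift_none/=; congr pair.
by apply/rowP => i; rewrite !mxE liftK.
Qed.

Lemma measurable_rV_cons : measurable_fun [set: measurableTypeR R * 'rV[R]_n] rV_cons.
Proof.
apply: measurable_fun_rVP => i.
rewrite (_ : _ \o _ =
    fun p : measurableTypeR R * 'rV[R]_n => oapp (p.2 ord0) p.1 (unlift ord0 i)); last first.
  by apply/funext => p; rewrite /= /rV_coord mxE.
case: unliftP => [j|] _ /=; last exact: measurable_fst.
exact: (measurableT_comp (measurable_rV_coord j) measurable_snd).
Qed.

Lemma measurable_rV_uncons : measurable_fun [set: 'rV[R]_n.+1] rV_uncons.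
Proof.
apply: measurable_fun_pair; first exact: (measurable_rV_coord ord0).
apply: measurable_fun_rVP => i.
rewrite (_ : _ \o _ = rV_coord (lift ord0 i)); first exact: measurable_rV_coord.
by apply/funext => p; rewrite /= /rV_coord mxE.
Qed.

End rV_cons.

Section lebesgue_rV.
Variable R : realType.

Section step.
Variables (n : nat) (mu : {sigma_finite_measure set 'rV[R]_n -> \bar R}).

(* The product of the Lebesgue measure on R and of mu, transported along
   R * R^n = R^(n+1). *)
Definition lebesgue_rV_step : set 'rV[R]_n.+1 -> \bar R :=
  pushforward (@lebesgue_measure R \x mu)%E (@rV_cons R n).

Let lebesgue_rV_step0 : lebesgue_rV_step set0 = 0%E.
Proof. by rewrite /lebesgue_rV_step /pushforward preimage_set0 measure0. Qed.

Let lebesgue_rV_step_ge0 A : (0 <= lebesgue_rV_step A)%E.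
Proof. by rewrite /lebesgue_rV_step /pushforward measure_ge0. Qed.

Let lebesgue_rV_step_sigma_additive : semi_sigma_additive lebesgue_rV_step.
Proof.
have mcons A : measurable A -> measurable (@rV_cons R n @^-1` A).
  by move=> mA; rewrite -[X in measurable X]setTI; exact: measurable_rV_cons.
move=> F mF tF mUF; rewrite /lebesgue_rV_step /pushforward preimage_bigcup.
apply: measure_semi_sigma_additive.
- by move=> k; exact: mcons.
- apply/trivIsetP => /= i j _ _ ij; rewrite -preimage_setI.
  by move/trivIsetP : tF => /(_ _ _ _ _ ij) ->//; rewrite preimage_set0.
- by rewrite -preimage_bigcup; exact: mcons.
Qed.

HB.instance Definition _ := isMeasure.Build _ _ _ lebesgue_rV_step
  lebesgue_rV_step0 lebesgue_rV_step_ge0 lebesgue_rV_step_sigma_additive.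

Let lebesgue_rV_step_sigma_finite : sigma_finite setT lebesgue_rV_step.
Proof.
have mE A B : measurable A -> measurable B ->
    (@lebesgue_measure R \x mu)%E (A `*` B) = (lebesgue_measure A * mu B)%E.
  exact: product_measure1E.
have /sigma_finiteP[F [TF ndF Foo]] := sigma_finiteT (@lebesgue_measure R).
have /sigma_finiteP[G [TG ndG Goo]] := sigma_finiteT mu.
exists (fun k => (@rV_uncons R n) @^-1` (F k `*` G k)).
  rewrite predeqE => x; split=> // _.
  have [k _ Fk] : (\bigcup_i F i) (rV_uncons x).1 by rewrite -TF.
  have [l _ Gl] : (\bigcup_i G i) (rV_uncons x).2 by rewrite -TG.
  exists (maxn k l) => //; split.
    by move: Fk; exact/subsetPset/ndF/leq_maxl.
  by move: Gl; exact/subsetPset/ndG/leq_maxr.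
move=> k; have [mF Fkoo] := Foo k; have [mG Gkoo] := Goo k; split.
  rewrite -[X in measurable X]setTI; apply: measurable_rV_uncons => //.
  exact: measurableX.
rewrite /lebesgue_rV_step /pushforward -comp_preimage.
rewrite (_ : _ \o _ = id) ?preimage_id; last first.
  by apply/funext => x /=; rewrite rV_consK.
by rewrite mE// lte_mul_pinfty// ge0_fin_numE.
Qed.

HB.instance Definition _ :=
  @Measure_isSigmaFinite.Build _ _ _ lebesgue_rV_step
    lebesgue_rV_step_sigma_finite.

End step.

Fixpoint lebesgue_borel_rV n : {sigma_finite_measure set 'rV[R]_n -> \bar R} :=
  if n is m.+1 then lebesgue_rV_step (lebesgue_borel_rV m) else \d_(0 : 'rV[R]_0).

End lebesgue_rV.

(* The completion of the Borel measure: its measurable sets are the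
   Caratheodory (i.e., Lebesgue) measurable sets. *)
Notation lebesgue_rV_type R n :=
  (caratheodory_type ((@lebesgue_borel_rV R n)^*)%mu).

Definition lebesgue_rV {R : realType} {n : nat} :
    set (lebesgue_rV_type R n) -> \bar R :=
  @completed_measure_extension _ _ _ (@lebesgue_borel_rV R n).
HB.instance Definition _ (R : realType) (n : nat) :=
  Measure.on (@lebesgue_rV R n).

Section sobolev.
Variables (R : realType) (n : nat).
Notation V := 'rV[R]_n.
Notation mu := (@lebesgue_rV R n).
Implicit Types (Om O K : set V) (u v phi : V -> R) (a : seq 'I_n) (p : \bar R).

(* A sequence of indices a = [:: i_1; ..; i_k] stands for the iterated
   derivative of order k = size a in the directions e_(i_1), ..., e_(i_k);
   multi-indices are such sequences up to reordering. *)
Definition partial a phi : V -> R :=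
  foldr (fun i f => 'D_(delta_mx ord0 i) f) phi a.

(* C^oo functions with compact support in Om. *)
Definition test_fun Om : set (V -> R) :=
  [set phi | (forall a x, differentiable (partial a phi) x) /\
    exists K, [/\ compact K, K `<=` Om & forall x, ~ K x -> phi x = 0]].

Definition L1loc Om : set (V -> R) :=
  [set u | forall K, compact K -> K `<=` Om ->
    mu.-integrable (K : set (lebesgue_rV_type R n)) (EFin \o u)].

Definition weak_deriv Om a u v : Prop :=
  [/\ L1loc Om u, L1loc Om v & forall phi, test_fun Om phi ->
    \int[mu]_(x in Om) (u x * partial a phi x) =
    (-1) ^+ size a * \int[mu]_(x in Om) (v x * phi x)].

(* A representative of the a-th weak derivative of u, which is unique up to
   a negligible set; 0 if there is none. *)
Definition wderiv Om a u : V -> R := xget (cst 0) [set v | weak_deriv Om a u v].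

(* Since weak_deriv only depends on the iterated derivatives of smooth
   functions, D2 Om u x is a symmetric matrix for all x. *)
Definition D2 Om u (x : V) : 'M[R]_n := \matrix_(i, j) wderiv Om [:: i; j] u x.

Definition Lp Om p : set (V -> R) :=
  [set u | (u \_ Om : lebesgue_rV_type R n -> R) \in Lfun mu p].

Definition Lp_norm Om p u : \bar R := 'N[mu]_p[EFin \o (u \_ Om)]%E.

Definition W2 Om p : set (V -> R) :=
  [set u | Lp Om p u /\
    forall a, (0 < size a <= 2)%N -> exists2 v, weak_deriv Om a u v & Lp Om p v].

Definition W2_norm Om p u : \bar R :=
  (Lp_norm Om p u + \sum_(i < n) Lp_norm Om p (wderiv Om [:: i] u) +
   \sum_(i < n) \sum_(j < n) Lp_norm Om p (wderiv Om [:: i; j] u))%E.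

(* The closure of the test functions in W^{2,p}. *)
Definition W20 Om p : set (V -> R) :=
  [set u | W2 Om p u /\ forall e : R, 0 < e ->
    exists2 phi, test_fun Om phi & (W2_norm Om p (u \- phi)%R < e%:E)%E].

Definition W2oo0 Om : set (V -> R) :=
  W2 Om +oo%E `&` \bigcap_(p in [set p : R | 1 < p]) W20 Om p%:E.

Definition W2oo_bd Om (g : V -> R) : set (V -> R) :=
  [set g \+ v | v in W2oo0 Om].

(* Bounded linear functionals on W^{2,p}; boundedness makes them independent
   of the choice of representatives of the elements of W^{2,p}. *)
Definition W2_dual Om p : set ((V -> R) -> R) :=
  [set L | (forall (c : R) u v, W2 Om p u -> W2 Om p v ->
              L (fun x => c * u x + v x) = c * L u + L v) /\
           (exists C : R, forall u, W2 Om p u ->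
              (`|L u|%:E <= C%:E * W2_norm Om p u)%E)].

Definition W2_weak_cvg Om p (u_ : (V -> R)^nat) u : Prop :=
  [/\ forall j, W2 Om p (u_ j), W2 Om p u &
      forall L, W2_dual Om p L -> L (u_ j) @[j --> \oo] --> L u].

Variable H : 'M[R]_n -> R.

(* If O is negligible, H \o D2 Om u \_ O vanishes almost everywhere and the
   value is 0. *)
Definition Eoo Om u O : \bar R := Lp_norm O +oo (H \o D2 Om u).

Definition Ep Om (p : nat) u O : \bar R :=
  (if mu O == 0 then 0
   else (((fine (mu O))^-1)%:E *
         \int[mu]_(x in O) ((H (D2 Om u x)) ^+ p)%:E) `^ (p%:R^-1))%E.

End sobolev.

(* H is only meaningful on the symmetric matrices. *)
Definition symmx (R : realType) (n : nat) : set 'M[R]_n := [set X | X^T = X].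

Definition level_convex (R : realType) (n : nat) (H : 'M[R]_n -> R) : Prop :=
  forall t : R, 0 <= t -> convex_set (@symmx R n `&` [set X | H X <= t]).

(* The norm of the normed module 'M[R]_n is the sup norm, not this one. *)
Definition euclid_norm (R : realType) (n : nat) (X : 'M[R]_n) : R :=
  Num.sqrt (\sum_(i < n) \sum_(j < n) X i j ^+ 2).

(* Main.v *)
Require Import Defs.
From HB Require Import structures.
From mathcomp Require Import all_boot all_order all_algebra.
From mathcomp Require Import all_classical all_reals all_analysis.
From mathcomp Require Import measurable_realfun ess_sup_inf lra.

Set Implicit Arguments.
Unset Strict Implicit.
Unset Printing Implicit Defensive.

Import Order.TTheory GRing.Theory Num.Theory.
Import numFieldNormedType.Exports.

Local Open Scope classical_set_scope.
Local Open Scope ring_scope.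

(** The minimiser is obtained from approximate minimisers u_p of the L^p functionals by
    the direct method.

    Comparing u_p with a competitor psi such that H(D^2 psi) <= c gives
    E_p(u_p) <= 2^(-p) + c ([approximate_minimiser_le]). With psi = g and the growth of H,
    the Hessians D^2 u_p are bounded in every L^s, and the Poincare inequality
    ([poincare_W20]) bounds u_p - g in every W^{2,s} ([diffs_moment_bounded]).

    Compactness is extracted in the Hilbert space W^{2,2}, in the form of Mazur's lemma
    ([weak_compactness], [sob_weak_compactness]): there are a subsequence p_j and a
    function y such that, for every infinite set Q of indices, y is a strong limit in
    W^{2,2} of convex combinations of the functions u_(p_j) - g with j in Q. Convex
    combinations obey the same bounds in every W^{2,s}, so that by interpolation they
    approximate y in every W^{2,q} ([moment_class_interpolation]). The minimiser is
    u_oo = g + y. Everything now follows by a suitable choice of Q.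

    For (c), let t exceed the lower limit of E_(p_j)(u_(p_j), B), and let Q be the set of
    indices where E_(p_j)(u_(p_j), B) stays below some s < t. By Chebyshev's inequality
    and the Borel-Cantelli lemma, at almost every x in B one has H(D^2 u_(p_j)(x)) <= t
    for all large j in Q, because the powers (s / t)^(p_j) are summable. Level convexity
    transfers this bound to convex combinations, and continuity of H to D^2 u_oo(x)
    ([Eoo_le_liminf]). With B = Om and the comparison above, (c) implies (a).

    That u_oo is in W^{2,oo} is a consequence of (a) applied to g: H(D^2 u_oo) is bounded,
    hence so is D^2 u_oo by growth, and so are D y and y by the Poincare inequality on
    L^k as k tends to infinity, its constant being a k-th power
    ([hess_bounded_W2oo0]).

    For the weak convergence in (b), if a bounded functional l kept l(u_(p_j) - u_oo) >= e
    on an infinite set Q, it would do so on convex combinations that tend to u_oo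
    strongly ([hull_weak_cvg]).

    Since H is only given on symmetric matrices, all of this is done for the composition
    of H with the projection X |-> (X + X^T) / 2, and weak second derivatives are
    symmetric ([D2_sym]). *)

(** * Integrals of powers *)

(** The p-th power of the L^p norm. Only smallness and boundedness matter below, and
    for powers the triangle inequality holds up to the constant 2^p, pointwise under
    the integral sign. *)
HB.lock Definition moment {d} {T : measurableType d} {R : realType}
  (mu : {measure set T -> \bar R}) (D : set T) (p : R) (f : T -> R) : \bar R :=
  (\int[mu]_(x in D) (`|f x| `^ p)%:E)%E.

Section moment.
Context d (T : measurableType d) (R : realType) (mu : {measure set T -> \bar R}).
Implicit Types (D : set T) (f g : T -> R) (p q : R) (P Q : T -> Prop).

Lemma lte_scaleD (a b : R) (x y : \bar R) : 0 <= a -> 0 <= b ->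
  (x < +oo)%E -> (y < +oo)%E -> (a%:E * x + b%:E * y < +oo)%E.
Proof. by move=> a0 b0 xoo yoo; rewrite lte_add_pinfty// lte_mul_pinfty. Qed.

Lemma lee_sum_lin (I : finType) (F G H : I -> \bar R) (a b : R) :
  (forall i, 0 <= G i)%E -> (forall i, 0 <= H i)%E ->
  (forall i, F i <= a%:E * G i + b%:E * H i)%E ->
  (\sum_i F i <= a%:E * \sum_i G i + b%:E * \sum_i H i)%E.
Proof.
move=> G0 H0 h; rewrite !ge0_sume_distrr// -big_split/=.
by apply: lee_sum => i _; exact: h.
Qed.

Lemma ae_imp P Q : {ae mu, forall x, P x} -> (forall x, P x -> Q x) ->
  {ae mu, forall x, Q x}.
Proof.
move=> h PQ; apply: (@filterS _ _ (ae_filter_ringOfSetsType mu) P) h => x.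
exact: PQ.
Qed.

Lemma ae_imp2 P P' Q : {ae mu, forall x, P x} -> {ae mu, forall x, P' x} ->
  (forall x, P x -> P' x -> Q x) -> {ae mu, forall x, Q x}.
Proof.
move=> h h' PQ; apply: (@ae_imp (fun x => P x /\ P' x)) => [|x []]; last exact: PQ.
exact: (@filterI _ _ (ae_filter_ringOfSetsType mu) P P').
Qed.

Lemma momentE D p f :
  moment mu D p f = (\int[mu]_(x in D) (`|f x| `^ p)%:E)%E.
Proof. by rewrite unlock. Qed.

Lemma moment_ge0 D p f : (0 <= moment mu D p f)%E.
Proof. by rewrite momentE; apply: integral_ge0 => x _; rewrite lee_fin powR_ge0. Qed.

Variables (D : set T) (mD : measurable D).

Lemma measurable_moment p f : measurable_fun D f ->
  measurable_fun D (fun x => (`|f x| `^ p)%:E).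
Proof.
move=> mf; apply/measurable_EFinP; apply: (measurableT_comp (measurable_powR p)).
exact: measurableT_comp.
Qed.
Hint Resolve measurable_moment : core.

Lemma moment_ae p f g : measurable_fun D f -> measurable_fun D g ->
  {ae mu, forall x, D x -> f x = g x} -> moment mu D p f = moment mu D p g.
Proof.
move=> mf mg fg; rewrite !momentE; apply: ae_eq_integral => //; try exact: measurable_moment.
by apply: (ae_imp fg) => x h /h ->.
Qed.

Lemma integral_dominated (F G K : T -> R) (a b : R) :
  measurable_fun D F -> measurable_fun D G -> measurable_fun D K ->
  (forall x, 0 <= F x) -> (forall x, 0 <= G x) -> (forall x, 0 <= K x) ->
  0 <= a -> 0 <= b -> (forall x, F x <= a * G x + b * K x) ->
  (\int[mu]_(x in D) (F x)%:E <=
   a%:E * \int[mu]_(x in D) (G x)%:E + b%:E * \int[mu]_(x in D) (K x)%:E)%E.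
Proof.
move=> /measurable_EFinP mF /measurable_EFinP mG /measurable_EFinP mK F0 G0 K0 a0 b0 h.
have eG := ge0_integralZl_EFin mu mD (fun x _ => G0 x : (0%:E <= (G x)%:E)%E) mG a0.
have eK := ge0_integralZl_EFin mu mD (fun x _ => K0 x : (0%:E <= (K x)%:E)%E) mK b0.
have maG : measurable_fun D (fun x => a%:E * (G x)%:E)%E by exact: measurable_funeM.
have mbK : measurable_fun D (fun x => b%:E * (K x)%:E)%E by exact: measurable_funeM.
rewrite -eG -eK -ge0_integralD//; last 2 first.
- by move=> x _; rewrite -EFinM lee_fin mulr_ge0.
- by move=> x _; rewrite -EFinM lee_fin mulr_ge0.
apply: ge0_le_integral => //.
- by move=> x _; rewrite lee_fin.
- exact: emeasurable_funD.
- by move=> x _; rewrite -!EFinM -EFinD lee_fin.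
Qed.

Lemma measurable_powR_norm p f : measurable_fun D f ->
  measurable_fun D (fun x => `|f x| `^ p).
Proof.
move=> mf; apply: (measurableT_comp (measurable_powR p)); exact: measurableT_comp.
Qed.

Lemma moment_le p q f g (a b : R) : measurable_fun D f -> measurable_fun D g ->
  0 <= a -> 0 <= b -> (forall x, `|f x| `^ p <= a + b * `|g x| `^ q) ->
  (moment mu D p f <= a%:E * mu D + b%:E * moment mu D q g)%E.
Proof.
move=> mf mg a0 b0 h; have := @integral_dominated _ (cst 1) _ a b
  (measurable_powR_norm p mf) (measurable_cst _) (measurable_powR_norm q mg).
rewrite (integral_cst mu mD 1) mul1e !momentE; apply => // x; try exact: powR_ge0.
by rewrite mulr1.
Qed.

Lemma moment_le2 p q q' f g g' (a b : R) :
  measurable_fun D f -> measurable_fun D g -> measurable_fun D g' ->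
  0 <= a -> 0 <= b ->
  (forall x, `|f x| `^ p <= a * `|g x| `^ q + b * `|g' x| `^ q') ->
  (moment mu D p f <= a%:E * moment mu D q g + b%:E * moment mu D q' g')%E.
Proof.
move=> mf mg mg' a0 b0 h; rewrite !momentE; apply: integral_dominated => //;
  try exact: measurable_powR_norm; move=> x; exact: powR_ge0.
Qed.

Lemma ler_powR2 p (x y : R) : 0 <= p -> 0 <= x -> x <= y -> x `^ p <= y `^ p.
Proof.
move=> p0 x0 xy; apply: ge0_ler_powR; rewrite ?nnegrE//; exact: le_trans xy.
Qed.

Lemma powR_normD p (x y : R) : 0 <= p ->
  `|x + y| `^ p <= 2 `^ p * `|x| `^ p + 2 `^ p * `|y| `^ p.
Proof.
move=> p0; have h2 := powR_ge0 2 p.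
have H (a b : R) : `|a| <= `|b| -> `|a + b| `^ p <= 2 `^ p * `|b| `^ p.
  move=> ab; rewrite -powRM// ler_powR2//.
  apply: le_trans (ler_normD _ _) _; lra.
case: (leP `|x| `|y|) => xy.
  apply: le_trans (H _ _ xy) _; rewrite lerDr mulr_ge0// powR_ge0//.
rewrite addrC; apply: le_trans (H _ _ (ltW xy)) _; rewrite lerDl mulr_ge0// powR_ge0//.
Qed.

Lemma moment_add p f g : 0 <= p -> measurable_fun D f -> measurable_fun D g ->
  (moment mu D p (fun x => f x + g x)%R <=
   (2 `^ p)%:E * moment mu D p f + (2 `^ p)%:E * moment mu D p g)%E.
Proof.
move=> p0 mf mg; apply: moment_le2 => //; try exact: powR_ge0.
  exact: measurable_funD.
by move=> x; exact: powR_normD.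
Qed.

Lemma moment_scale p c f : measurable_fun D f ->
  moment mu D p (fun x => c * f x) = ((`|c| `^ p)%:E * moment mu D p f)%E.
Proof.
move=> mf; have := @ge0_integralZl_EFin _ _ _ mu D mD (fun x => (`|f x| `^ p)%:E) _
  (measurable_moment p mf) (`|c| `^ p).
rewrite !momentE => <-; first by apply: eq_integral => x _; rewrite normrM powRM.
  by move=> x _; rewrite lee_fin powR_ge0.
exact: powR_ge0.
Qed.

Lemma powR_le1D p q (x : R) : 0 <= p -> p <= q -> 0 <= x -> x `^ p <= 1 + x `^ q.
Proof.
move=> p0 pq x0; case: (leP x 1) => x1.
  rewrite -[x `^ p]addr0 lerD ?powR_ge0//.
  by have := ler_powR2 p0 x0 x1; rewrite powR1.
by rewrite -[x `^ p]add0r lerD// ler_powR// ltW.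
Qed.

Lemma moment_exponent p q f : 0 <= p -> p <= q -> measurable_fun D f ->
  (moment mu D p f <= mu D + moment mu D q f)%E.
Proof.
move=> p0 pq mf; have := @moment_le p q f f 1 1 mf mf ler01 ler01.
rewrite !mul1e; apply => x; rewrite mul1r; exact: powR_le1D.
Qed.

Lemma powR_convex p (t x y : R) : 1 <= p -> 0 <= t -> t <= 1 ->
  `|t * x + (1 - t) * y| `^ p <= t * `|x| `^ p + (1 - t) * `|y| `^ p.
Proof.
move=> p1 t0 t1; have p0 : 0 <= p by lra.
have t0' : 0 <= 1 - t by lra.
apply: (@le_trans _ _ ((t * `|x| + (1 - t) * `|y|) `^ p)).
  rewrite ler_powR2//; apply: le_trans (ler_normD _ _) _.
  by rewrite !normrM (ger0_norm t0) (ger0_norm t0').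
have t01 : 0 <= t <= 1 by rewrite t0.
have := @convex_powR R p p1 (@Itv01 R t t0 t1) `|x| `|y|.
rewrite !inE /= !in_itv/= !andbT !normr_ge0 => /(_ isT isT).
by rewrite /conv/=.
Qed.

Lemma moment_convex p t f g C : 1 <= p -> 0 <= t -> t <= 1 ->
  measurable_fun D f -> measurable_fun D g ->
  (moment mu D p f <= C%:E)%E -> (moment mu D p g <= C%:E)%E ->
  (moment mu D p (fun x => t * f x + (1 - t) * g x)%R <= C%:E)%E.
Proof.
move=> p1 t0 t1 mf mg fC gC; have t0' : 0 <= 1 - t by lra.
have h : (moment mu D p (fun x => t * f x + (1 - t) * g x)%R <=
    t%:E * moment mu D p f + (1 - t)%:E * moment mu D p g)%E.
  apply: moment_le2 => //.
    by apply: measurable_funD; apply: measurable_funM.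
  by move=> x; exact: powR_convex.
apply: (le_trans h).
have -> : C%:E = (t%:E * C%:E + (1 - t)%:E * C%:E)%E.
  by rewrite -!EFinM -EFinD -mulrDl addrC subrK mul1r.
by apply: (leeD (lee_wpmul2l _ fC) (lee_wpmul2l _ gC)); rewrite lee_fin.
Qed.

Lemma powR_interpolation p (k : nat) (x e : R) : 1 <= p -> p <= k%:R + 1 -> 0 < e ->
  0 <= x -> x `^ p <= e^-1 * x `^ 2 + e * (1 + x `^ (2 * k%:R)).
Proof.
move=> p1 pk e0 x0.
have -> : x `^ p = x * x `^ (p - 1).
  rewrite -{2}(powRr1 x0) -powRD; first by rewrite addrC subrK.
  apply/implyP => /eqP h; have : (1 : R) <= 0 by lra.
  by rewrite ler10.
have y0 := powR_ge0 x (p - 1).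
have h1 : (x `^ (p - 1)) ^+ 2 <= 1 + x `^ (2 * k%:R).
  rewrite -powR_mulrn// -powRrM mulrC; apply: powR_le1D => //; lra.
have -> : x `^ 2 = x ^+ 2 by rewrite -powR_mulrn.
have h2 : 0 <= e * (1 + x `^ (2 * k%:R) - (x `^ (p - 1)) ^+ 2).
  by rewrite mulr_ge0 ?subr_ge0// ltW.
have e1 : e * e^-1 = 1 by rewrite divff// gt_eqF.
have e2 : 0 < e^-1 by rewrite invr_gt0.
have h3 : 0 <= e * (x `^ (p - 1) - e^-1 * x) ^+ 2 by rewrite mulr_ge0 ?sqr_ge0// ltW.
have h4 : 0 <= x * x `^ (p - 1) by exact: mulr_ge0.
set y := x `^ (p - 1) in h1 h2 h3 h4 y0 *.
have e3 : e * (y - e^-1 * x) ^+ 2 =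
  e * y ^+ 2 - 2 * (e * e^-1) * x * y + e * e^-1 * e^-1 * x ^+ 2 by lra.
rewrite e3 e1 in h3; lra.
Qed.

(** L^p is interpolated between L^2 and a large even exponent by a pointwise Young
    inequality: functions that are small in L^2 and bounded in all L^s are small in
    every L^p. *)
Lemma moment_interpolation p (k : nat) f e : 1 <= p -> p <= k%:R + 1 -> 0 < e ->
  measurable_fun D f ->
  (moment mu D p f <= e^-1%:E * moment mu D 2 f + e%:E * (mu D + moment mu D (2 * k%:R) f))%E.
Proof.
move=> p1 pk e0 mf; have e1 : 0 <= e^-1 by rewrite invr_ge0 ltW.
have m2 := measurable_powR_norm 2 mf.
have mk := measurable_powR_norm (2 * k%:R) mf.
have := @integral_dominated _ _ _ e^-1 e (measurable_powR_norm p mf) m2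
  (measurable_funD (measurable_cst (1 : R)) mk).
have -> : (\int[mu]_(x in D) (1 + `|f x| `^ (2 * k%:R))%:E =
    mu D + moment mu D (2 * k%:R) f)%E.
  rewrite !momentE -[mu D]mul1e -integral_cst// -ge0_integralD//.
  exact/measurable_EFinP.
rewrite !(momentE _ p) !(momentE _ 2) => H; apply: H => [x|x|x|||x]; rewrite ?powR_ge0//; last 2 first.
- exact: ltW.
- exact: powR_interpolation.
by rewrite /= addr_ge0// powR_ge0.
Qed.

(** The sum of the series has a finite integral, hence is finite almost everywhere. *)
Lemma ae_cvg_series (f : nat -> T -> R) (C : R) :
  (forall k, measurable_fun D (f k)) -> (forall k x, D x -> 0 <= f k x) ->
  (forall m, (\sum_(0 <= k < m) \int[mu]_(x in D) (f k x)%:E <= C%:E)%E) ->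
  {ae mu, forall x, D x -> cvgn (series (f ^~ x)) }.
Proof.
move=> mf f0 fC.
have mE k : measurable_fun D (EFin \o f k) by apply/measurable_EFinP.
have E := @integral_nneseries _ _ _ mu D mD (fun k x => (f k x)%:E) mE f0.
pose F x := (\sum_(0 <= k <oo) (f k x)%:E)%E.
have F0 x : D x -> (0 <= F x)%E by move=> Dx; apply: nneseries_ge0 => k _ _; exact: f0.
have iF : (\int[mu]_(x in D) F x <= C%:E)%E.
  rewrite /F E; apply: lime_le.
    apply: is_cvg_ereal_nneg_natsum_cond => k _ _.
    by apply: integral_ge0 => x Dx; exact: f0.
  by apply: nearW => m; exact: fC.
have mF : measurable_fun D F.
  rewrite (_ : F = fun x => \sum_(k <oo | k \in xpredT) (f k x)%:E)%E.
    exact: (@ge0_emeasurable_sum _ _ _ D (fun k x => (f k x)%:E) xpredT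
      (fun k x Dx _ => f0 k x Dx) (fun k _ => mE k)).
  by apply/funext => x; apply: eq_eseriesl => k.
have intF : mu.-integrable D F.
  apply/integrableP; split; first exact: mF.
  have -> : (\int[mu]_(x in D) `|F x| = \int[mu]_(x in D) F x)%E.
    by apply: eq_integral => x /set_mem Dx; rewrite gee0_abs// F0.
  exact: le_lt_trans iF (ltry _).
apply: (ae_imp (integrable_ae mD intF)) => x h Dx; have {}h := h Dx.
apply: nondecreasing_is_cvgn.
  by apply: nondecreasing_series => k _ _; exact: f0.
exists (fine (F x)) => _ [m _ <-].
rewrite -lee_fin fineK// /series/= -sumEFin.
by apply: nneseries_lim_ge => k _ _; exact: f0.
Qed.

Lemma sum_geometric (q : R) m : 0 <= q -> q < 1 ->
  \sum_(0 <= k < m) q ^+ k <= (1 - q)^-1.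
Proof.
move=> q0 q1; have q1' : 0 < 1 - q by rewrite subr_gt0.
rewrite -[leRHS]mul1r ler_pdivlMr//.
suff -> : (\sum_(0 <= k < m) q ^+ k) * (1 - q) = 1 - q ^+ m by rewrite gerBl exprn_ge0.
elim: m => [|m IH]; first by rewrite big_geq// mul0r expr0 subrr.
by rewrite big_nat_recr//= mulrDl IH mulrBr mulr1 -exprSr addrA subrK.
Qed.

(** The form in which the Borel-Cantelli lemma is used: integrals that decay
    geometrically. *)
Lemma ae_series_geometric (f : nat -> T -> R) (C q : R) : 0 <= C -> 0 <= q -> q < 1 ->
  (forall k, measurable_fun D (f k)) -> (forall k x, D x -> 0 <= f k x) ->
  (forall k, (\int[mu]_(x in D) (f k x)%:E <= (C * q ^+ k)%:E)%E) ->
  {ae mu, forall x, D x -> cvgn (series (f ^~ x))}.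
Proof.
move=> C0 q0 q1 mf f0 fC; apply: (@ae_cvg_series _ (C * (1 - q)^-1)) => // m.
apply: (@le_trans _ _ (\sum_(0 <= k < m) (C * q ^+ k)%:E)%E).
  by apply: lee_sum => k _; exact: fC.
by rewrite sumEFin lee_fin -mulr_sumr ler_wpM2l// sum_geometric.
Qed.

Lemma cvg_moment_ae p (f : nat -> T -> R) g (C q : R) : 0 < p ->
  0 <= C -> 0 <= q -> q < 1 ->
  (forall k, measurable_fun D (f k)) -> measurable_fun D g ->
  (forall k, (moment mu D p (fun x => f k x - g x)%R <= (C * q ^+ k)%:E)%E) ->
  {ae mu, forall x, D x -> f k x @[k --> \oo] --> g x}.
Proof.
move=> p0 C0 q0 q1 mf mg fC.
have := @ae_series_geometric (fun k x => `|f k x - g x| `^ p) C q C0 q0 q1.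
have h1 k : measurable_fun D (fun x => `|f k x - g x| `^ p).
  by apply: measurable_powR_norm; exact: measurable_funB.
have fC' k : (\int[mu]_(x in D) (`|f k x - g x| `^ p)%:E <= (C * q ^+ k)%:E)%E.
  by have := fC k; rewrite momentE.
move=> /(_ h1 (fun k x _ => powR_ge0 _ _) fC')/ae_imp; apply => x h Dx.
have /cvgrPdist_lt h0 := cvg_series_cvg_0 (h Dx).
apply/cvgrPdist_lt => e e0; have [N _ NP] := h0 _ (powR_gt0 p e0).
exists N => // k /NP; rewrite sub0r normrN ger0_norm ?powR_ge0// distrC.
by apply: contraTT; rewrite -!leNgt; apply: ler_powR2; [exact: ltW|exact: ltW].
Qed.

(** Fatou's lemma; the powers are natural numbers so that they are continuous. *)
Lemma moment_fatou (k : nat) (f : nat -> T -> R) g (C : R) :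
  (forall m, measurable_fun D (f m)) -> measurable_fun D g ->
  {ae mu, forall x, D x -> f m x @[m --> \oo] --> g x} ->
  (exists N, forall m, (N <= m)%N -> (moment mu D k%:R (f m) <= C%:E)%E) ->
  (moment mu D k%:R g <= C%:E)%E.
Proof.
move=> mf mg fg [N fC].
pose F m x := (`|f (m + N)%N x| `^ k%:R)%:E.
have mF m : measurable_fun D (F m) by exact: measurable_moment.
have F0 m x : D x -> (0 <= F m x)%E by move=> _; rewrite lee_fin powR_ge0.
have -> : moment mu D k%:R g = (\int[mu]_(x in D) limn_einf (F ^~ x))%E.
  rewrite momentE; apply: ae_eq_integral => //.
  - exact: measurable_moment.
  - under eq_fun do rewrite limn_einf_lim.
    have -> : (fun x => limn (einfs (F ^~ x))) = (fun x => - limn_esup (fun m => - F m x))%E.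
      by apply/funext => x; rewrite -limn_einf_lim limn_esupN oppeK.
    apply: measurableT_comp => //; apply: measurable_fun_limn_esup => m.
    exact: measurableT_comp.
  apply: (ae_imp fg) => x h Dx; have {}h := h Dx.
  have c : F m x @[m --> \oo] --> (`|g x| `^ k%:R)%:E.
    apply: cvg_EFin; first exact: nearW.
    have := cvg_comp _ _ h (@exprn_continuous R k (g x)).
    move=> /(cvg_norm)/=; rewrite normrX -powR_mulrn// => c.
    rewrite -(cvg_shiftn N) in c; move: c; apply: cvg_trans; apply: near_eq_cvg; apply: nearW => m.
    by rewrite /= powR_mulrn// normrX.
  by have [-> _] := cvg_limn_einf_sup c.
apply: (le_trans (fatou mu mD mF F0)).
rewrite limn_einf_lim; apply: lime_le; first exact: is_cvg_einfs.
apply: nearW => m; apply: (@le_trans _ _ (moment mu D k%:R (f (m + N)%N))).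
  by rewrite momentE; apply: ereal_inf_lbound; exists m => //=.
by apply: fC; rewrite leq_addl.
Qed.

Hypothesis Dfin : (mu D < +oo)%E.

(** Riesz-Fischer. A subsequence with geometrically small increments converges almost
    everywhere, and Fatou's lemma gives the convergence of the whole sequence. *)
Lemma moment2_complete (f : nat -> T -> R) :
  (forall m, measurable_fun D (f m)) ->
  (forall e, 0 < e -> exists N, forall i j, (N <= i)%N -> (N <= j)%N ->
    (moment mu D 2 (fun x => f i x - f j x)%R <= e%:E)%E) ->
  exists2 g : T -> R, measurable_fun D g &
    forall e, 0 < e -> exists N, forall i, (N <= i)%N ->
      (moment mu D 2 (fun x => f i x - g x)%R <= e%:E)%E.
Proof.
move=> mf cf.
have h4 l : 0 < (4^-1 : R) ^+ l by rewrite exprn_gt0// invr_gt0.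
have /choice[N NP] l := cf _ (h4 l).
(* an increasing sequence of indices such that N l <= m l *)
pose m l := (\sum_(0 <= i < l.+1) (N i).+1)%N.
have mN l : (N l <= m l)%N by rewrite /m big_nat_recr//= -addSnnS addSn ltnW// -addnS leq_addl.
have mge l : (l <= m l)%N.
  elim: l => // l IH; rewrite /m big_nat_recr//= addnS ltnS.
  exact: leq_trans IH (leq_addr _ _).
have mS l : (m l <= m l.+1)%N by rewrite /m [X in (_ <= X)%N]big_nat_recr//= leq_addr.
have ml : {homo m : a b / (a <= b)%N} by apply: homo_leq => // ? ? ?; exact: leq_trans.
pose h l x := f (m l.+1) x - f (m l) x.
have mh l : measurable_fun D (h l) by exact: measurable_funB.
have hC l : (moment mu D 2 (h l) <= ((4^-1) ^+ l)%:E)%E.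
  by apply: NP; [exact: leq_trans (mS l)|].
have [M MD] : exists M : R, mu D = M%:E.
  by exists (fine (mu D)); rewrite fineK// ge0_fin_numE.
have M0 : 0 <= M by rewrite -lee_fin -MD.
have half0 : 0 < (2^-1 : R) by rewrite invr_gt0.
have h1 l : (\int[mu]_(x in D) (`|h l x|)%:E <= ((M + 1) * 2^-1 ^+ l)%:E)%E.
  have p2 : 0 < (2 : R) ^+ l by rewrite exprn_gt0.
  (* |h| <= 2^-l + 2^l h^2, with the weights that balance the bound 4^-l of hC *)
  have := @moment_le 1 2 (h l) (h l) (2^-1 ^+ l) (2 ^+ l) (mh l) (mh l) _ _ _.
  rewrite MD; have -> : moment mu D 1 (h l) = (\int[mu]_(x in D) (`|h l x|)%:E)%E.
    by rewrite momentE; apply: eq_integral => x _; rewrite powRr1.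
  move=> /(_ (exprn_ge0 _ (ltW half0)) (ltW p2)) H.
  apply: (le_trans (H _)) => [x|].
    rewrite powRr1// -[2]/(2%:R) powR_mulrn//.
    have e1 : 2 ^+ l * 2^-1 ^+ l = 1 :> R by rewrite -exprMn divff// expr1n.
    have p0 : 0 < 2^-1 ^+ l :> R by rewrite exprn_gt0.
    have n0 := normr_ge0 (h l x).
    have := sqr_ge0 (2 ^+ l * `|h l x| - 1).
    set y := `|h l x| in n0 *; set a := 2 ^+ l in e1 p2 *; set b := 2^-1 ^+ l in e1 p0 *.
    move=> sq; have : 0 <= b * (a * y - 1) ^+ 2 by rewrite mulr_ge0// ltW.
    have -> : b * (a * y - 1) ^+ 2 = (a * b) * a * y ^+ 2 - 2 * (a * b) * y + b by lra.
    rewrite e1; have : 0 <= a * y ^+ 2 by rewrite mulr_ge0 ?sqr_ge0// ltW.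
    lra.
  apply: (@le_trans _ _ ((2^-1 ^+ l)%:E * M%:E + (2 ^+ l)%:E * ((4^-1) ^+ l)%:E)%E).
    by apply: leeD => //; apply: lee_wpmul2l => //; rewrite lee_fin ltW.
  rewrite -!EFinM -EFinD lee_fin -exprMn.
  have -> : 2 * 4^-1 = 2^-1 :> R by lra.
  by rewrite mulrDl mul1r mulrC.
have aec : {ae mu, forall x, D x -> cvgn (fun l => f (m l) x)}.
  have half1 : 2^-1 < 1 :> R by lra.
  have M1 : 0 <= M + 1 by lra.
  have := @ae_series_geometric (fun l x => `|h l x|) (M + 1) 2^-1 M1 (ltW half0) half1.
  move=> /(_ (fun l => measurableT_comp (@normr_measurable _ _) (mh l)) (fun l x _ => normr_ge0 _) h1)/ae_imp.
  apply => x H Dx; have /normed_cvg := H Dx => c.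
  have -> : (fun l => f (m l) x) = (fun l => series (h ^~ x) l + f (m 0%N) x).
    apply/funext => l; rewrite addrC.
    exact: (eq_sum_telescope (fun l => f (m l) x)).
  by apply: is_cvgD => //; exact: is_cvg_cst.
pose g x := fine (limn_esup (fun l => (f (m l) x)%:E)).
have mg : measurable_fun D g.
  apply: (measurableT_comp (@fine_measurable R setT measurableT)).
  by apply: measurable_fun_limn_esup => l; apply/measurable_EFinP.
have gl : {ae mu, forall x, D x -> f (m l) x @[l --> \oo] --> g x}.
  apply: (ae_imp aec) => x H Dx; have c := H Dx.
  rewrite /g; have /cvg_limn_einf_sup[_ ->] : (f (m l) x)%:E @[l --> \oo] --> (limn (fun l => f (m l) x))%:E.
    by apply: cvg_EFin; [exact: nearW|exact: c].
  exact: c.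
exists g => // e e0; have [K KP] := cf _ e0; exists K => i Ki.
apply: (@moment_fatou 2 (fun l x => f i x - f (m l) x)).
- by move=> l; exact: measurable_funB.
- exact: measurable_funB.
- apply: (ae_imp gl) => x H Dx; apply: cvgB; [exact: cvg_cst|exact: H].
- exists K => l Kl; apply: KP => //; exact: leq_trans (mge l).
Qed.

(** Markov's inequality as the exponent tends to infinity: where |f| > s > c, the
    function (|f| / s)^k does not tend to 0, although its integral decays like
    (c / s)^k. The bounds are on exponents k > 1 because those on functions of
    W^{2,p}_0 are for p > 1. *)
Lemma ae_bounded_moments f (c C : R) : 0 <= c -> 0 <= C -> measurable_fun D f ->
  (forall k : nat, (1 < k)%N -> (moment mu D k%:R f <= (C * c ^+ k)%:E)%E) ->
  {ae mu, forall x, D x -> `|f x| <= c}.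
Proof.
move=> c0 C0 mf fC.
suff H (l : nat) : {ae mu, forall x, D x -> `|f x| <= c + l.+1%:R^-1}.
  apply: (ae_imp (ae_foralln H)) => x h Dx; apply/ler_addgt0Pl => e e0.
  have [N _ /(_ N (leqnn _)) NP] := near_infty_natSinv_lt (PosNum e0).
  apply: le_trans (h N Dx) _; rewrite addrC lerD2r ltW//.
set s := c + _; have s0 : 0 < s by rewrite ltr_wpDl// invr_gt0.
have q1 : c / s < 1 by rewrite ltr_pdivrMr// mul1r /s ltrDl invr_gt0.
have q0 : 0 <= c / s by rewrite divr_ge0// ltW.
have mk (k : nat) : measurable_fun D (fun x => `|s^-1 * f x| `^ k.+2%:R).
  by apply: measurable_powR_norm; exact: measurable_funM.
have int k : (\int[mu]_(x in D) (`|s^-1 * f x| `^ k.+2%:R)%:E <= (C * (c / s) ^+ k)%:E)%E.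
  have := @moment_scale k.+2%:R s^-1 f mf; rewrite !momentE => ->.
  apply: (@le_trans _ _ ((`|s^-1| `^ k.+2%:R)%:E * (C * c ^+ k.+2)%:E)%E).
    by rewrite -momentE; apply: lee_wpmul2l; [rewrite lee_fin powR_ge0|exact: fC].
  rewrite -EFinM lee_fin gtr0_norm ?invr_gt0// powR_mulrn; last by rewrite invr_ge0 ltW.
  rewrite mulrCA -exprMn mulrC [s^-1 * c]mulrC [leRHS]mulrC ler_wpM2r//.
  by apply: ler_wiXn2l => //; [exact: ltW|exact: leqW].
have := ae_series_geometric C0 q0 q1 mk (fun k x _ => powR_ge0 _ _) int.
move=> /ae_imp; apply => x h Dx.
have /cvgrPdist_lt/(_ 1 ltr01)[N _ /(_ N (leqnn _))] := cvg_series_cvg_0 (h Dx).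
rewrite sub0r normrN ger0_norm ?powR_ge0// powR_mulrn//.
rewrite expr_lt1// normrM gtr0_norm ?invr_gt0// mulrC ltr_pdivrMr// mul1r.
exact: ltW.
Qed.

Lemma integrable_moment2 f g : measurable_fun D f -> measurable_fun D g ->
  (moment mu D 2 f < +oo)%E -> (moment mu D 2 g < +oo)%E ->
  mu.-integrable D (fun x => (f x * g x)%:E).
Proof.
move=> mf mg f2 g2; apply/integrableP; split.
  by apply/measurable_EFinP; exact: measurable_funM.
have -> : (\int[mu]_(x in D) `|(f x * g x)%:E| = moment mu D 1 (fun x => f x * g x)%R)%E.
  by rewrite momentE; apply: eq_integral => x _; rewrite powRr1.
have := @moment_le2 1 2 2 _ f g 1 1 (measurable_funM mf mg) mf mg ler01 ler01.
rewrite !mul1e => H.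
apply: (le_lt_trans (H _)); last exact: lte_add_pinfty.
move=> x; rewrite powRr1// !mul1r -[2]/(2%:R) !powR_mulrn// normrM.
have := sqr_ge0 (`|f x| - `|g x|); have := mulr_ge0 (normr_ge0 (f x)) (normr_ge0 (g x)).
set a := `|f x|; set b := `|g x|; lra.
Qed.

Lemma integrable_moment1 p f : 1 <= p -> measurable_fun D f -> (moment mu D p f < +oo)%E ->
  mu.-integrable D (EFin \o f).
Proof.
move=> p1 mf fp; apply/integrableP; split; first exact/measurable_EFinP.
have -> : (\int[mu]_(x in D) `|(EFin \o f) x| = moment mu D 1 f)%E.
  by rewrite momentE; apply: eq_integral => x _; rewrite powRr1.
apply: le_lt_trans (moment_exponent _ p1 mf) _ => //.
exact: lte_add_pinfty.
Qed.

Lemma Lnorm_moment p f : p != 0 ->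
  ('N[mu]_p%:E[EFin \o (f \_ D)] `^ p)%E = moment mu D p f.
Proof.
move=> p0; rewrite poweR_Lnorm// momentE [RHS]integral_mkcond.
apply: eq_integral => x _; rewrite /= patchE [RHS]patchE; case: ifPn => // _.
by rewrite normr0 powR0.
Qed.

Lemma Lnorm_lt_moment p f (e : R) : 0 < p -> 0 < e ->
  (moment mu D p f < (e `^ p)%:E)%E -> ('N[mu]_p%:E[EFin \o (f \_ D)] < e%:E)%E.
Proof.
move=> p0 e0 h; rewrite ltNge; apply/negP => eN; move: h; apply/negP; rewrite -leNgt.
rewrite -Lnorm_moment ?gt_eqF// -poweR_EFin; apply: gt0_ler_poweR => //.
- exact: ltW.
- by rewrite in_itv/= leey lee_fin ltW.
- by rewrite in_itv/= leey Lnorm_ge0.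
Qed.

Lemma moment_lt_Lnorm p f (e : R) : 0 < p -> 0 < e ->
  ('N[mu]_p%:E[EFin \o (f \_ D)] < e%:E)%E -> (moment mu D p f <= (e `^ p)%:E)%E.
Proof.
move=> p0 e0 h.
rewrite -Lnorm_moment ?gt_eqF// -poweR_EFin; apply: gt0_ler_poweR => //.
- exact: ltW.
- by rewrite in_itv/= leey Lnorm_ge0.
- by rewrite in_itv/= leey lee_fin ltW.
- exact: ltW.
Qed.

Lemma mfun_patch f : (f \_ D \in mfun) <-> measurable_fun D f.
Proof.
rewrite inE/=; split; first by move=> /(measurable_restrictT _ mD).
by move=> h; apply/(measurable_restrictT _ mD).
Qed.

Lemma Lfun_moment p f : 0 < p -> (f \_ D) \in Lfun mu p%:E <->
  measurable_fun D f /\ (moment mu D p f < +oo)%E.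
Proof.
move=> p0; rewrite !inE/=; split.
  move=> /andP[/mfun_patch mf]; rewrite inE/= => fp; split => //.
  by rewrite -Lnorm_moment ?gt_eqF//; exact: poweR_lty.
move=> [/mfun_patch mf]; rewrite -Lnorm_moment ?gt_eqF// => fp; apply/andP; split => //.
by rewrite inE/=; apply: lty_poweRy fp; rewrite gt_eqF.
Qed.

Lemma Lnorm_oo_le f (c : R) : 0 <= c ->
  ('N[mu]_+oo[EFin \o (f \_ D)] <= c%:E)%E <-> {ae mu, forall x, D x -> `|f x| <= c}.
Proof.
move=> c0; rewrite unlock; case: ifPn => mu0.
  split=> [/ess_supP h|h].
    by apply: (ae_imp h) => x /=; rewrite patchE => + Ox; rewrite mem_set.
  apply/ess_supP; apply: (ae_imp h) => x /= H; rewrite patchE.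
  by case: ifPn => [/set_mem/H//|_]; rewrite normr0.
split=> [_|]; last by rewrite lee_fin.
exists setT; split => //; move: mu0; rewrite -leNgt => mu0.
by apply/eqP; rewrite eq_le mu0/=.
Qed.

Lemma Lfun_oo f : (f \_ D) \in Lfun mu +oo%E <-> measurable_fun D f /\
  exists2 c, 0 <= c & {ae mu, forall x, D x -> `|f x| <= c}.
Proof.
rewrite !inE/=; split.
  move=> /andP[/mfun_patch mf]; rewrite inE/= => fp; split => //.
  have N0 := Lnorm_ge0 mu +oo%E (EFin \o (f \_ D)).
  exists (fine ('N[mu]_+oo[EFin \o (f \_ D)])%E); first exact: fine_ge0.
  by apply/Lnorm_oo_le; rewrite ?fine_ge0// fineK// ge0_fin_numE.
move=> [/mfun_patch mf [c c0 /(Lnorm_oo_le _ c0) h]]; apply/andP; split => //.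
by rewrite inE/=; exact: le_lt_trans h (ltry _).
Qed.

Lemma moment_bounded p f (c : R) : 0 <= p -> 0 <= c -> measurable_fun D f ->
  {ae mu, forall x, D x -> `|f x| <= c} ->
  (moment mu D p f <= (c `^ p)%:E * mu D)%E.
Proof.
move=> p0 c0 mf fc; rewrite -integral_cst// momentE; apply: ae_ge0_le_integral => //.
- exact: measurable_moment.
- by move=> x _; rewrite lee_fin powR_ge0.
- by apply: (ae_imp fc) => x h Ox; rewrite lee_fin ler_powR2// h.
Qed.

Lemma moment_bounded_fin p f (c : R) : 0 <= p -> 0 <= c -> measurable_fun D f ->
  {ae mu, forall x, D x -> `|f x| <= c} -> (moment mu D p f < +oo)%E.
Proof.
move=> p0 c0 mf fc; apply: le_lt_trans (moment_bounded p0 c0 mf fc) _.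
by rewrite lte_mul_pinfty// lee_fin powR_ge0.
Qed.

Lemma moment_null p f : measurable_fun D f -> mu D = 0%E -> moment mu D p f = 0%E.
Proof.
by move=> mf D0; rewrite momentE; apply: null_set_integral => //; exact: measurable_moment.
Qed.

Lemma measurable_lin (c : R) f g : measurable_fun D f -> measurable_fun D g ->
  measurable_fun D (fun x => c * f x + g x).
Proof. by move=> mf mg; apply: measurable_funD => //; exact: measurable_funM. Qed.

Lemma measurable_scale (c : R) f : measurable_fun D f ->
  measurable_fun D (fun x => c * f x).
Proof. by move=> mf; exact: measurable_funM. Qed.

Lemma measurable_comb (a b : R) f g : measurable_fun D f -> measurable_fun D g ->
  measurable_fun D (fun x => a * f x + b * g x).
Proof. by move=> mf mg; apply: measurable_lin => //; exact: measurable_funM. Qed.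

Lemma moment_linE p (c : R) f g : 0 <= p -> measurable_fun D f -> measurable_fun D g ->
  (moment mu D p (fun x => c * f x + g x)%R <=
   ((2 * `|c|) `^ p)%:E * moment mu D p f + (2 `^ p)%:E * moment mu D p g)%E.
Proof.
move=> p0 mf mg.
have mcf : measurable_fun D (fun x => c * f x) by exact: measurable_funM.
apply: le_trans (moment_add p0 mcf mg) _.
by rewrite moment_scale// muleA -EFinM -powRM.
Qed.

Lemma Rintegral_mul_lin (c : R) f g h :
  measurable_fun D f -> measurable_fun D g -> measurable_fun D h ->
  (moment mu D 2 f < +oo)%E -> (moment mu D 2 g < +oo)%E -> (moment mu D 2 h < +oo)%E ->
  \int[mu]_(x in D) ((c * f x + g x) * h x) =
  c * \int[mu]_(x in D) (f x * h x) + \int[mu]_(x in D) (g x * h x).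
Proof.
move=> mf mg mh f2 g2 h2.
have i1 := integrable_moment2 mf mh f2 h2; have i2 := integrable_moment2 mg mh g2 h2.
rewrite -RintegralZl// -RintegralD//.
  by apply: eq_Rintegral => x _; rewrite mulrDl mulrA.
by have := integrableZl mD c i1; apply: eq_integrable.
Qed.

Lemma Rintegral_ae f g : measurable_fun D f -> measurable_fun D g ->
  {ae mu, forall x, D x -> f x = g x} ->
  \int[mu]_(x in D) f x = \int[mu]_(x in D) g x.
Proof.
move=> mf mg fg; congr fine; apply: ae_eq_integral => //; try exact/measurable_EFinP.
by apply: (ae_imp fg) => x h /h ->.
Qed.

Lemma Rintegral_sqr f : \int[mu]_(x in D) (f x * f x) = fine (moment mu D 2 f).
Proof.
rewrite momentE; congr fine; apply: eq_integral => x _.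
by rewrite -[2]/(2%:R) powR_mulrn// -normrX ger0_norm ?sqr_ge0.
Qed.

Lemma Rintegral_young f g (e : R) : 0 < e -> measurable_fun D f -> measurable_fun D g ->
  (moment mu D 2 f < +oo)%E -> (moment mu D 2 g < +oo)%E ->
  `|\int[mu]_(x in D) (f x * g x)| <=
  e^-1 * fine (moment mu D 2 f) + e * fine (moment mu D 2 g).
Proof.
move=> e0 mf mg f2 g2; have i := integrable_moment2 mf mg f2 g2.
apply: le_trans (le_normr_Rintegral mD i) _.
have e1 : 0 < e^-1 by rewrite invr_gt0.
have F f' : (moment mu D 2 f' < +oo)%E -> moment mu D 2 f' \is a fin_num.
  by move=> h; rewrite ge0_fin_numE// moment_ge0.
rewrite -lee_fin EFinD !EFinM (fineK (F _ f2)) (fineK (F _ g2)).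
have -> : (\int[mu]_(x in D) `|f x * g x|)%:E = moment mu D 1 (fun x => f x * g x)%R.
  rewrite momentE /Rintegral fineK.
    by apply: eq_integral => x _; rewrite powRr1.
  by apply: integrable_fin_num => //; exact: (integrable_norm i).
apply: (moment_le2 (measurable_funM mf mg) mf mg (ltW e1) (ltW e0)) => x.
rewrite powRr1// -[2]/(2%:R) !powR_mulrn// normrM.
have a0 := normr_ge0 (f x); have b0 := normr_ge0 (g x).
have : 0 <= e * (e^-1 * `|f x| - `|g x|) ^+ 2 by rewrite mulr_ge0 ?sqr_ge0// ltW.
set a := `|f x| in a0 *; set b := `|g x| in b0 *.
have ee : e * e^-1 = 1 by rewrite divff// gt_eqF.
have -> : e * (e^-1 * a - b) ^+ 2 = (e * e^-1) * e^-1 * a ^+ 2 - 2 * (e * e^-1) * (a * b) + e * b ^+ 2 by lra.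
have : 0 <= a * b by exact: mulr_ge0.
rewrite ee; lra.
Qed.

Lemma cvg_Rintegral_mul (f : nat -> T -> R) g h :
  (forall k, measurable_fun D (f k)) -> measurable_fun D g -> measurable_fun D h ->
  (forall k, moment mu D 2 (f k) < +oo)%E -> (moment mu D 2 g < +oo)%E ->
  (moment mu D 2 h < +oo)%E ->
  (forall e, 0 < e -> exists N, forall k, (N <= k)%N ->
     (moment mu D 2 (fun x => f k x - g x)%R <= e%:E)%E) ->
  \int[mu]_(x in D) (f k x * h x) @[k --> \oo] --> \int[mu]_(x in D) (g x * h x).
Proof.
move=> mf mg mh f2 g2 h2 fg; apply/cvgrPdist_le => e e0.
set H := fine (moment mu D 2 h); have H0 : 0 <= H by rewrite fine_ge0// moment_ge0.
pose s := e / (2 * (H + 1)); have s0 : 0 < s by rewrite divr_gt0// mulr_gt0//; lra.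
have [N NP] := fg (s * e / 2) (divr_gt0 (mulr_gt0 s0 e0) (ltr0Sn _ _)).
exists N => // k /= Nk; have {}NP := NP k Nk.
have mfg : measurable_fun D (fun x => f k x - g x) by exact: measurable_funB.
have fg2 : (moment mu D 2 (fun x => f k x - g x)%R < +oo)%E by exact: le_lt_trans NP (ltry _).
have -> : \int[mu]_(x in D) (g x * h x) - \int[mu]_(x in D) (f k x * h x) =
    - \int[mu]_(x in D) ((f k x - g x) * h x).
  have := @Rintegral_mul_lin (-1) g (f k) h mg (mf k) mh g2 (f2 k) h2.
  rewrite mulN1r; have -> : \int[mu]_(x in D) ((-1 * g x + f k x) * h x) =
    \int[mu]_(x in D) ((f k x - g x) * h x).
    by apply: eq_Rintegral => x _; rewrite mulN1r addrC.
  by move=> ->; rewrite opprD opprK.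
rewrite normrN; apply: le_trans (Rintegral_young s0 mfg mh fg2 h2) _.
have h1 : s^-1 * fine (moment mu D 2 (fun x => f k x - g x)%R) <= e / 2.
  rewrite mulrC ler_pdivrMr//; have := NP.
  rewrite -[X in (X <= _)%E]fineK ?ge0_fin_numE ?moment_ge0// lee_fin.
  by move=> h'; apply: le_trans h' _; lra.
have h3 : s * H <= e / 2.
  have -> : e / 2 = s * (H + 1) by rewrite /s invfM !mulrA mulfVK// gt_eqF//; lra.
  by rewrite ler_pM2l//; lra.
have : e / 2 * 2 = e by rewrite divfK.
by move=> ee; apply: le_trans (lerD h1 h3) _; lra.
Qed.

End moment.

(** * Borel and Lebesgue sets of R^n *)
Section rat_boxes.
Variables (R : realType) (m n : nat).

Definition rat_box (q : 'M[rat]_(m, n) * nat) : set 'M[R]_(m, n) :=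
  [set X | forall i j, `|X i j - ratr (q.1 i j)| < q.2.+1%:R^-1].

Definition rat_cbox (q : 'M[rat]_(m, n) * nat) : set 'M[R]_(m, n) :=
  [set X | forall i j, `|X i j - ratr (q.1 i j)| <= q.2.+1%:R^-1].

(** The countable family of the cubes with rational centres and radii 1/(k+1) is a
    base of the topology; this is what relates open sets to the sigma-algebra
    generated by the coordinates. *)
Lemma open_rat_boxP (U : set 'M[R]_(m, n)) (X : 'M[R]_(m, n)) : open U -> U X ->
  exists2 q, rat_box q X & rat_cbox q `<=` U.
Proof.
move=> oU UX.
have /nbhs_ballP[e /= e0 eU] : nbhs X U by exact: open_nbhs_nbhs.
have [k /= ke] : exists k : nat, k.+1%:R^-1 < e / 2 :> R.
  have := @near_infty_natSinv_lt R (PosNum (divr_gt0 e0 (ltr0n _ 2))).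
  by move=> [k _ /(_ k (leqnn _))]; exists k.
have k0 : 0 < k.+1%:R^-1 :> R by rewrite invr_gt0.
have dq (x : R) : {q : rat | `|x - ratr q| < k.+1%:R^-1}.
  apply/cid; have [|q] := @rat_in_itvoo _ (x - k.+1%:R^-1) (x + k.+1%:R^-1).
    by rewrite ltrBlDr -addrA ltrDl addr_gt0.
  by rewrite in_itv/= => h; exists q; rewrite ltr_distlC.
exists (\matrix_(i, j) sval (dq (X i j)), k) => /=.
  by move=> i j; rewrite mxE; case: (dq _).
move=> Y hY; apply: eU; split => // i j; rewrite /ball/=.
have := hY i j; rewrite /= mxE; case: (dq _) => q /= h1 h2.
rewrite (_ : X i j - Y i j = (X i j - ratr q) - (Y i j - ratr q)); last by lra.
apply: (le_lt_trans (ler_normB _ _)); apply: (lt_le_trans (ltr_leD h1 h2)).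
  by rewrite [leRHS]splitr lerD// ltW.
Qed.

Lemma measurable_preimage_open d (T : measurableType d) (D : set T)
    (F : T -> 'M[R]_(m, n)) (U : set 'M[R]_(m, n)) : measurable D ->
  (forall i j, measurable_fun D (fun x => F x i j)) -> open U ->
  measurable (D `&` F @^-1` U).
Proof.
move=> mD mF oU.
have -> : D `&` F @^-1` U = \bigcup_q
    (D `&` [set x | rat_box q `<=` U /\ rat_box q (F x)]).
  apply/seteqP; split => [x [Dx /= UFx]|x [q _] [Dx /= [qU qF]]]; last first.
    by split => //=; exact: qU.
  have [q qx qU] := open_rat_boxP oU UFx; exists q => //; split => //; split => //.
  by move=> Y qY; apply: qU => i j; exact/ltW/qY.
apply: countable_bigcupT_measurable; first exact: countableP.
move=> q; have [qU|qU] := pselect (rat_box q `<=` U); last first.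
  by rewrite (_ : _ `&` _ = set0)// -subset0 => x [_ []].
rewrite (_ : _ `&` _ = D `&` \big[setI/setT]_(ij : 'I_m * 'I_n)
    (D `&` (fun x => F x ij.1 ij.2) @^-1` (ball (ratr (q.1 ij.1 ij.2) : R) q.2.+1%:R^-1))).
  apply: measurableI => //; apply: bigsetI_measurable => ij _.
  apply: mF => //; apply: open_measurable; apply: ball_open.
apply/seteqP; split => [x [Dx [_ qFx]]|x [Dx]]; split => //.
  by rewrite -bigcap_seq => ij _; split => //=; rewrite /ball/= distrC.
split => // i j; move: b; rewrite -bigcap_seq => /(_ (i, j))/= [].
  by rewrite mem_index_enum.
by rewrite /ball/= distrC.
Qed.

End rat_boxes.

Section borel_lebesgue.
Variables (R : realType) (n : nat).
Notation V := 'rV[R]_n.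
Notation L := (lebesgue_rV_type R n).
Notation mu := (@lebesgue_rV R n).
Notation bmu := (@lebesgue_borel_rV R n).

Lemma open_borel (U : set V) : open U -> measurable U.
Proof.
move=> oU; rewrite -[U]setTI -(preimage_id U).
apply: (@measurable_preimage_open R 1 n _ _ setT id) => //.
by move=> i j; rewrite ord1; exact: measurable_rV_coord.
Qed.

Lemma closed_borel (U : set V) : closed U -> measurable U.
Proof.
move=> cU; rewrite -(setCK U); apply: measurableC; apply: open_borel; exact: closed_openC.
Qed.

Lemma continuous_borel (f : V -> R) : continuous f -> measurable_fun [set: V] f.
Proof.
move=> /continuousP cf mT; apply: (measurability _ (RGenOInfty.measurableE R)) => //.
move=> _ [_ [x ->] <-]; rewrite setTI; apply: open_borel; apply: cf.
exact: interval_open.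
Qed.

Lemma borel_lebesgue (A : set V) : measurable A -> measurable (A : set L).
Proof. exact: caratheodory_measurable_mu_ext. Qed.

Lemma lebesgue_borelE (A : set V) : measurable A -> mu A = bmu A.
Proof. exact: measurable_mu_extE. Qed.

Lemma measurable_id_borel : measurable_fun [set: L] (id : L -> V).
Proof. by move=> _ A mA; rewrite setTI; exact: borel_lebesgue. Qed.

Lemma borel_lebesgue_fun (D : set V) (f : V -> R) : measurable D ->
  measurable_fun D f -> measurable_fun (D : set L) (f : L -> R).
Proof. by move=> mD mf _ A mA; apply: borel_lebesgue; exact: mf. Qed.

Lemma ge0_integral_borel (D : set V) (f : V -> \bar R) : measurable D ->
  measurable_fun D f -> (forall x, D x -> 0 <= f x)%E ->
  (\int[mu]_(x in D) f x = \int[bmu]_(x in D) f x)%E.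
Proof.
move=> mD mf f0.
have := ge0_integral_pushforward measurable_id_borel mu mD mf.
rewrite preimage_id => <-; last by move=> x; rewrite inE => /f0.
by apply: (@eq_measure_integral _ V R D bmu
  (measure_function_pushforward__canonical__measure_function_Measure mu
    measurable_id_borel) f) => A mA _; exact: lebesgue_borelE.
Qed.

Lemma integral_borel (D : set V) (f : V -> \bar R) : measurable D ->
  measurable_fun D f -> (\int[mu]_(x in D) f x = \int[bmu]_(x in D) f x)%E.
Proof.
move=> mD mf; rewrite integralE [RHS]integralE; congr (_ - _)%E;
  apply: ge0_integral_borel => //.
- exact: measurable_funepos.
- exact: measurable_funeneg.
Qed.

(** The outer measure is an infimum over countable Borel covers; the hull is the
    intersection of almost optimal ones. *)
Lemma borel_hull (A : set L) : (mu A < +oo)%E ->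
  exists G : set V, [/\ measurable G, A `<=` G & mu G = mu A].
Proof.
move=> Afin.
have cov (k : nat) : exists G : set V, [/\ measurable G, A `<=` G &
    (mu G < mu A + (k.+1%:R^-1)%:E)%E].
  have : (mu A < mu A + (k.+1%:R^-1)%:E)%E.
    by rewrite lteDl ?lte_fin ?invr_gt0// ge0_fin_numE.
  rewrite {1}/lebesgue_rV /completed_measure_extension /mu_ext.
  move=> /ereal_inf_lt[_ [F [mF AF] <-]] hF.
  exists (\bigcup_i F i); split => //; first exact: bigcup_measurable.
  rewrite (le_lt_trans _ hF)// lebesgue_borelE; last exact: bigcup_measurable.
  by apply: measure_sigma_subadditive => //; exact: bigcup_measurable.
have /choice[G hG] := cov.
have mG : measurable (\bigcap_k G k) by apply: bigcapT_measurable => k; have [] := hG k.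
exists (\bigcap_k G k); split => //.
  by move=> x Ax k _; have [_ + _] := hG k; apply.
apply/eqP; rewrite eq_le; apply/andP; split; last first.
  by apply: le_mu_ext => x Ax k _; have [_ + _] := hG k; exact.
apply/lee_addgt0Pr => e e0.
have [k _ /(_ k (leqnn _)) ke] := @near_infty_natSinv_lt R (PosNum e0).
rewrite (@le_trans _ _ (mu (G k)))//.
  by apply: le_mu_ext => x; exact.
have [_ _ /ltW/le_trans] := hG k; apply; rewrite leeD2l// lee_fin; exact/ltW.
Qed.

(** Lebesgue sets are Borel sets up to negligible sets, so that integrals of a function
    over Borel sets determine its integrals over Lebesgue sets. *)
Lemma borel_hull_negligible (A : set L) : measurable A -> (mu A < +oo)%E ->
  exists G : set V, [/\ measurable G, A `<=` G & mu (G `\` A) = 0%E].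
Proof.
move=> mA Afin; have [G [mG AG GA]] := borel_hull Afin.
exists G; split => //; rewrite measureD//=; last by rewrite GA.
  by rewrite (_ : G `&` A = A) ?GA ?subee ?ge0_fin_numE//; exact/setIidPr.
exact: borel_lebesgue.
Qed.

End borel_lebesgue.

Section cube.
Variable R : realType.

Definition cube n (M : R) : set 'rV[R]_n := [set x | forall i, `|x ord0 i| <= M].

Lemma cube_closed n M : closed (@cube n M).
Proof.
rewrite (_ : cube M = \bigcap_i [set x : 'rV[R]_n | `|x ord0 i| <= M]); last first.
  by apply/seteqP; split => [x h i _|x h i]; apply: h.
apply: closed_bigI => i _; apply: (@closed_comp _ _ (fun x : 'rV[R]_n => `|x ord0 i|) [set x | x <= M]).
  move=> x _; apply: (@continuous_comp _ _ _ (fun x : 'rV[R]_n => x ord0 i) (@Num.norm _ R)).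
    exact: coord_continuous.
  exact: norm_continuous.
exact: closed_le.
Qed.

Lemma cube_borel n M : measurable (@cube n M).
Proof. by apply: closed_borel; exact: cube_closed. Qed.

Lemma rV_cons_cube n M : @rV_cons R n @^-1` (cube M) = `[- M, M] `*` cube M.
Proof.
apply/seteqP; split => [[t x] /= h|[t x] /= [h1 h2] i].
  split => /=.
    have := h ord0; rewrite mxE unlift_none/= in_itv/= -ler_norml//.
  by move=> i; have := h (lift ord0 i); rewrite mxE liftK.
rewrite mxE; case: (unliftP ord0 i) => [j|] _ //=.
by move: h1; rewrite in_itv/= -ler_norml.
Qed.

Lemma cube_fin n M : (lebesgue_borel_rV R n (@cube n M) < +oo)%E.
Proof.
elim: n => [|n IH] /=; first by rewrite /dirac/= indicE ltry.
rewrite /lebesgue_rV_step /pushforward rV_cons_cube.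
have -> : forall A B, measurable A -> measurable B ->
    (@lebesgue_measure R \x lebesgue_borel_rV R n)%E (A `*` B) =
    (lebesgue_measure A * lebesgue_borel_rV R n B)%E.
- exact: product_measure1E.
- rewrite lte_mul_pinfty//.
  rewrite ge0_fin_numE// lebesgue_measure_itv/=; case: ifP => _ //.
  by rewrite -EFinB ltry.
- exact: measurable_itv.
- exact: cube_borel.
Qed.

Lemma bounded_cube n (A : set 'rV[R]_n) : bounded_set A ->
  exists2 M : R, 0 < M & A `<=` cube M.
Proof.
move=> [M0 [_ M0A]]; exists (Num.max 1 (M0 + 1)); first by rewrite lt_max ltr01.
move=> x Ax i; have := M0A (Num.max 1 (M0 + 1)) _ x Ax.
rewrite /= lt_max ltrDl ltr01 orbT => /(_ isT)/(le_trans _); apply.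
have [/= y] := @mx_normrE R 1 n x.
rewrite /Num.norm/= mx_normrE.
exact: (@le_bigmax _ _ _ 0 (fun i : 'I_1 * 'I_n => `|x i.1 i.2|) (ord0, i)).
Qed.

Lemma bounded_lebesgue_fin n (A : set 'rV[R]_n) : bounded_set A ->
  (@lebesgue_rV R n A < +oo)%E.
Proof.
move=> /bounded_cube[M _ AM]; rewrite (le_lt_trans _ (cube_fin n M))//.
rewrite -lebesgue_borelE; last exact: cube_borel.
exact: le_mu_ext.
Qed.

Lemma compact_borel n (K : set 'rV[R]_n) : compact K -> measurable K.
Proof. by move=> cK; apply: closed_borel; exact: (compact_closed (@norm_hausdorff _ _)). Qed.

Lemma compact_lebesgue_fin n (K : set 'rV[R]_n) : compact K ->
  (@lebesgue_rV R n K < +oo)%E.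
Proof. by move=> /compact_bounded; exact: bounded_lebesgue_fin. Qed.

End cube.

(** * Smooth functions and bump functions *)
Section flat.
Variable R : realType.
Implicit Types (p : {poly R}) (t : R).

(** For the polynomial 1 this is the classical function that is smooth, flat at 0 and
    positive exactly on the positive reals. Arbitrary polynomials in 1/t make the
    family stable under differentiation. *)
Definition flat p t : R := if 0 < t then p.[t^-1] * expR (- t^-1) else 0.

Lemma poly_growth p : exists C k, 0 <= C /\ forall x, 1 <= x -> `|p.[x]| <= C * x ^+ k.
Proof.
elim/poly_ind: p => [|p c [C [k [C0 hC]]]].
  by exists 0, 0%N; split => // x _; rewrite horner0 normr0 mul0r.
exists (C + `|c|), k.+1; split; first by rewrite addr_ge0.
move=> x x1; have x0 : 0 <= x by exact: le_trans x1.
rewrite hornerMXaddC (le_trans (ler_normD _ _))// mulrDl lerD//.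
  by rewrite normrM (ger0_norm x0) exprSr mulrA ler_wpM2r// hC.
by rewrite ler_peMr// exprn_ege1.
Qed.

(** The factor t^2 gives the derivative 0 at 0; it comes from exp(1/t) dominating
    every power of 1/t. *)
Lemma flat_le p : exists2 C, 0 <= C & forall t, t <= 1 -> `|flat p t| <= C * t ^+ 2.
Proof.
have [C [k [C0 hC]]] := poly_growth p.
exists (C * (k.+2)`!%:R); first by rewrite mulr_ge0.
move=> t t1; rewrite /flat; case: ifPn => t0; last by rewrite normr0 mulr_ge0 ?sqr_ge0 ?mulr_ge0.
have tv1 : 1 <= t^-1 by rewrite invf_ge1.
have tv0 : 0 < t^-1 by rewrite invr_gt0.
rewrite normrM (ger0_norm (expR_ge0 _)) expRN.
have h := expR_ge1Dxn k.+1 (ltW tv0).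
have f0 : 0 < (k.+2)`!%:R :> R by rewrite ltr0n fact_gt0.
have {}h : t^-1 ^+ k.+2 <= (k.+2)`!%:R * expR t^-1.
  rewrite mulrC -ler_pdivrMr//; apply: le_trans h; rewrite lerDr//.
rewrite ler_pdivrMr ?expR_gt0// (le_trans (hC _ tv1))//.
rewrite -!mulrA ler_wpM2l//.
apply: (@le_trans _ _ (t ^+ 2 * t^-1 ^+ k.+2)).
  by rewrite -[k.+2]addn2 exprD [_ ^+ k * _]mulrC mulrA -exprMn divff ?gt_eqF// expr1n mul1r.
rewrite [leRHS](_ : _ = t ^+ 2 * ((k.+2)`!%:R * expR t^-1)); last by lra.
by rewrite ler_wpM2l ?sqr_ge0.
Qed.

Lemma flat_neg p t : t <= 0 -> flat p t = 0.
Proof. by rewrite /flat ltNge => ->. Qed.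

Lemma is_derive_flat p t : is_derive t 1 (flat p) (flat ('X^2 * (p - p^`())) t).
Proof.
have [t0|t0|->] := ltgtP t 0.
- rewrite (flat_neg _ (ltW t0)).
  apply: (@near_eq_is_derive _ _ _ (cst 0)).
  near=> s; rewrite flat_neg//; apply/ltW; near: s.
  exact: lt_nbhsl.
- apply: (@near_eq_is_derive _ _ _ ((horner p \o GRing.inv) \* (expR \o (fun t => - t^-1)))).
    near=> s; rewrite /flat ifT//; near: s; exact: lt_nbhsr.
  have tn0 : t != 0 by rewrite gt_eqF.
  have dV : is_derive t 1 (GRing.inv : R -> R) (- t ^- 2).
    have := @is_deriveV R id t 1 1 tn0 (is_derive_id _ _).
    by rewrite /GRing.scale/= mulr1.
  have dp : is_derive t^-1 1 (horner p) (p^`()).[t^-1].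
    apply: DeriveDef; first exact: derivable_horner.
    by rewrite -derive1E derivE.
  have dpV := is_derive1_comp dp dV.
  have dNV : is_derive t 1 (fun t : R => - t^-1) (t ^- 2).
    by have := is_deriveN dV; rewrite opprK.
  have deV := @is_derive1_comp _ expR (fun t : R => - t^-1) t _ _ (is_derive_expR _) dNV.
  have D := is_deriveM dpV deV; apply: (is_derive_eq D).
  rewrite /flat t0 hornerM hornerXn hornerD hornerN /GRing.scale/=.
  rewrite -exprVn; lra.
- rewrite (flat_neg _ (lexx 0)); have [C C0 hC] := flat_le p.
  have F0 : (fun h : R => h^-1 *: ((flat p \o shift 0) (h *: (1 : R)) - flat p 0)) @ 0^' --> (0 : R).
    apply/cvgr0Pnorm_le => e e0; near=> h.
    rewrite (flat_neg _ (lexx 0)) subr0 /= addr0 [h%:A]mulr1 normrM normfV.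
    have h0 : 0 < `|h| by rewrite normr_gt0; near: h; exact: nbhs_dnbhs_neq.
    rewrite ler_pdivrMl// (le_trans (hC _ _))//.
      rewrite (le_trans (ler_norm _))//; near: h; apply: dnbhs0_le; exact: ltr01.
    rewrite -(real_normK (num_real h)) expr2 mulrCA ler_wpM2l//.
    have : `|h| <= e / (C + 1) by near: h; apply: dnbhs0_le; rewrite divr_gt0// ltr_wpDl.
    rewrite ler_pdivlMr ?ltr_wpDl// => /(le_trans _); apply.
    by rewrite mulrDr mulr1 mulrC lerDl.
  apply: DeriveDef; first by apply/cvg_ex; exists 0.
  exact/cvg_lim.
Unshelve. all: by end_near. Qed.
End flat.

Section second_derivatives.
Variables (R : realType) (V : normedModType R).
Implicit Types (f : V -> R) (x u v : V).

Lemma is_derive_line f x u (s : R) : derivable f (x + s *: u) u ->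
  is_derive s (1 : R) (fun s : R => f (x + s *: u)) ('D_u f (x + s *: u)).
Proof.
move=> df.
have E : (fun h : R => h^-1 *: (((fun s : R => f (x + s *: u)) \o shift s) (h *: (1 : R)) - f (x + s *: u))) =
         (fun h : R => h^-1 *: ((f \o shift (x + s *: u)) (h *: u) - f (x + s *: u))).
  by apply/funext => h /=; rewrite [h%:A](_ : _ = h) ?scalerDl 1?addrCA//; exact: mulr1.
by apply: DeriveDef; rewrite /derivable /derive E.
Qed.

Lemma MVT_line f x u (h : R) : 0 < h -> (forall y, derivable f y u) ->
  exists2 s, 0 <= s <= h & f (x + h *: u) - f x = h * 'D_u f (x + s *: u).
Proof.
move=> h0 df.
have [|s + e] := @MVT R (fun s => f (x + s *: u)) (fun s => 'D_u f (x + s *: u)) _ _ h0 (fun s _ => is_derive_line (df _)).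
  by apply: derivable_within_continuous => s _; have [] := is_derive_line (df (x + s *: u)).
rewrite in_itv/= => /andP[/ltW s0 /ltW sh]; exists s; first by rewrite s0.
by move: e; rewrite scale0r addr0 subr0 mulrC.
Qed.

Lemma derive_translate f x u v : 'D_u (fun y => f (y + v)) x = 'D_u f (x + v).
Proof.
rewrite /derive; set F := (X in lim (X @ _) = _); set G := (X in _ = lim (X @ _)).
by rewrite (_ : F = G)//; apply/funext => k; rewrite /F/G /= addrA.
Qed.

Lemma derivable_translate f x u v :
  derivable f (x + v) u -> derivable (fun y => f (y + v)) x u.
Proof.
rewrite /derivable; set F := (X in cvg (X @ _)); set G := (X in _ -> cvg (X @ _)).
by rewrite (_ : G = F)//; apply/funext => k; rewrite /F/G /= addrA.
Qed.

(** The second difference of f along u and v is, by two applications of the mean value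
    theorem, a value of the second derivative near x; exchanging u and v gives the
    other mixed derivative for the same difference. *)
Lemma MVT_second f x u v (h : R) : 0 < h ->
  (forall y, derivable f y u) -> (forall y, derivable ('D_u f) y v) ->
  exists s t, [/\ 0 <= s <= h, 0 <= t <= h &
   f (x + h *: u + h *: v) - f (x + h *: u) - f (x + h *: v) + f x =
   h ^+ 2 * 'D_v ('D_u f) (x + s *: u + t *: v)].
Proof.
move=> h0 df ddf.
have dg y : derivable (fun y => f (y + h *: v) - f y) y u.
  apply: derivableB => //.
  exact: derivable_translate.
have [s sh es] := MVT_line x h0 dg.
have [t th et] := MVT_line (x + s *: u) h0 ddf.
exists s, t; split => //.
rewrite expr2 -mulrA -et -[RHS](_ : h * 'D_u (fun y => f (y + h *: v) - f y) (x + s *: u) = _).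
  rewrite -es; lra.
congr (_ * _); rewrite deriveB ?derive_translate//.
exact: derivable_translate.
Qed.

(** Schwarz' theorem, for directional derivatives that are continuous at x. *)
Lemma derive_comm f x u v :
  (forall y, derivable f y u) -> (forall y, derivable f y v) ->
  (forall y, derivable ('D_u f) y v) -> (forall y, derivable ('D_v f) y u) ->
  {for x, continuous ('D_v ('D_u f))} -> {for x, continuous ('D_u ('D_v f))} ->
  'D_v ('D_u f) x = 'D_u ('D_v f) x.
Proof.
move=> dfu dfv dfuv dfvu cuv cvu.
apply/eqP; rewrite -subr_eq0 -normr_le0; apply/ler_addgt0Pr => e e0; rewrite add0r.
have e20 : 0 < e / 2 by rewrite divr_gt0.
have /cvgrPdist_le /(_ _ e20) /nbhs_ballP[d1 /= d10 h1] := cuv.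
have /cvgrPdist_le /(_ _ e20) /nbhs_ballP[d2 /= d20 h2] := cvu.
pose d := Num.min d1 d2; have d0 : 0 < d by rewrite lt_min d10.
pose N := `|u| + `|v| + 1.
have N0 : 0 < N by rewrite ltr_wpDl// addr_ge0.
pose h := d / 2 / N; have h0 : 0 < h by rewrite !divr_gt0.
have near_x s t : 0 <= s <= h -> 0 <= t <= h -> `|x - (x + s *: u + t *: v)| < d.
  move=> /andP[s0 sh] /andP[t0 th]; rewrite -addrA opprD addrA subrr sub0r normrN.
  rewrite (le_lt_trans (ler_normD _ _))// !normrZ !ger0_norm//.
  apply: (@le_lt_trans _ _ (h * N)).
    rewrite /N 2!mulrDr -[X in X <= _]addr0 lerD//; last by rewrite mulr1 ltW.
    by rewrite lerD// ler_wpM2r.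
  by rewrite /h divfK ?gt_eqF// ltr_pdivrMr// ltr_pMr// ltr1n.
have [s [t [sh th e1]]] := MVT_second x h0 dfu dfuv.
have [s' [t' [sh' th' e2]]] := MVT_second x h0 dfv dfvu.
have {e1 e2} E : 'D_v ('D_u f) (x + s *: u + t *: v) = 'D_u ('D_v f) (x + s' *: v + t' *: u).
  have h20 : h ^+ 2 != 0 by rewrite expf_neq0// gt_eqF.
  apply: (mulfI h20); apply: (etrans (esym e1)); apply: etrans e2.
  by rewrite [x + h *: v + h *: u]addrAC; congr (_ + _); exact: addrAC.
have k1 : `|'D_v ('D_u f) x - 'D_v ('D_u f) (x + s *: u + t *: v)| <= e / 2.
  apply: h1; rewrite -ball_normE; apply: lt_le_trans (near_x _ _ sh th) _.
  by rewrite ge_min lexx.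
have k2 : `|'D_u ('D_v f) x - 'D_u ('D_v f) (x + s' *: v + t' *: u)| <= e / 2.
  apply: h2; rewrite -ball_normE addrAC; apply: lt_le_trans (near_x _ _ th' sh') _.
  by rewrite ge_min lexx orbT.
rewrite -E in k2; apply: le_trans (ler_distD ('D_v ('D_u f) (x + s *: u + t *: v)) _ _) _.
move: k1 k2; move: ('D_v ('D_u f) x) ('D_u ('D_v f) x) ('D_v ('D_u f) (x + _ + _)).
by move=> y z w yw zw; rewrite [X in _ + X]distrC (splitr e) lerD.
Qed.

End second_derivatives.

Section smooth.
Variables (R : realType) (n : nat).
Notation V := 'rV[R]_n.
Implicit Types (f g phi : V -> R) (i j k : 'I_n).

Definition smooth phi := forall a x, differentiable (partial a phi) x.

(** An algebra of functions that is stable under the partial derivatives, hence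
    consists of smooth functions: no induction on the order of differentiation has to
    deal with explicit derivatives. *)
Inductive flat_alg : (V -> R) -> Prop :=
| flat_coord p s c i : flat_alg (fun x : V => flat p (s * x ord0 i + c))
| flat_cst c : flat_alg (cst c)
| flat_add f g : flat_alg f -> flat_alg g -> flat_alg (f \+ g)
| flat_mul f g : flat_alg f -> flat_alg g -> flat_alg (f \* g).

Lemma differentiable_affine s c i x :
  differentiable (fun x : V => s * x ord0 i + c) x.
Proof.
apply: differentiableD => //; apply: differentiableM => //.
exact: differentiable_coord.
Qed.

Lemma differentiable_flat p (t : R) : differentiable (flat p) t.
Proof. by apply/derivable1_diffP; have [] := is_derive_flat p t. Qed.

Lemma flat_alg_differentiable f x : flat_alg f -> differentiable f x.
Proof.
elim=> {f} [p s c i|c|f g _ df _ dg|f g _ df _ dg].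
- apply: (@differentiable_comp _ _ _ _ (fun x : V => s * x ord0 i + c)).
    exact: differentiable_affine.
  exact: differentiable_flat.
- exact: differentiable_cst.
- exact: differentiableD.
- exact: differentiableM.
Qed.

Lemma derive_flat_coord p (s c : R) i k (x : V) :
  'D_(delta_mx ord0 k) (fun x : V => flat p (s * x ord0 i + c)) x =
  (s * (i == k)%:R) * flat ('X^2 * (p - p^`())) (s * x ord0 i + c).
Proof.
pose aff := (fun x : V => s * x ord0 i + c).
have daff : differentiable aff x by exact: differentiable_affine.
have E : 'D_(delta_mx ord0 k) aff x = s * (i == k)%:R.
  have dc : is_derive x (delta_mx ord0 k) (fun x : V => x ord0 i) (i == k)%:R.
    apply: DeriveDef; first by apply: diff_derivable; exact: differentiable_coord.
    apply: cvg_lim => //; apply: cvg_near_cst; near=> h.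
    rewrite /= !mxE/= addrK [_ *: _]mulrA mulVf ?mul1r//.
    by near: h; exact: nbhs_dnbhs_neq.
  rewrite /aff derive_val//.
  by rewrite [LHS](_ : _ = s *: (i == k)%:R + x ord0 i *: 0 + 0)// scaler0 !addr0.
rewrite deriveE; last by apply: differentiable_comp daff (differentiable_flat _ _).
rewrite (diff_comp daff (differentiable_flat _ _))/= -(deriveE _ daff) E.
have := is_derive_flat p (aff x); rewrite /aff => -[dd vv].
rewrite -[X in 'd _ _ X](mulr1 (s * _)) -[X in 'd _ _ X]/((s * (i == k)%:R) *: (1 : R)).
by rewrite linearZ/= -deriveE ?vv//; exact: differentiable_flat.
Unshelve. all: by end_near. Qed.

Lemma flat_alg_derive f k : flat_alg f -> flat_alg ('D_(delta_mx ord0 k) f).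
Proof.
elim=> {f} [p s c i|c|f g hf df hg dg|f g hf df hg dg].
- rewrite (_ : 'D__ _ = cst (s * (i == k)%:R) \*
      (fun x : V => flat ('X^2 * (p - p^`())) (s * x ord0 i + c))).
    by apply: flat_mul; [exact: flat_cst|exact: flat_coord].
  by apply/funext => x; rewrite derive_flat_coord.
- rewrite (_ : 'D__ _ = cst 0); first exact: flat_cst.
  by apply/funext => x; rewrite derive_cst.
- rewrite (_ : 'D__ _ = 'D_(delta_mx ord0 k) f \+ 'D_(delta_mx ord0 k) g).
    exact: flat_add.
  apply/funext => x; rewrite deriveD//; apply: diff_derivable;
    exact: flat_alg_differentiable.
- rewrite (_ : 'D__ _ = (f \* 'D_(delta_mx ord0 k) g) \+ (g \* 'D_(delta_mx ord0 k) f)).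
    by apply: flat_add; apply: flat_mul.
  apply/funext => x; rewrite deriveM//; apply: diff_derivable;
    exact: flat_alg_differentiable.
Qed.

Lemma flat_alg_smooth f : flat_alg f -> smooth f.
Proof.
move=> hf a x; apply: flat_alg_differentiable.
by elim: a => //= i a; exact: flat_alg_derive.
Qed.

Lemma flat_alg_prod (r : seq 'I_n) (F : 'I_n -> V -> R) :
  (forall i, flat_alg (F i)) -> flat_alg (fun x => \prod_(i <- r) F i x).
Proof.
move=> hF; elim: r => [|i r IH].
  rewrite (_ : (fun x => _) = cst 1); first exact: flat_cst.
  by apply/funext => x; rewrite big_nil.
rewrite (_ : (fun x => _) = F i \* (fun x => \prod_(i <- r) F i x)).
  exact: flat_mul.
by apply/funext => x; rewrite big_cons.
Qed.

(** As m tends to infinity these functions increase to the indicator function of the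
    open box with corners a and b. *)
Definition box_bump (a b : V) (m : R) (x : V) : R :=
  \prod_(i < n) (flat 1 (m * x ord0 i + - (m * a ord0 i)) *
                 flat 1 (- m * x ord0 i + m * b ord0 i)).

Lemma box_bump_smooth (a b : V) m : smooth (box_bump a b m).
Proof.
apply: flat_alg_smooth; apply: flat_alg_prod => i.
by apply: flat_mul; exact: flat_coord.
Qed.

Lemma flat1_itv (t : R) : 0 <= flat 1 t <= 1.
Proof.
rewrite /flat; case: ifP => [t0|_]; last by rewrite lexx ler01.
by rewrite hornerC mul1r expR_ge0 -expR0 ler_expR oppr_le0 invr_ge0 ltW.
Qed.

Lemma box_bump_itv (a b : V) m x : 0 <= box_bump a b m x <= 1.
Proof.
rewrite /box_bump; apply/andP; split.
  by apply: prodr_ge0 => i _; rewrite mulr_ge0//; exact: (proj1 (andP (flat1_itv _))).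
rewrite -[leRHS](_ : \prod_(i < n) 1 = 1); last by rewrite big1.
apply: ler_prod => i _.
have /andP[h1 h2] := flat1_itv (m * x ord0 i + - (m * a ord0 i)).
have /andP[h3 h4] := flat1_itv (- m * x ord0 i + m * b ord0 i).
by rewrite mulr_ge0// mulr_ile1.
Qed.

Lemma flat1_cvg (t : R) : 0 < t -> flat 1 (k.+1%:R * t) @[k --> \oo] --> (1 : R).
Proof.
move=> t0.
have E : (fun k : nat => flat 1 (k.+1%:R * t)) = (fun k : nat => expR (- (k.+1%:R^-1 * t^-1))).
  by apply/funext => k; rewrite /flat mulr_gt0// hornerC mul1r invfM.
have h1 : (fun k : nat => k.+1%:R^-1 * t^-1) @ \oo --> (0 : R).
  have h := cvgM (@cvg_harmonic R) (@cvg_cst _ t^-1 _ \oo _).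
  by rewrite mul0r in h; exact: h.
have := @continuous_cvg _ _ _ _ _ (fun k : nat => - (k.+1%:R^-1 * t^-1)) expR _
  (@continuous_expR R _) (cvgN h1).
by rewrite oppr0 expR0 E => h; exact: h.
Qed.

Definition obox (a b : V) : set V :=
  [set x | forall i, a ord0 i < x ord0 i < b ord0 i].
Definition cbox (a b : V) : set V :=
  [set x | forall i, a ord0 i <= x ord0 i <= b ord0 i].

Lemma box_bump_out (a b : V) m x : 0 < m -> ~ obox a b x -> box_bump a b m x = 0.
Proof.
move=> m0 /existsNP[i /negP]; rewrite negb_and -!leNgt => h.
rewrite /box_bump (bigD1 i)//=; case/orP: h => h.
  by rewrite flat_neg ?mul0r// -mulrN -mulrDr pmulr_rle0// subr_le0.
by rewrite [flat 1 (- m * _ + _)]flat_neg ?mulr0 ?mul0r// mulNr -mulrN -mulrDr pmulr_rle0// addrC subr_le0.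
Qed.

Lemma box_bump_cvg (a b : V) x : obox a b x -> box_bump a b k.+1%:R x @[k --> \oo] --> (1 : R).
Proof.
move=> abx; rewrite /box_bump.
have cvg_prod (r : seq 'I_n) : (\prod_(i <- r) (flat 1 (k.+1%:R * x ord0 i + - (k.+1%:R * a ord0 i)) *
                 flat 1 (- k.+1%:R * x ord0 i + k.+1%:R * b ord0 i))) @[k --> \oo] --> (1 : R).
  elim: r => [|i r IH].
    by under eq_fun do rewrite big_nil; exact: cvg_cst.
  under eq_fun do rewrite big_cons.
  have /andP[ax xb] := abx i.
  have h1 : flat 1 (k.+1%:R * x ord0 i + - (k.+1%:R * a ord0 i)) @[k --> \oo] --> (1 : R).
    under eq_fun do rewrite -mulrBr.
    by apply: flat1_cvg; rewrite subr_gt0.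
  have h2 : flat 1 (- k.+1%:R * x ord0 i + k.+1%:R * b ord0 i) @[k --> \oo] --> (1 : R).
    under eq_fun do rewrite mulNr -mulrN -mulrDr addrC.
    by apply: flat1_cvg; rewrite subr_gt0.
  have h3 := cvgM (cvgM h1 h2) IH; rewrite !mulr1 in h3; exact: h3.
exact: cvg_prod.
Qed.

Lemma cbox_compact (a b : V) : compact (cbox a b).
Proof.
rewrite (_ : cbox a b = [set x : V | forall i, `[a ord0 i, b ord0 i]%classic (x ord0 i)]).
  apply: (@rV_compact R n (fun i => `[a ord0 i, b ord0 i]%classic)) => i.
  exact: segment_compact.
by apply/seteqP; split => x h i; have := h i; rewrite /= in_itv.
Qed.

Lemma test_fun_bump (Om : set V) (a b : V) m : 0 < m -> cbox a b `<=` Om ->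
  test_fun Om (box_bump a b m).
Proof.
move=> m0 abOm; split; first exact: box_bump_smooth.
exists (cbox a b); split => //; first exact: cbox_compact.
move=> x abx; apply: box_bump_out => // h; apply: abx => i.
by have /andP[/ltW-> /ltW->] := h i.
Qed.

Lemma smooth_derive phi i : smooth phi -> smooth ('D_(delta_mx ord0 i) phi).
Proof. by move=> sphi a x; have := sphi (rcons a i) x; rewrite /partial foldr_rcons. Qed.

Lemma smooth_partial phi a : smooth phi -> smooth (partial a phi).
Proof. by move=> sphi; elim: a => //= i a; exact: smooth_derive. Qed.

Lemma smooth_differentiable phi x : smooth phi -> differentiable phi x.
Proof. by move=> /(_ [::]); exact. Qed.

Lemma smooth_derivable phi x v : smooth phi -> derivable phi x v.
Proof. by move=> sphi; apply/diff_derivable/smooth_differentiable. Qed.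

Lemma smooth_continuous phi : smooth phi -> continuous phi.
Proof. by move=> sphi x; apply/differentiable_continuous/smooth_differentiable. Qed.

Lemma smooth_comm phi i j : smooth phi ->
  'D_(delta_mx ord0 i) ('D_(delta_mx ord0 j) phi) =
  'D_(delta_mx ord0 j) ('D_(delta_mx ord0 i) phi).
Proof.
move=> sphi; apply/funext => x.
have sd k := smooth_derive k sphi.
apply: derive_comm => [y|y|y|y||]; try exact: smooth_derivable.
  exact: (smooth_continuous (smooth_derive _ (sd _))).
exact: (smooth_continuous (smooth_derive _ (sd _))).
Qed.

Lemma partial_derive phi a i : smooth phi ->
  partial a ('D_(delta_mx ord0 i) phi) = 'D_(delta_mx ord0 i) (partial a phi).
Proof.
move=> sphi; elim: a => //= j a ->.
by apply: smooth_comm; exact: smooth_partial.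
Qed.

End smooth.

(** * Compactly supported functions *)
Section line.
Variable R : realType.
Notation leb := (@lebesgue_measure R).
Variables (g dg : R -> R) (N : R).
Hypothesis N_gt0 : 0 < N.
Hypothesis gdg : forall t : R, is_derive t 1 g (dg t).
Hypothesis cdg : continuous dg.
Hypothesis g0 : forall t, N <= `|t| -> g t = 0.

Lemma line_continuous : continuous g.
Proof.
move=> t; apply: differentiable_continuous; apply/derivable1_diffP.
by have [] := gdg t.
Qed.

Lemma line_FTC (a b : R) : a < b ->
  (\int[leb]_(t in `[a, b]) (dg t)%:E = (g b)%:E - (g a)%:E)%E.
Proof.
move=> ab; apply: continuous_FTC2 => //.
- by apply: continuous_subspaceT; exact: cdg.
- split.
  + by move=> t _; have [] := gdg t.
  + by apply: cvg_at_right_filter; exact: line_continuous.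
  + by apply: cvg_at_left_filter; exact: line_continuous.
- by move=> t _; rewrite derive1E; have [_ ->] := gdg t.
Qed.

Lemma line_dg0 t : N < `|t| -> dg t = 0.
Proof.
move=> Nt; have [_ <-] := gdg t.
rewrite (@near_eq_derive _ _ _ g (cst 0)) ?derive_cst//.
near=> s; rewrite g0//; apply: ltW; near: s.
have : nbhs `|t| [set x | N < x] by exact: lt_nbhsr.
by move=> /(@norm_continuous _ R t).
Unshelve. all: by end_near. Qed.

Lemma line_int0 : (\int[leb]_t (dg t)%:E = 0)%E.
Proof.
have -> : (\int[leb]_t (dg t)%:E = \int[leb]_(t in `[(- N)%R, N]) (dg t)%:E)%E.
  rewrite [RHS]integral_mkcond; apply: eq_integral => t _.
  rewrite patchE; case: ifPn => //; rewrite notin_setE/= in_itv/= -ler_norml => /negP.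
  by rewrite -ltNge => /line_dg0 ->.
rewrite line_FTC; last by rewrite gtrN.
by rewrite !g0 ?subee// ?normrN ger0_norm// ltW.
Qed.

(** The convexity of the power function, in the form that proves Jensen's inequality by
    integration. *)
Lemma exprn_tangent (a c : R) k : 0 <= a -> 0 <= c ->
  c ^+ k.+1 + k.+1%:R * c ^+ k * (a - c) <= a ^+ k.+1.
Proof.
move=> a0 c0; elim: k => [|k IH]; first by rewrite !expr1 expr0 !mul1r; lra.
rewrite [leRHS]exprS; apply: le_trans (ler_wpM2l a0 IH).
have h : 0 <= k.+1%:R * c ^+ k * (a - c) ^+ 2.
  by rewrite mulr_ge0 ?sqr_ge0// mulr_ge0// exprn_ge0.
move: h; rewrite -[k.+2%:R]natr1 !exprS.
move: (k.+1%:R) (c ^+ k) => x y h; lra.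
Qed.

(** For t in [-N, N], |g t| is at most the integral A of |g'|, and Jensen's inequality
    compares A^(k+1) with the integral of |g'|^(k+1). The constant is a (k+1)-th power;
    this keeps the inequality meaningful as k tends to infinity. *)
Lemma line_poincare k :
  (\int[leb]_t (`|g t| ^+ k.+1)%:E <=
   ((2 * N) ^+ k.+1)%:E * \int[leb]_t (`|dg t| ^+ k.+1)%:E)%E.
Proof.
have mg : measurable_fun [set: R] g by apply: continuous_measurable_fun; exact: line_continuous.
have mdg : measurable_fun [set: R] dg by exact: continuous_measurable_fun.
pose I : set R := `[- N, N]%classic.
have mI : measurable I by exact: measurable_itv.
have lI : leb I = (2 * N)%:E.
  rewrite /I lebesgue_measure_itv/= lte_fin gtrN// -EFinB; congr (_%:E); lra.
have NN : - N < N by rewrite gtrN.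
have ci (h : R -> R) : continuous h -> leb.-integrable I (EFin \o h).
  move=> ch; apply: continuous_compact_integrable; first exact: segment_compact.
  exact: continuous_subspaceT.
have cadg : continuous (fun t => `|dg t|).
  by move=> t; apply: (@continuous_comp _ _ _ dg (@Num.norm _ R)); [exact: cdg|exact: norm_continuous].
have cadgk : continuous (fun t => `|dg t| ^+ k.+1).
  by move=> t; apply: (@continuous_comp _ _ _ (fun t => `|dg t|) (fun x => x ^+ k.+1)); [exact: cadg|exact: exprn_continuous].
pose A := (\int[leb]_(t in I) `|dg t|)%R.
have A0 : 0 <= A by apply: Rintegral_ge0.
have gA t : `|g t| <= A.
  have [Nt|tN] := leP N `|t|; first by rewrite g0// normr0.
  have /andP[t1 t2] : - N < t < N by rewrite -ltr_norml.
  have E : (g t = \int[leb]_(s in `[- N, t]) dg s)%R.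
    have gN : g (- N) = 0 by rewrite g0// normrN ger0_norm// ltW.
    by rewrite /Rintegral line_FTC// gN -EFinB subr0.
  have sI : `[- N, t]%classic `<=` I.
    by apply: subset_itvl; rewrite bnd_simp ltW.
  rewrite E; apply: le_trans (le_normr_Rintegral _ _) _ => //.
    exact: integrableS (ci _ cdg).
  rewrite /A/Rintegral fine_le//.
  - apply: integrable_fin_num => //.
    by apply: integrableS (ci _ cadg).
  - by apply: integrable_fin_num => //; exact: ci.
  - apply: ge0_subset_integral => //.
    apply/measurable_EFinP; apply: measurable_funTS.
    exact: (continuous_measurable_fun cadg).
(* Jensen's inequality: integrate the tangent at the mean value c *)
have J : (2 * N) * (A / (2 * N)) ^+ k.+1 <= \int[leb]_(t in I) (`|dg t| ^+ k.+1).
  set c := A / (2 * N).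
  have c0 : 0 <= c by rewrite divr_ge0// mulr_ge0// ltW.
  have -> : (2 * N) * c ^+ k.+1 =
      \int[leb]_(t in I) (c ^+ k.+1 + k.+1%:R * c ^+ k * (`|dg t| - c)).
    have ic (x : R) : leb.-integrable I (EFin \o cst x).
      by apply: ci => t; exact: cst_continuous.
    have i1 : leb.-integrable I (EFin \o (fun t => `|dg t| - c)).
      by apply: ci => t; apply: cvgB; [exact: cadg|exact: cvg_cst].
    have i2 : leb.-integrable I (EFin \o (fun t => k.+1%:R * c ^+ k * (`|dg t| - c))).
      apply: ci => t; apply: cvgM; first exact: cvg_cst.
      by apply: cvgB; [exact: cadg|exact: cvg_cst].
    have i3 : leb.-integrable I (EFin \o (fun=> c ^+ k.+1)) by exact: ic.
    have i4 : leb.-integrable I (EFin \o (fun=> c)) by exact: ic.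
    have i5 := ci _ cadg.
    rewrite RintegralD// RintegralZl// RintegralB//.
    have cst_int x : \int[leb]_(t in I) x = x * (2 * N).
      by rewrite Rintegral_cst//; congr (_ * _); exact: (congr1 fine lI).
    rewrite !cst_int -/A.
    have -> : A - c * (2 * N) = 0.
      by rewrite /c divfK ?subrr// mulf_neq0// gt_eqF.
    by rewrite mulr0 addr0 mulrC.
  apply: le_Rintegral => //; [|exact: ci|].
    apply: ci => t; apply: cvgD; first exact: cvg_cst.
    apply: cvgM; first exact: cvg_cst.
    by apply: cvgB; [exact: cadg|exact: cvg_cst].
  by move=> t _; exact: exprn_tangent.
apply: (@le_trans _ _ (\int[leb]_(t in I) (A ^+ k.+1)%:E)%E).
  rewrite [leRHS]integral_mkcond; apply: ge0_le_integral => //.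
  - by apply/measurable_EFinP; apply: measurable_funX; exact: measurableT_comp.
  - by apply/(measurable_restrictT _ _).1 => //; exact: measurable_cst.
  - move=> t _; rewrite patchE; case: ifPn => tI.
      by rewrite lee_fin lerXn2r ?nnegrE// gA.
    rewrite g0 ?normr0 ?expr0n//.
    move: tI; rewrite notin_setE /I/= in_itv/= -ler_norml => /negP.
    by rewrite -ltNge => /ltW.
rewrite integral_cst//= [X in (_ * X)%E]lI -EFinM.
apply: (@le_trans _ _ (((2 * N) ^+ k.+1)%:E * \int[leb]_(t in I) (`|dg t| ^+ k.+1)%:E)%E).
  rewrite -[X in (_ <= _ * X)%E]fineK; last by apply: integrable_fin_num => //; exact: ci.
  rewrite -EFinM lee_fin; apply: le_trans (ler_wpM2l _ J); last first.
    by rewrite exprn_ge0// mulr_ge0// ltW.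
  have N20 : 2 * N != 0 by rewrite mulf_neq0// gt_eqF.
  by rewrite [leRHS]mulrCA -exprMn [2 * N * (A / _)]mulrCA divff// mulr1 mulrC.
apply: lee_wpmul2l; first by rewrite lee_fin exprn_ge0// mulr_ge0// ltW.
apply: ge0_subset_integral => //.
by apply/measurable_EFinP; exact: (continuous_measurable_fun cadgk).
Qed.

End line.

Section slices.
Variables (R : realType) (n : nat).
Notation cons := (@rV_cons R n).
Notation e i := (delta_mx ord0 i).

Lemma rV_cons_coord0 t x : cons (t, x) = cons (0, x) + t *: e ord0.
Proof.
apply/rowP => i; rewrite !mxE/=.
by case: (unliftP ord0 i) => [j ->|->] /=;
  rewrite ?mulr1 ?add0r ?(negbTE (neq_lift _ _)) ?mulr0 ?addr0// eq_sym (negbTE (neq_lift _ _)) mulr0 addr0.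
Qed.

Lemma rV_cons_lift t x j h : cons (t, h *: e j + x) = h *: e (lift ord0 j) + cons (t, x).
Proof.
apply/rowP => i; rewrite !mxE/=.
case: (unliftP ord0 i) => [k ->|->] /=; last first.
  by rewrite ?(negbTE (neq_lift _ _)) mulr0 add0r.
by rewrite !mxE/= (inj_eq lift_inj).
Qed.

Lemma is_derive_slice0 (f : 'rV[R]_n.+1 -> R) t x :
  (forall y, derivable f y (e ord0)) ->
  is_derive t (1 : R) (fun t : R => f (cons (t, x))) ('D_(e ord0) f (cons (t, x))).
Proof.
move=> df; have := @is_derive_line R _ f (cons (0, x)) (e ord0) t (df _).
rewrite -rV_cons_coord0 (_ : (fun s => _) = (fun t => f (cons (t, x))))//.
by apply/funext => s; rewrite -rV_cons_coord0.
Qed.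

Lemma slice_diff_quot (f : 'rV[R]_n.+1 -> R) t x j :
  (fun h : R => h^-1 *: (((fun y => f (cons (t, y))) \o shift x) (h *: e j) - f (cons (t, x)))) =
  (fun h : R => h^-1 *: ((f \o shift (cons (t, x))) (h *: e (lift ord0 j)) - f (cons (t, x)))).
Proof. by apply/funext => h /=; rewrite rV_cons_lift. Qed.

Lemma derive_slice (f : 'rV[R]_n.+1 -> R) t x j :
  'D_(e j) (fun y => f (cons (t, y))) x = 'D_(e (lift ord0 j)) f (cons (t, x)).
Proof. by rewrite /derive slice_diff_quot. Qed.

Lemma derivable_slice (f : 'rV[R]_n.+1 -> R) t x j :
  derivable f (cons (t, x)) (e (lift ord0 j)) ->
  derivable (fun y => f (cons (t, y))) x (e j).
Proof. by rewrite /derivable slice_diff_quot. Qed.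

Lemma continuous_slice (t : R) : continuous (fun x => cons (t, x)).
Proof.
move=> x U /nbhs_ballP[d /= d0 dU]; apply/nbhs_ballP; exists d => // y [_ xy].
apply: dU; split => // i j; rewrite ord1 !mxE/=.
by case: (unliftP ord0 j) => [k _|_] /=; [exact: xy|exact: ballxx].
Qed.

Lemma continuous_slice0 (x : 'rV[R]_n) : continuous (fun t : R => cons (t, x)).
Proof.
move=> t; rewrite (_ : (fun t => _) = (fun t : R => cons (0, x) + t *: e ord0)); last first.
  by apply/funext => s; exact: rV_cons_coord0.
by apply: cvgD; [exact: cvg_cst|apply: cvgZr_tmp; exact: cvg_id].
Qed.

Lemma continuous_comp_slice0 (h : 'rV[R]_n.+1 -> R) x :
  continuous h -> continuous (fun t : R => h (cons (t, x))).
Proof.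
move=> ch t.
exact: (@continuous_comp _ _ _ (fun t : R => cons (t, x)) h t (@continuous_slice0 x t) (ch _)).
Qed.

Lemma cube_slice M t x : ~ cube M x -> ~ cube M (cons (t, x)).
Proof.
by move=> h h'; apply: h => i; have := h' (lift ord0 i); rewrite mxE liftK.
Qed.

Lemma cube_slice0 M t x : M < `|t| -> ~ cube M (cons (t, x)).
Proof. by move=> h /(_ ord0); rewrite mxE unlift_none/= leNgt h. Qed.

Notation leb := (@lebesgue_measure R).
Notation bmu k := (@lebesgue_borel_rV R k).

Lemma ge0_integral_step (f : 'rV[R]_n.+1 -> \bar R) :
  measurable_fun [set: 'rV[R]_n.+1] f -> (forall x, 0 <= f x)%E ->
  (\int[bmu n.+1]_x f x = \int[(leb \x bmu n)%E]_z f (cons z))%E.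
Proof.
move=> mf f0.
rewrite -(@ge0_integral_pushforward _ _ _ _ _ _ (@measurable_rV_cons R n) _ setT)//.
Qed.

Lemma integral_step (f : 'rV[R]_n.+1 -> \bar R) :
  measurable_fun [set: 'rV[R]_n.+1] f ->
  (\int[bmu n.+1]_x f x = \int[(leb \x bmu n)%E]_z f (cons z))%E.
Proof.
move=> mf; rewrite integralE [RHS]integralE; congr (_ - _)%E.
  rewrite (ge0_integral_step (measurable_funepos mf) (funepos_ge0 f)).
  by apply: eq_integral => z _; rewrite !funeposE.
rewrite (ge0_integral_step (measurable_funeneg mf) (funeneg_ge0 f)).
by apply: eq_integral => z _; rewrite !funenegE.
Qed.

Lemma integrable_step (f : 'rV[R]_n.+1 -> \bar R) :
  (bmu n.+1).-integrable setT f -> (leb \x bmu n)%E.-integrable setT (f \o cons).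
Proof.
move=> /integrableP[mf fi]; apply/integrableP; split.
  exact: (measurableT_comp mf (@measurable_rV_cons R n)).
by rewrite -(ge0_integral_step (f := fun x => `|f x|%E))//; exact: measurableT_comp.
Qed.

End slices.

Section compact_support.
Variable R : realType.
Notation leb := (@lebesgue_measure R).
Notation bmu k := (@lebesgue_borel_rV R k).
Notation e i := (delta_mx ord0 i).

Lemma derive_out n (f : 'rV[R]_n -> R) K v x : closed K ->
  (forall x, ~ K x -> f x = 0) -> ~ K x -> 'D_v f x = 0.
Proof.
move=> cK f0 Mx; rewrite (@near_eq_derive _ _ _ f (cst 0)) ?derive_cst//.
have oC : open (~` K) by exact: closed_openC.
by near=> y; apply: f0; near: y; exact: (open_nbhs_nbhs (conj oC Mx)).
Unshelve. all: by end_near. Qed.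

Lemma cube_compact n M : compact (@cube R n M).
Proof.
apply: bounded_closed_compact; last exact: cube_closed.
exists `|M|; split; first exact: num_real.
move=> y My x xM; rewrite /Num.norm/=.
have [->|/mx_norm_neq0[[i j] ->]] := eqVneq (mx_norm x) 0.
  by rewrite (le_trans _ (ltW My)).
by rewrite ord1/= (le_trans (xM j))// (le_trans (ler_norm _))// ltW.
Qed.

Lemma integrable_compact_support n (f : 'rV[R]_n -> R) M : continuous f ->
  (forall x, ~ cube M x -> f x = 0) -> (bmu n).-integrable setT (EFin \o f).
Proof.
move=> cf f0.
have mf : measurable_fun [set: 'rV[R]_n] f by exact: continuous_borel.
have mC : measurable (@cube R n M) by exact: cube_borel.
have -> : EFin \o f = (EFin \o f) \_ (cube M).
  apply/funext => x; rewrite patchE; case: ifPn => //.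
  by rewrite notin_setE => /f0 /= ->.
apply/(integrable_mkcond _ mC).
apply: measurable_bounded_integrable => //.
- exact: cube_fin.
- exact: measurable_funTS.
- have /compact_bounded[M0 [M0r h]] : compact (f @` cube M).
    apply: continuous_compact; last exact: cube_compact.
    exact: continuous_subspaceT.
  by exists M0; split => // y My x Cx; apply: (h y My); exists x.
Qed.

(** Fubini's theorem reduces the claim to a function of one variable when i is the first
    coordinate, and to one dimension less otherwise. *)
Lemma integral_derive n (i : 'I_n) (f : 'rV[R]_n -> R) M :
  (forall x, derivable f x (e i)) -> continuous f -> continuous ('D_(e i) f) ->
  (forall x, ~ cube M x -> f x = 0) ->
  (\int[bmu n]_x ('D_(e i) f x)%:E = 0)%E.
Proof.
elim: n i f => [[]//|n IH] i f df cf cdf f0.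
have D0 x := derive_out (e i) (@cube_closed _ _ M) f0 (x := x).
have Dint := integrable_compact_support cdf D0.
rewrite integral_step; last by have /integrableP[] := Dint.
have {}Dint := integrable_step Dint.
have [j ij|i0] := unliftP ord0 i.
  rewrite -(integral12_prod_meas1 Dint) integral0_eq// => t _.
  rewrite /fubini_F/=.
  transitivity (\int[bmu n]_y ('D_(e j) (fun y => f (rV_cons (t, y))) y)%:E)%E.
    by apply: eq_integral => y _; rewrite derive_slice -ij.
  apply: IH.
  - by move=> x; apply: derivable_slice; rewrite -ij.
  - by move=> x; apply: continuous_comp; [exact: continuous_slice|exact: cf].
  - rewrite (_ : 'D__ _ = 'D_(e i) f \o (fun x => rV_cons (t, x))).
      by move=> x; apply: continuous_comp; [exact: continuous_slice|exact: cdf].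
    by apply/funext => x /=; rewrite derive_slice -ij.
  - by move=> x Mx; apply: f0; exact: cube_slice.
rewrite -(integral21_prod_meas1 Dint) integral0_eq// => x _.
rewrite /fubini_G/=.
apply: (@line_int0 R (fun t => f (rV_cons (t, x))) _ (`|M| + 1)).
- by rewrite ltr_wpDl.
- by move=> t; rewrite i0; apply: is_derive_slice0; rewrite -i0.
- exact: (continuous_comp_slice0 cdf).
- move=> t Mt; apply: f0; apply: cube_slice0.
  by rewrite (lt_le_trans _ Mt)// ltr_pwDr// ler_norm.
Qed.

(** The one-dimensional inequality on the lines parallel to the first axis. *)
Lemma poincare_compact_support n (f : 'rV[R]_n.+1 -> R) M k : 0 < M ->
  (forall x, derivable f x (e ord0)) -> continuous f -> continuous ('D_(e ord0) f) ->
  (forall x, ~ cube M x -> f x = 0) ->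
  (\int[bmu n.+1]_x (`|f x| ^+ k.+1)%:E <=
    ((2 * (M + 1)) ^+ k.+1)%:E * \int[bmu n.+1]_x (`|'D_(e ord0) f x| ^+ k.+1)%:E)%E.
Proof.
move=> M0 df cf cdf f0.
have mabs (h : 'rV[R]_n.+1 -> R) : continuous h ->
    measurable_fun [set: 'rV[R]_n.+1] (fun x => (`|h x| ^+ k.+1)%:E).
  move=> ch; apply/measurable_EFinP; apply: measurable_funX.
  by apply: measurableT_comp => //; exact: continuous_borel.
have mc (h : 'rV[R]_n.+1 -> R) : continuous h ->
    measurable_fun [set: measurableTypeR R * 'rV[R]_n] (fun z => (`|h (rV_cons z)| ^+ k.+1)%:E).
  by move=> ch; exact: (measurableT_comp (mabs h ch) (@measurable_rV_cons R n)).
have N0 : 0 < M + 1 by rewrite ltr_wpDl// ltW.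
rewrite (ge0_integral_step (mabs _ cf)); last by move=> x; rewrite lee_fin exprn_ge0.
rewrite (ge0_integral_step (mabs _ cdf)); last by move=> x; rewrite lee_fin exprn_ge0.
rewrite (fubini_tonelli2 _ (mc _ cf)); last by move=> z; rewrite lee_fin exprn_ge0.
rewrite (fubini_tonelli2 _ (mc _ cdf)); last by move=> z; rewrite lee_fin exprn_ge0.
have mG (h : 'rV[R]_n.+1 -> R) : continuous h -> measurable_fun setT
    (fubini_G leb (fun z : measurableTypeR R * 'rV[R]_n => (`|h (rV_cons z)| ^+ k.+1)%:E)).
  move=> ch; apply: measurable_fun_fubini_tonelli_G; first exact: mc.
  by move=> z; rewrite lee_fin exprn_ge0.
rewrite -ge0_integralZl//; last 3 first.
- exact: (mG _ cdf).
- by move=> x _; apply: integral_ge0 => t _; rewrite lee_fin exprn_ge0.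
- by rewrite lee_fin exprn_ge0// mulr_ge0// ltW.
apply: ge0_le_integral => //.
- by move=> x _; apply: integral_ge0 => t _; rewrite lee_fin exprn_ge0.
- exact: (mG _ cf).
- by apply: measurable_funeM; exact: (mG _ cdf).
move=> x _; apply: (@line_poincare R (fun t => f (rV_cons (t, x))) (fun t => 'D_(e ord0) f (rV_cons (t, x)))) => //.
- by move=> t; exact: is_derive_slice0.
- exact: (continuous_comp_slice0 cdf).
- move=> t Mt; apply: f0; apply: cube_slice0.
  by rewrite (lt_le_trans _ Mt)// ltrDl.
Qed.

End compact_support.

(** * Test functions and weak derivatives *)
Section test_functions.
Variables (R : realType) (n : nat).
Notation V := 'rV[R]_n.
Notation L := (lebesgue_rV_type R n).
Notation mu := (@lebesgue_rV R n).

Lemma derive_scaleD (f g : V -> R) (c : R) x v :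
  derivable f x v -> derivable g x v ->
  'D_v (fun x => c * f x + g x) x = c * 'D_v f x + 'D_v g x.
Proof.
move=> df dg; have h := @derivableZ _ _ _ f c x v df.
by rewrite -[c * _](deriveZ c df) -(deriveD h dg).
Qed.

Lemma derive_mul (f g : V -> R) x v : derivable f x v -> derivable g x v ->
  'D_v (fun x => f x * g x) x = f x * 'D_v g x + 'D_v f x * g x.
Proof. by move=> df dg; rewrite [_ * g x]mulrC -(deriveM df dg). Qed.

Implicit Types (Om K : set V) (u v phi psi : V -> R) (a : seq 'I_n).

Lemma test_fun_smooth Om phi : test_fun Om phi -> smooth phi.
Proof. by case. Qed.

Lemma partial_out phi K a x : closed K -> (forall x, ~ K x -> phi x = 0) ->
  ~ K x -> partial a phi x = 0.
Proof.
move=> cK phi0; elim: a x => /= [|i a IH] x Kx; first exact: phi0.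
exact: (derive_out _ cK).
Qed.

Lemma compact_closedV K : compact K -> closed K.
Proof. exact: (compact_closed (@norm_hausdorff _ _)). Qed.

Lemma test_fun_partial Om phi a : test_fun Om phi -> test_fun Om (partial a phi).
Proof.
move=> [sphi [K [cK KOm phi0]]]; split; first exact: smooth_partial.
exists K; split => // x; apply: partial_out phi0; exact: compact_closedV.
Qed.

Lemma partialD phi psi (c : R) a : smooth phi -> smooth psi ->
  partial a (fun x => c * phi x + psi x) = fun x => c * partial a phi x + partial a psi x.
Proof.
move=> sphi spsi; elim: a => //= i a ->; apply/funext => x.
by apply: derive_scaleD; apply: smooth_derivable; exact: smooth_partial.
Qed.

Lemma test_funD Om phi psi (c : R) : test_fun Om phi -> test_fun Om psi ->
  test_fun Om (fun x => c * phi x + psi x).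
Proof.
move=> [sphi [K [cK KOm phi0]]] [spsi [K' [cK' KOm' psi0]]]; split.
  move=> a x; rewrite partialD//; apply: differentiableD; last exact: spsi.
  by apply: differentiableM => //; exact: sphi.
exists (K `|` K'); split; [exact: compactU| |].
  by move=> x [/KOm|/KOm'].
by move=> x /not_orP[/phi0 -> /psi0 ->]; rewrite mulr0 addr0.
Qed.

Lemma test_fun0 Om : test_fun Om (cst 0).
Proof.
split; last by exists set0; split => //; exact: compact0.
have p0 a : partial a (cst 0 : V -> R) = cst 0.
  by elim: a => //= i a ->; apply/funext => x; rewrite derive_cst.
by move=> a x; rewrite p0.
Qed.

Lemma continuous_lebesgue (h : V -> R) : continuous h ->
  measurable_fun [set: L] (h : L -> R).
Proof.
by move=> ch; apply: borel_lebesgue_fun => //; exact: continuous_borel.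
Qed.

Lemma open_lebesgue Om : open Om -> measurable (Om : set L).
Proof. by move=> oO; apply: borel_lebesgue; exact: open_borel. Qed.

Lemma compact_lebesgue K : compact K -> measurable (K : set L).
Proof. by move=> oO; apply: borel_lebesgue; exact: compact_borel. Qed.

Lemma integrable_test Om u (h : V -> R) K : measurable (Om : set L) -> L1loc Om u ->
  continuous h -> compact K -> K `<=` Om -> (forall x, ~ K x -> h x = 0) ->
  mu.-integrable (Om : set L) (EFin \o (fun x => u x * h x)).
Proof.
move=> mO uL ch cK KO h0.
have mK := compact_lebesgue cK.
have iK : mu.-integrable (K : set L) (EFin \o (fun x => u x * h x)).
  have := @integrableMl _ _ _ mu (K : set L) mK (EFin \o u) h (uL _ cK KO).
  apply; first by apply: measurable_funTS; exact: continuous_lebesgue.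
  have /compact_bounded[M0 [M0r H]] : compact (h @` K).
    by apply: continuous_compact => //; exact: continuous_subspaceT.
  by exists M0; split => // y My x Cx; apply: (H y My); exists x.
move/(integrable_mkcond _ mK) : iK.
move/(@integrableS _ _ _ mu setT (Om : set L) _ measurableT mO (@subsetT _ _)).
apply: eq_integrable => // x _; rewrite patchE; case: ifPn => //.
by rewrite notin_setE => /h0/= ->; rewrite mulr0.
Qed.

Lemma continuous_L1loc Om u : continuous u -> L1loc Om u.
Proof.
move=> cu K cK _; apply: measurable_bounded_integrable.
- exact: compact_lebesgue.
- exact: compact_lebesgue_fin.
- by apply: measurable_funTS; exact: continuous_lebesgue.
- have /compact_bounded[M0 [M0r H]] : compact (u @` K).
    by apply: continuous_compact => //; exact: continuous_subspaceT.
  by exists M0; split => // y My x Cx; apply: (H y My); exists x.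
Qed.

Lemma integral_support (Om : set V) (h : V -> R) : (forall x, ~ Om x -> h x = 0) ->
  (\int[mu]_(x in Om) (h x)%:E = \int[mu]_x (h x)%:E)%E.
Proof.
move=> h0; rewrite integral_mkcond; apply: eq_integral => x _; rewrite patchE.
by case: ifPn => //; rewrite notin_setE => /h0 ->.
Qed.

(** The integral of the derivative of the product vanishes, as the product has compact
    support. *)
Lemma integration_by_parts_test Om i phi psi : open Om -> smooth phi -> test_fun Om psi ->
  \int[mu]_(x in Om) (phi x * 'D_(delta_mx ord0 i) psi x) =
  - \int[mu]_(x in Om) ('D_(delta_mx ord0 i) phi x * psi x).
Proof.
move=> oO sphi [spsi [K [cK KO psi0]]].
have mO := open_lebesgue oO.
have cphi := smooth_continuous sphi; have cpsi := smooth_continuous spsi.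
have cdphi := smooth_continuous (smooth_derive i sphi).
have cdpsi := smooth_continuous (smooth_derive i spsi).
have dpsi0 x := @derive_out _ _ _ K (delta_mx ord0 i) x (compact_closedV cK) psi0.
pose f x := phi x * psi x.
have cf : continuous f by move=> x; exact: (cvgM (cphi x) (cpsi x)).
have dfE : 'D_(delta_mx ord0 i) f =
    (fun x => phi x * 'D_(delta_mx ord0 i) psi x + 'D_(delta_mx ord0 i) phi x * psi x).
  apply/funext => x; apply: derive_mul; exact: smooth_derivable.
have cdf : continuous ('D_(delta_mx ord0 i) f).
  rewrite dfE => x.
  exact: (cvgD (cvgM (cphi x) (cdpsi x)) (cvgM (cdphi x) (cpsi x))).
have f0 x : ~ K x -> f x = 0 by move=> /psi0 fx; rewrite /f fx mulr0.
have [M M0 KM] := bounded_cube (compact_bounded cK).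
have I0 : (\int[mu]_(x in Om) ('D_(delta_mx ord0 i) f x)%:E = 0)%E.
  rewrite integral_support; last first.
    by move=> x Ox; apply: (derive_out _ (compact_closedV cK) f0) => /KO.
  rewrite integral_borel//; last by apply/measurable_EFinP; exact: continuous_borel.
  apply: (@integral_derive R n i f M) => //.
    move=> x; apply: derivableM; exact: smooth_derivable.
  by move=> x Mx; apply: f0 => /KM.
have i1 : mu.-integrable (Om : set L) (EFin \o (fun x => phi x * 'D_(delta_mx ord0 i) psi x)).
  by apply: (integrable_test mO (continuous_L1loc cphi) cdpsi cK KO dpsi0).
have i2 : mu.-integrable (Om : set L) (EFin \o (fun x => 'D_(delta_mx ord0 i) phi x * psi x)).
  by apply: (integrable_test mO (continuous_L1loc cdphi) cpsi cK KO psi0).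
apply/eqP; rewrite -addr_eq0 -RintegralD//; apply/eqP.
rewrite /Rintegral -[RHS]/(fine 0) -I0; congr fine; apply: eq_integral => x _.
by congr (_%:E); rewrite -[LHS]/((fun x => _) x) -dfE.
Qed.

Lemma weak_deriv_smooth Om phi a : open Om -> smooth phi ->
  weak_deriv Om a phi (partial a phi).
Proof.
move=> oO sphi; split.
- by apply: continuous_L1loc; exact: smooth_continuous.
- by apply: continuous_L1loc; apply: smooth_continuous; exact: smooth_partial.
elim: a phi sphi => [|i a IH] phi sphi psi tpsi /=.
  by rewrite expr0 mul1r.
rewrite integration_by_parts_test//; last exact: test_fun_partial.
rewrite IH//; last exact: smooth_derive.
by rewrite exprS mulN1r mulNr partial_derive.
Qed.

End test_functions.

(** * The fundamental lemma of the calculus of variations *)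
Section fundamental_lemma.
Variables (R : realType) (n : nat).
Notation V := 'rV[R]_n.
Notation L := (lebesgue_rV_type R n).
Notation mu := (@lebesgue_rV R n).
Implicit Types (Om K : set V) (u v phi : V -> R).

Lemma rat_box_obox (q : 'M[rat]_(1, n) * nat) : exists a b : V,
  @rat_box R 1 n q = obox a b /\ @rat_cbox R 1 n q = cbox a b.
Proof.
exists (\row_j (ratr (q.1 ord0 j) - q.2.+1%:R^-1)), (\row_j (ratr (q.1 ord0 j) + q.2.+1%:R^-1)).
split; apply/seteqP; split => x h.
- by move=> i; have := h ord0 i; rewrite ltr_distl !mxE.
- move=> i j; have -> : i = ord0 by rewrite ord1.
  by have := h j; rewrite ltr_distl !mxE.
- by move=> i; have := h ord0 i; rewrite ler_distl !mxE.
- move=> i j; have -> : i = ord0 by rewrite ord1.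
  by have := h j; rewrite ler_distl !mxE.
Qed.

(** Open boxes whose closure is in Om, and which cover Om, enumerated by the natural
    numbers; the empty set stands for the codes that give no such box. *)
Definition box_in Om (k : nat) : set V :=
  if unpickle k is Some q then [set x | @rat_cbox R 1 n q `<=` Om /\ rat_box q x] else set0.

Lemma box_in_cover Om : open Om -> Om = \bigcup_k box_in Om k.
Proof.
move=> oO; apply/seteqP; split => [x Ox|x [k _]].
  have [q qx qO] := open_rat_boxP oO Ox.
  by exists (pickle q) => //; rewrite /box_in pickleK.
rewrite /box_in; case: unpickle => // q [qO qx]; apply: qO => i j; exact/ltW/qx.
Qed.

Lemma box_inP Om k : box_in Om k = set0 \/
  exists a b : V, box_in Om k = obox a b /\ cbox a b `<=` Om.
Proof.
rewrite /box_in; case: unpickle => [q|]; last by left.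
have [qO|qO] := pselect (@rat_cbox R 1 n q `<=` Om); last first.
  by left; rewrite -subset0 => x [].
have [a [b [e1 e2]]] := rat_box_obox q.
right; exists a, b; rewrite -e2; split => //; rewrite -e1.
by apply/seteqP; split => x; [case|split].
Qed.

Lemma obox_open (a b : V) : open (obox a b).
Proof.
rewrite openE => x h.
exists (fun _ j => `]a ord0 j, b ord0 j[%classic).
  move=> i j; rewrite ord1; apply: open_nbhs_nbhs; split; first exact: interval_open.
  by rewrite /= in_itv/=; exact: h.
by move=> y hy j; have := hy ord0 j; rewrite /= in_itv.
Qed.

Lemma obox_setI (a1 b1 a2 b2 : V) : obox a1 b1 `&` obox a2 b2 =
  obox (\row_i Num.max (a1 ord0 i) (a2 ord0 i)) (\row_i Num.min (b1 ord0 i) (b2 ord0 i)).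
Proof.
apply/seteqP; split => [x [h1 h2] i|x h].
  rewrite !mxE gt_max lt_min.
  by have /andP[-> ->] := h1 i; have /andP[-> ->] := h2 i.
split => i; have := h i; rewrite !mxE gt_max lt_min => /andP[/andP[e1 e2] /andP[e3 e4]].
  by rewrite e1 e3.
by rewrite e2 e4.
Qed.

Lemma sub_obox_cbox (a b : V) : obox a b `<=` cbox a b.
Proof. by move=> x h i; have /andP[/ltW-> /ltW->] := h i. Qed.

Lemma L1loc_measurable Om u : open Om -> L1loc Om u ->
  measurable_fun (Om : set L) (u : L -> R).
Proof.
move=> oO uL; rewrite (box_in_cover oO); apply/measurable_fun_bigcup.
  move=> k; have [->|[a [b [-> _]]]] := box_inP Om k; first exact: measurable0.
  by apply: open_lebesgue; exact: obox_open.
move=> k; have [->|[a [b [-> abO]]]] := box_inP Om k.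
  exact: measurable_fun_set0.
have /integrableP[/measurable_EFinP mu' _] := uL _ (@cbox_compact R n a b) abO.
apply: measurable_funS mu'; last exact: sub_obox_cbox.
by apply: compact_lebesgue; exact: cbox_compact.
Qed.

(** Local integrability only gives information on compact subsets; countably many boxes
    suffice to recover an open set. *)
Lemma ae_open Om (P : V -> Prop) : open Om ->
  (forall a b, cbox a b `<=` Om -> {ae mu, forall x, obox a b x -> P x}) ->
  {ae mu, forall x, Om x -> P x}.
Proof.
move=> oO h; have : {ae mu, forall x, forall k, box_in Om k x -> P x}.
  apply: ae_foralln => k; have [->|[a [b [-> abO]]]] := box_inP Om k.
    exact: aeW.
  exact: h.
move/ae_imp; apply => x h' Ox.
have [k _ kx] : (\bigcup_k box_in Om k) x by rewrite -box_in_cover.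
exact: (h' k).
Qed.

Lemma borel_obox : @measurable _ V = <<s [set A | exists a b : V, A = obox a b] >>.
Proof.
apply/seteqP; split; last first.
  apply: smallest_sub; first exact: sigma_algebra_measurable.
  by move=> _ [a [b ->]]; apply: open_borel; exact: obox_open.
set S := <<s _ >>.
have SU (U : set V) : open U -> S U.
  move=> oU; rewrite (box_in_cover oU); apply: sigma_algebra_bigcup => k.
  have [->|[a [b [-> _]]]] := box_inP U k; first exact: sigma_algebra0.
  by apply: sub_sigma_algebra; exists a, b.
apply: smallest_sub; first exact: smallest_sigma_algebra.
elim/big_ind : _ => // [A B hA hB C [/hA|/hB]//|i _ A [B mB <-]].
rewrite setTI.
have : <<s @RGenOInfty.G R >> B by move: mB; rewrite [X in X -> _](_ : _ = (@ocitv R).-sigma.-measurable B)// RGenOInfty.measurableE.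
apply: (@smallest_sub _ _ (@RGenOInfty.G R) [set B | S (rV_coord i @^-1` B)]).
  split => /=.
  - by rewrite preimage_set0; exact: sigma_algebra0.
  - move=> C hC; rewrite setTD preimage_setC -setTD.
    exact: sigma_algebraCD.
  - by move=> F hF; rewrite preimage_bigcup; exact: sigma_algebra_bigcup.
move=> _ [x ->] /=; apply: SU; apply: open_comp; last exact: interval_open.
by move=> y _; exact: coord_continuous.
Qed.

(** By dominated convergence, as bump functions tend to the indicator function of the
    box. *)
Lemma integral_obox0 Om v a b : open Om -> L1loc Om v ->
  (forall phi, test_fun Om phi -> \int[mu]_(x in Om) (v x * phi x) = 0) ->
  cbox a b `<=` Om -> (\int[mu]_(x in obox a b) (v x)%:E = 0)%E.
Proof.
move=> oO vL v0 abO.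
have mO := open_lebesgue oO.
have mC : measurable (cbox a b : set L) by apply: compact_lebesgue; exact: cbox_compact.
have mB : measurable (obox a b : set L) by apply: open_lebesgue; exact: obox_open.
have iv := vL _ (@cbox_compact R n a b) abO.
pose f_ k (x : L) := (v x * box_bump a b k.+1%:R x)%:E.
pose f (x : L) := ((EFin \o v) \_ (obox a b)) x.
have fk0 k : (\int[mu]_(x in cbox a b) f_ k x = 0)%E.
  have tb := @test_fun_bump R n Om a b k.+1%:R (ltr0Sn _ _) abO.
  have := v0 _ tb; rewrite /Rintegral.
  have [sb _] := tb.
  have ib : mu.-integrable (Om : set L) (EFin \o (fun x => v x * box_bump a b k.+1%:R x)).
    apply: (integrable_test mO vL (smooth_continuous sb) (@cbox_compact R n a b) abO).
    by move=> x hx; apply: box_bump_out => // /sub_obox_cbox.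
  have E : (\int[mu]_(x in Om) f_ k x = \int[mu]_(x in cbox a b) f_ k x)%E.
    rewrite integral_support; last first.
      move=> x Ox; rewrite box_bump_out ?mulr0// => /sub_obox_cbox/abO; exact.
    rewrite [RHS]integral_support// => x Ox.
    by rewrite box_bump_out ?mulr0// => /sub_obox_cbox.
  rewrite -E -{2}(fineK (integrable_fin_num mO ib)) => ->.
  by [].
have mf_ k : measurable_fun (cbox a b : set L) (f_ k).
  apply/measurable_EFinP; apply: measurable_funM.
    by move/integrableP : iv => [/measurable_EFinP].
  apply: measurable_funTS; apply: continuous_lebesgue; apply: smooth_continuous.
  exact: box_bump_smooth.
have mf : measurable_fun (cbox a b : set L) f.
  apply/(measurable_restrict _ mB) => //.
  move/integrableP : iv => [mv _]; exact: measurable_funS mv.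
have [||] := @dominated_convergence _ _ _ mu (cbox a b : set L) mC f_ f
    (abse \o (EFin \o v)) mf_ mf _ (integrable_abse iv).
- apply: aeW => x abx; rewrite /f patchE /f_; case: ifPn => [|] hx.
    rewrite inE in hx; apply: cvg_EFin; first exact: nearW.
    have h1 : v x * box_bump a b k.+1%:R x @[k --> \oo] --> v x * 1.
      by apply: cvgM; [exact: cvg_cst|exact: box_bump_cvg].
    by rewrite mulr1 in h1; exact: h1.
  rewrite notin_setE in hx; apply: cvg_near_cst; apply: nearW => k.
  by rewrite box_bump_out// mulr0.
- apply: aeW => x k _; rewrite /f_ /= lee_fin normrM ler_piMr//.
  have /andP[b0 b1] := box_bump_itv a b k.+1%:R x.
  by rewrite ger0_norm.
move=> _ _; rewrite (_ : [sequence _]_k = cst 0%E); last by apply/funext => k; exact: fk0.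
move=> fcvg.
have : (\int[mu]_(x in cbox a b) f x = 0)%E.
  exact: (cvg_unique (@ereal_hausdorff R) fcvg (cvg_cst 0%E)).
rewrite -integral_mkcondr (_ : cbox a b `&` obox a b = obox a b)//.
by apply/seteqP; split => [x []//|x abx]; split => //; exact: sub_obox_cbox.
Qed.

(** The boxes are a pi-system that generates the Borel sets, so Dynkin's theorem
    applies to the sets on which the integral vanishes. *)
Lemma integral_borel_obox0 Om v a b (A : set V) : open Om -> L1loc Om v ->
  (forall phi, test_fun Om phi -> \int[mu]_(x in Om) (v x * phi x) = 0) ->
  cbox a b `<=` Om -> measurable A -> (\int[mu]_(x in A `&` obox a b) (v x)%:E = 0)%E.
Proof.
move=> oO vL v0 abO mA.
have mC : measurable (cbox a b : set L) by apply: compact_lebesgue; exact: cbox_compact.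
have mQ : measurable (obox a b : set L) by apply: open_lebesgue; exact: obox_open.
have iQ : mu.-integrable (obox a b : set L) (EFin \o v).
  by apply: integrableS (vL _ (@cbox_compact R n a b) abO) => //; exact: sub_obox_cbox.
have : <<s [set A | exists a b : V, A = obox a b] >> A by rewrite -borel_obox.
apply: (@dynkin_induction _ V [set A | exists a b : V, A = obox a b]
  (fun A => \int[mu]_(x in A `&` obox a b) (v x)%:E = 0)%E).
- exact: borel_obox.
- move=> _ _ [a1 [b1 ->]] [a2 [b2 ->]].
  by rewrite obox_setI; eexists; eexists.
- by rewrite setTI; exact: integral_obox0 v0 abO.
- move=> _ [a1 [b1 ->]].
  rewrite /= obox_setI.
  apply: integral_obox0 v0 _ => // x h; apply: abO => i.
  by have := h i; rewrite !mxE ge_max le_min => /andP[/andP[_ e1] /andP[_ e2]]; rewrite e1 e2.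
- move=> S /borel_lebesgue mS /= S0.
  have := @integral_setU _ _ _ mu (S `&` obox a b : set L) (~` S `&` obox a b : set L) (EFin \o v).
  have -> : (S `&` obox a b) `|` (~` S `&` obox a b) = obox a b.
    by rewrite -setIUl setUv setTI.
  rewrite S0 add0e (integral_obox0 oO vL v0 abO) => <- //.
  + exact: measurableI.
  + by apply: measurableI => //; exact: measurableC.
  + by move/integrableP : iQ => [].
  + by rewrite disj_set2E; apply/eqP; rewrite setIACA setICr set0I.
- move=> F mF tF F0 /=; rewrite setI_bigcupl.
  rewrite integral_bigcup.
  + by rewrite eseries0// => k _ _; exact: F0.
  + exact: trivIset_setIr.
  + by move=> k; apply: measurableI => //; apply: borel_lebesgue; exact: mF.
  + apply: integrableS iQ => //.
      apply: bigcup_measurable => k _; apply: measurableI => //.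
      by apply: borel_lebesgue; exact: mF.
    by move=> x [k _ []].
Qed.

(** A function whose integral over every measurable set vanishes is zero almost
    everywhere. *)
Theorem fundamental_lemma Om v : open Om -> L1loc Om v ->
  (forall phi, test_fun Om phi -> \int[mu]_(x in Om) (v x * phi x) = 0) ->
  {ae mu, forall x, Om x -> v x = 0}.
Proof.
move=> oO vL v0; apply: ae_open => // a b abO.
have mC : measurable (cbox a b : set L) by apply: compact_lebesgue; exact: cbox_compact.
have mQ : measurable (obox a b : set L) by apply: open_lebesgue; exact: obox_open.
have iQ : mu.-integrable (obox a b : set L) (EFin \o v).
  by apply: integrableS (vL _ (@cbox_compact R n a b) abO) => //; exact: sub_obox_cbox.
have Qfin : (mu (obox a b) < +oo)%E.
  rewrite (le_lt_trans _ (compact_lebesgue_fin (@cbox_compact R n a b)))//.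
  by apply: le_measure; rewrite ?inE//; exact: sub_obox_cbox.
have : ae_eq mu (obox a b : set L) (EFin \o v) (cst 0%E).
  apply: integral_ae_eq => // E EQ mE.
  rewrite integral0.
  have [|G [mG EG GE]] := @borel_hull_negligible R n E mE.
    by rewrite (le_lt_trans _ Qfin)//; apply: le_measure; rewrite ?inE.
  have mGQ : measurable (G `&` obox a b : set L).
    by apply: measurableI => //; exact: borel_lebesgue.
  rewrite -(@integral_borel_obox0 Om v a b G)//.
  rewrite (@negligible_integral _ _ _ mu (G `&` obox a b : set L) (G `\` E : set L))//.
  + congr (integral mu _ _); apply/seteqP; split => [x Ex|x [[Gx _] /not_andP[//|]]].
      by split; [split; [exact: EG|exact: EQ]|move=> []].
    by move=> /contrapT.
  + by apply: measurableD => //; exact: borel_lebesgue.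
  + by apply: integrableS iQ => //; exact: subIsetr.
by move/ae_imp; apply => x /= h /h[].
Qed.

Lemma L1loc_lin Om u v (c : R) : L1loc Om u -> L1loc Om v ->
  L1loc Om (fun x => c * u x + v x).
Proof.
move=> uL vL K cK KO.
have mK := compact_lebesgue cK.
have := integrableD mK (integrableZl mK c (uL K cK KO)) (vL K cK KO).
by apply: eq_integrable => // x _ /=.
Qed.

Lemma Rintegral_test_lin Om u v (c : R) phi : open Om -> L1loc Om u -> L1loc Om v ->
  test_fun Om phi ->
  \int[mu]_(x in Om) ((c * u x + v x) * phi x) =
  c * \int[mu]_(x in Om) (u x * phi x) + \int[mu]_(x in Om) (v x * phi x).
Proof.
move=> oO uL vL [sphi [K [cK KO phi0]]].
have mO := open_lebesgue oO; have cphi := smooth_continuous sphi.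
have i1 := integrable_test mO uL cphi cK KO phi0.
have i2 := integrable_test mO vL cphi cK KO phi0.
rewrite -RintegralZl// -RintegralD//.
  by apply: eq_Rintegral => x _; rewrite mulrDl mulrA.
by have := integrableZl mO c i1; apply: eq_integrable.
Qed.

Lemma weak_deriv_lin Om a u v du dv (c : R) : open Om ->
  weak_deriv Om a u du -> weak_deriv Om a v dv ->
  weak_deriv Om a (fun x => c * u x + v x) (fun x => c * du x + dv x).
Proof.
move=> oO [uL duL ue] [vL dvL ve]; split; [exact: L1loc_lin|exact: L1loc_lin|].
move=> phi tphi; rewrite !Rintegral_test_lin//; last exact: test_fun_partial.
by rewrite ue// ve// mulrDr mulrCA.
Qed.

Lemma weak_deriv_unique Om a u v w : open Om ->
  weak_deriv Om a u v -> weak_deriv Om a u w -> {ae mu, forall x, Om x -> v x = w x}.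
Proof.
move=> oO [_ vL ve] [_ wL we].
have : {ae mu, forall x, Om x -> -1 * v x + w x = 0}.
  apply: fundamental_lemma => //; first exact: L1loc_lin.
  move=> phi tphi; rewrite Rintegral_test_lin//.
  have := ve _ tphi; rewrite we// => /(congr1 (fun x => (-1) ^+ size a * x)).
  by rewrite !mulrA -!exprMn mulrNN mulr1 expr1n !mul1r mulN1r => ->; rewrite addNr.
by move/ae_imp; apply => x h /h; rewrite mulN1r addrC => /eqP; rewrite subr_eq0 => /eqP.
Qed.

End fundamental_lemma.

(** * Weak compactness in a Hilbert space *)
Lemma increasing_ge_id (j : nat -> nat) : {homo j : m n / (m < n)%N} ->
  forall k, (k <= j k)%N.
Proof. by move=> hj; elim=> // k IH; exact: leq_ltn_trans IH (hj _ _ (ltnSn k)). Qed.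

Lemma increasing_select (P : nat -> nat -> Prop) :
  (forall m N, exists2 k, (N <= k)%N & P m k) ->
  exists2 j : nat -> nat, {homo j : m n / (m < n)%N} & forall m, P m (j m).
Proof.
move=> h; have h' m : {f : nat -> nat | forall N, (N <= f N)%N /\ P m (f N)}.
  apply: cid; have /choice[f fP] : forall N, exists k, (N <= k)%N /\ P m k.
    by move=> N; have [k] := h m N; exists k.
  by exists f.
pose f m := sval (h' m).
have f1 m N : (N <= f m N)%N by rewrite /f; case: (h' m) => g /= /(_ N)[].
have f2 m N : P m (f m N) by rewrite /f; case: (h' m) => g /= /(_ N)[].
pose s := fix s m := if m is m'.+1 then f m (s m').+1 else f 0%N 0%N.
exists s; last by case=> [|m]; exact: f2.
by apply: homo_ltn => [? ? ?|m]; [exact: ltn_trans|exact: f1].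
Qed.

(** Tychonoff's theorem in place of the diagonal argument: the sequence f of points of
    the compact space [-C, C]^N has a cluster point c. Its neighbourhoods only control
    finitely many coordinates, which is why the step m looks at the coordinates i <= m. *)
Lemma diagonal_subsequence (R : realType) (f : nat -> nat -> R) (C : R) :
  (forall k i, `|f k i| <= C) ->
  exists2 j : nat -> nat, {homo j : m n / (m < n)%N} &
    exists c : nat -> R, forall i, f (j k) i @[k --> \oo] --> c i.
Proof.
move=> fC.
have cC (i : nat) : compact (`[- C, C]%classic : set R) by exact: segment_compact.
have [|c [_ cl]] := @tychonoff nat (fun=> R) (fun=> `[- C, C]%classic) cC (f @ \oo) _.
  exists 0%N => // k _ i /=; rewrite in_itv/= -ler_norml; exact: fC.
have step m N : exists2 k, (N <= k)%N &
    forall i, (i <= m)%N -> `|c i - f k i| < m.+1%:R^-1.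
  have U1 i : nbhs c [set h : forall _ : nat, R | `|c i - h i| < m.+1%:R^-1].
    have B : nbhs (c i) [set b : R | `|c i - b| < m.+1%:R^-1].
      by apply/nbhs_ballP; exists (m.+1%:R^-1) => //=.
    exact: (@proj_continuous nat (fun=> R) i c _ B).
  have U : nbhs c [set h : forall _ : nat, R | forall i, (i < m.+1)%N ->
      `|c i - h i| < m.+1%:R^-1].
    elim: {1}m.+1 => [|l IH]; first exact: filterE.
    apply: filterS2 IH (U1 l) => h IH hl i; rewrite ltnS leq_eqVlt.
    by case/orP => [/eqP ->//|]; exact: IH.
  have [|h [[k Nk <-] hU]] := cl [set f k | k in [set k | (N <= k)%N]] _ _ U.
    by exists N => // k /= Nk; exists k.
  by exists k => // i im; apply: hU => /=; rewrite ltnS.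
have [j jh jP] := increasing_select step.
exists j => //; exists c => i; apply/cvgrPdist_lt => e e0.
near=> k; apply: lt_trans (_ : k.+1%:R^-1 < e).
  by apply: jP; near: k; exact: nbhs_infty_ge.
by near: k; exact: (near_infty_natSinv_lt (PosNum e0)).
Unshelve. all: by end_near. Qed.

Lemma convex_comb_add (R : realType) (E : lmodType R) (t : R) (a X Y : E) :
  a + (t *: X + (1 - t) *: Y) = t *: (a + X) + (1 - t) *: (a + Y).
Proof. by rewrite !scalerDr addrACA -scalerDl addrC [t + _]addrC subrK scale1r addrC. Qed.
Section hull.
Variables (R : realType) (E : lmodType R).
Implicit Types (A C : set E) (x y : E).

Definition convexP C := forall x y (t : R), C x -> C y -> 0 <= t -> t <= 1 ->
  C (t *: x + (1 - t) *: y).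

(** The convex hull, as an induction principle: a convex property that holds on A holds
    on the hull. *)
Definition hull A y := forall C, convexP C -> A `<=` C -> C y.

Lemma hull_convex A : convexP (hull A).
Proof.
move=> x y t hx hy t0 t1 C cC AC; apply: (cC) => //; [exact: hx|exact: hy].
Qed.

Lemma sub_hull A : A `<=` hull A.
Proof. by move=> x Ax C _; apply. Qed.

Lemma hull_sub A B : A `<=` hull B -> hull A `<=` hull B.
Proof. by move=> AB x hx; apply: hx => //; exact: hull_convex. Qed.

End hull.

(** The elements of S carry a symmetric, positive, possibly degenerate bilinear form, for
    which S is complete; W^{2,2} will be used as a set of functions, without passing to
    classes modulo negligible sets. *)
Section hilbert.
Variables (R : realType) (E : lmodType R) (S : set E) (ip : E -> E -> R).
Hypothesis S0 : S 0.
Hypothesis S_lin : forall c u v, S u -> S v -> S (c *: u + v).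
Hypothesis ipC : forall u v, ip u v = ip v u.
Hypothesis ip_lin : forall c u v w, S u -> S v -> S w ->
  ip (c *: u + v) w = c * ip u w + ip v w.
Hypothesis ip_ge0 : forall u, 0 <= ip u u.
Hypothesis ip_complete : forall y_ : nat -> E, (forall m, S (y_ m)) ->
  (forall e, 0 < e -> exists N, forall i j, (N <= i)%N -> (N <= j)%N ->
    ip (y_ i - y_ j) (y_ i - y_ j) <= e) ->
  exists2 y, S y & forall e, 0 < e -> exists N, forall i, (N <= i)%N ->
    ip (y_ i - y) (y_ i - y) <= e.

Local Notation norm2 u := (ip u u).

Lemma S_scale c u : S u -> S (c *: u).
Proof. by move=> Su; rewrite -[_ *: u]addr0; exact: S_lin. Qed.

Lemma S_sub u v : S u -> S v -> S (u - v).
Proof. by move=> Su Sv; have := S_lin (-1) Sv Su; rewrite scaleN1r addrC. Qed.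

Lemma S_comb t u v : S u -> S v -> S (t *: u + (1 - t) *: v).
Proof. by move=> Su Sv; apply: S_lin => //; exact: S_scale. Qed.

Lemma S_hull A : A `<=` S -> hull A `<=` S.
Proof. by move=> AS x; apply => // u v t Su Sv _ _; exact: S_comb. Qed.

Lemma ip_subl u v w : S u -> S v -> S w -> ip (u - v) w = ip u w - ip v w.
Proof. by move=> Su Sv Sw; rewrite addrC -scaleN1r ip_lin// mulN1r addrC. Qed.

Lemma ip_subr w u v : S u -> S v -> S w -> ip w (u - v) = ip w u - ip w v.
Proof. by move=> Su Sv Sw; rewrite ipC ip_subl// !(ipC w). Qed.

Lemma ip_scalel c u w : S u -> S w -> ip (c *: u) w = c * ip u w.
Proof.
move=> Su Sw; rewrite -[c *: u]addr0 ip_lin//.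
have -> : ip 0 w = 0 by rewrite -[X in ip X w](subrr w) ip_subl// subrr.
by rewrite addr0.
Qed.

Lemma ip_combl t u v w : S u -> S v -> S w ->
  ip (t *: u + (1 - t) *: v) w = t * ip u w + (1 - t) * ip v w.
Proof. by move=> Su Sv Sw; rewrite ip_lin ?ip_scalel//; exact: S_scale. Qed.

Lemma ip_combr t u v w : S u -> S v -> S w ->
  ip w (t *: u + (1 - t) *: v) = t * ip w u + (1 - t) * ip w v.
Proof. by move=> Su Sv Sw; rewrite ipC ip_combl// !(ipC w). Qed.

Lemma norm2_sub u v : S u -> S v -> norm2 (u - v) = norm2 u - 2 * ip u v + norm2 v.
Proof.
move=> Su Sv; have Suv := S_sub Su Sv.
rewrite ip_subl// !ip_subr// (ipC v u); lra.
Qed.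

Lemma norm2_comb t u v : S u -> S v ->
  norm2 (t *: u + (1 - t) *: v) =
  t ^+ 2 * norm2 u + 2 * t * (1 - t) * ip u v + (1 - t) ^+ 2 * norm2 v.
Proof.
move=> Su Sv; have Suv := S_comb t Su Sv.
rewrite ip_combl// !ip_combr// (ipC v u); lra.
Qed.

Lemma ip_young u v d : S u -> S v -> 0 < d ->
  2 * ip u v <= d * norm2 u + d^-1 * norm2 v.
Proof.
move=> Su Sv d0; have Sdu := S_scale d Su.
have := ip_ge0 (d *: u - v); rewrite norm2_sub// !ip_scalel// (ipC u) ip_scalel// => h.
have h1 : 0 <= d^-1 * (d * (d * norm2 u) - 2 * (d * ip u v) + norm2 v).
  by rewrite mulr_ge0// invr_ge0 ltW.
have dd : d * d^-1 = 1 by rewrite divff// gt_eqF.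
have e1 : d^-1 * (d * (d * norm2 u) - 2 * (d * ip u v) + norm2 v) =
    (d * d^-1) * d * norm2 u - 2 * (d * d^-1) * ip u v + d^-1 * norm2 v by lra.
by move: h1; rewrite e1 dd; lra.
Qed.

Lemma ip_youngN u v d : S u -> S v -> 0 < d ->
  - (2 * ip u v) <= d * norm2 u + d^-1 * norm2 v.
Proof.
move=> Su Sv d0; have SN := S_scale (-1) Su.
have := ip_young SN Sv d0.
have e1 : ip u (-1 *: u) = - 1 * ip u u by rewrite ipC ip_scalel.
rewrite (ip_scalel _ Su Sv) (ip_scalel _ Su SN) e1; lra.
Qed.

Definition tail (x : nat -> E) m := [set x k | k in [set k | (m <= k)%N]].

Lemma hull_tail x m n : (m <= n)%N -> hull (tail x n) `<=` hull (tail x m).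
Proof.
move=> mn; apply: hull_sub => _ [k /= nk <-]; apply: sub_hull; exists k => //=.
exact: leq_trans nk.
Qed.

(** The squared distances d m from 0 to the hulls of the tails increase to a finite
    limit. Almost minimal elements y_m are Cauchy: the midpoint of y_i and y_j is in the
    hull of the tail i, so its squared norm is at least d i, and the parallelogram
    identity bounds the distance from y_i to y_j. *)
Lemma cauchy_hull x C : (forall k, S (x k)) -> (forall k, norm2 (x k) <= C) ->
  exists y_ : nat -> E, (forall m, hull (tail x m) (y_ m)) /\
  forall e, 0 < e -> exists N, forall i j, (N <= i)%N -> (N <= j)%N ->
    norm2 (y_ i - y_ j) <= e.
Proof.
move=> Sx xC.
have tS m : hull (tail x m) `<=` S by apply: S_hull => _ [k _ <-].
pose D m := [set norm2 z | z in hull (tail x m)].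
have Dx m : D m (norm2 (x m)) by exists (x m) => //; apply: sub_hull; exists m => /=.
have Dinf m : has_inf (D m).
  by split; [exists (norm2 (x m))|exists 0 => _ [z _ <-]; exact: ip_ge0].
pose d m := inf (D m).
have d_le m z : hull (tail x m) z -> d m <= norm2 z.
  by move=> hz; apply: ge_inf; [case: (Dinf m)|exists z].
have d_nd : {homo d : m n / (m <= n)%N >-> m <= n}.
  move=> m n mn; apply: lb_le_inf; first by case: (Dinf n).
  by move=> _ [z hz <-]; apply: d_le; exact: hull_tail hz.
have dC m : d m <= C by apply: le_trans (xC m); apply: d_le; apply: sub_hull; exists m => /=.
have /(_ _)/cid2-/all_sig2[y_ hy yd] m : exists2 z, hull (tail x m) z & norm2 z < d m + m.+1%:R^-1.
  have m0 : (0 : R) < m.+1%:R^-1 by rewrite invr_gt0.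
  by have [_ [z hz <-] zd] := inf_adherent m0 (Dinf m); exists z.
exists y_; split => // e e0.
have dcvg : d @ \oo --> sup (range d).
  by apply: nondecreasing_cvgn => //; exists C => _ [m _ <-].
have dsup m : d m <= sup (range d).
  by apply: ub_le_sup; [exists C => _ [k _ <-]|exists m].
have [N [N1 N2]] : exists N, sup (range d) - d N < e / 4 /\ N.+1%:R^-1 < e / 8.
  have e4 : 0 < e / 4 by rewrite divr_gt0.
  have e8 : 0 < e / 8 by rewrite divr_gt0.
  near \oo => N; exists N; split; last by near: N; exact: (near_infty_natSinv_lt (PosNum e8)).
  apply: le_lt_trans (ler_norm _) _; near: N.
  by move/cvgrPdist_lt : dcvg; exact.
exists N.
suff H i j : (N <= i)%N -> (i <= j)%N -> norm2 (y_ i - y_ j) <= e.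
  move=> i j Ni Nj; case: (leqP i j) => ij; first exact: H.
  rewrite norm2_sub; [|exact: tS (hy i)|exact: tS (hy j)].
  have := H _ _ Nj (ltnW ij); rewrite norm2_sub; [|exact: tS (hy j)|exact: tS (hy i)].
  by rewrite (ipC (y_ j)); lra.
move=> Ni ij; have yij := hull_tail ij (hy j).
have Si := tS _ _ (hy i); have Sj := tS _ _ (hy j).
have := d_le i _ (hull_convex (t := 2^-1) (hy i) yij _ _).
have h2 : (2^-1 : R) * 2 = 1 by rewrite mulVf.
have h20 : (0 : R) <= 2^-1 by rewrite invr_ge0.
have h21 : (2^-1 : R) <= 1 by lra.
move=> /(_ h20 h21); rewrite norm2_comb// norm2_sub//.
have e1 : 1 - 2^-1 = 2^-1 :> R by lra.
rewrite e1; have e2 : (2^-1 : R) ^+ 2 = 4^-1 by lra.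
have e3 : 2 * 2^-1 * 2^-1 = 2^-1 :> R by lra.
have e4 : (4^-1 : R) * 4 = 1 by rewrite mulVf.
rewrite e2 e3.
have := yd i; have := yd j; have := d_nd _ _ Ni; have := dsup j.
have inv_le k : (N <= k)%N -> k.+1%:R^-1 <= N.+1%:R^-1 :> R.
  by move=> Nk; rewrite lef_pV2 ?posrE// ler_nat.
have := inv_le _ Ni; have := inv_le _ (leq_trans Ni ij).
have : e / 4 = e * 4^-1 by [].
have : e / 8 * 8 = e by rewrite divfK.
have : e / 4 * 4 = e by rewrite divfK.
move: N1 N2; move: (i.+1%:R^-1 : R) (j.+1%:R^-1 : R) (N.+1%:R^-1 : R) => a b c; lra.
Unshelve. all: by end_near. Qed.

(** Mazur's lemma for a sequence that tends weakly to 0 along itself. For the Cauchy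
    sequence y_m of convex combinations, the inner product of y_N and y_l is small for
    large l, because y_l only involves terms that are almost orthogonal to y_N; since
    y_N - y_l is small, so is y_N. *)
Lemma weak_null_hull (v : nat -> E) C (Q : set nat) :
  (forall k, S (v k)) -> (forall k, norm2 (v k) <= C) ->
  (forall i, ip (v i) (v k) @[k --> \oo] --> 0) ->
  (forall m, exists2 k, (m <= k)%N & Q k) ->
  forall e, 0 < e -> exists2 z, hull [set v k | k in Q] z & norm2 z < e.
Proof.
move=> Sv vC v0 Qi.
have [q qh qQ] := increasing_select (fun _ : nat => Qi).
have [y_ [hy cy]] := cauchy_hull (fun k => Sv (q k)) (fun k => vC (q k)).
move=> e e0.
have [N NP] := cy (e / 2) (divr_gt0 e0 (ltr0Sn _ _)).
have yS m : S (y_ m) by apply: S_hull (hy m) => _ [k _ <-].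
exists (y_ N).
  move: (hy N); apply: hull_sub => _ [k _ <-]; apply: sub_hull; exists (q k) => //=.
have lim0 : ip (y_ N) (v k) @[k --> \oo] --> 0.
  suff [] : S (y_ N) /\ ip (y_ N) (v k) @[k --> \oo] --> 0 by [].
  apply: (hy N (fun z => S z /\ ip z (v k) @[k --> \oo] --> 0)) => [a b t [Sa a0] [Sb b0] _ _|_ [k _ <-]]; last by split.
  split; first exact: S_comb.
  rewrite (_ : (fun k => _) = (fun k => t * ip a (v k) + (1 - t) * ip b (v k))).
    have := cvgD (cvgM (cvg_cst t) a0) (cvgM (cvg_cst (1 - t)) b0); rewrite !mulr0 addr0.
    exact.
  by apply/funext => k; rewrite ip_combl.
have e8 : 0 < e / 8 by rewrite divr_gt0.
have [M _ MP] : \forall k \near \oo, `|0 - ip (y_ N) (v k)| < e / 8.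
  by move/cvgrPdist_lt : lim0; exact.
pose l := maxn N M.
have yl : ip (y_ N) (y_ l) <= e / 8.
  suff [] : S (y_ l) /\ ip (y_ N) (y_ l) <= e / 8 by [].
  apply: (hy l (fun z => S z /\ ip (y_ N) z <= e / 8)) => [a b t [Sa a0] [Sb b0] t0 t1|_ [k /= lk <-]].
    split; first exact: S_comb.
    rewrite ip_combr//.
    have h1 : 0 <= t * (e / 8 - ip (y_ N) a) by rewrite mulr_ge0// subr_ge0.
    have h2 : 0 <= (1 - t) * (e / 8 - ip (y_ N) b) by rewrite mulr_ge0// subr_ge0.
    lra.
  split => //; have := MP (q k); rewrite sub0r normrN => h.
  apply: ltW; apply: le_lt_trans (ler_norm _) _; apply: h => /=.
  apply: leq_trans (increasing_ge_id qh k); apply: leq_trans lk; exact: leq_maxr.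
have := NP N l (leqnn _) (leq_maxl _ _); rewrite norm2_sub//.
have := ip_ge0 (y_ l).
have : e / 8 * 8 = e by rewrite divfK.
have : e / 2 * 2 = e by rewrite divfK.
move: yl; lra.
Qed.

(** A bounded sequence has a subsequence and a weak limit y, which is moreover the strong
    limit of convex combinations of the terms of any infinite part Q of the subsequence.
    The inner products of the terms with one another converge along a subsequence, and
    y is the limit of almost minimal convex combinations of its tails. Then x_j - y
    tends weakly to 0 against its own terms, and Mazur's lemma
    applies to every infinite part of this sequence. *)
Theorem weak_compactness (x : nat -> E) C :
  (forall k, S (x k)) -> (forall k, norm2 (x k) <= C) ->
  exists2 j : nat -> nat, {homo j : m n / (m < n)%N} &
  exists2 y, S y & forall Q : set nat, (forall m, exists2 k, (m <= k)%N & Q k) ->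
    forall e, 0 < e -> exists2 z, hull [set x (j k) | k in Q] z & norm2 (z - y) < e.
Proof.
move=> Sx xC.
have ipC' k i : `|ip (x i) (x k)| <= C.
  have := ip_young (Sx i) (Sx k) ltr01; have := ip_youngN (Sx i) (Sx k) ltr01.
  rewrite invr1 !mul1r; have := xC i; have := xC k => h1 h2 h3 h4.
  rewrite ler_norml; apply/andP; split; lra.
have [j jh [c jc]] := diagonal_subsequence ipC'.
exists j => //.
pose x' k := x (j k).
have Sx' k : S (x' k) by exact: Sx.
have x'C k : norm2 (x' k) <= C by exact: xC.
have cx' i : ip (x' i) (x' k) @[k --> \oo] --> c (j i) by exact: (jc (j i)).
have [y_ [hy cy]] := cauchy_hull Sx' x'C.
have yS m : S (y_ m) by apply: S_hull (hy m) => _ [k _ <-].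
have [y Sy yc] := ip_complete yS cy.
exists y => //.
pose v k := x' k - y.
have Sv k : S (v k) by exact: S_sub.
pose C' := 2 * C + 2 * norm2 y.
have vC k : norm2 (v k) <= C'.
  rewrite norm2_sub//; have := ip_youngN (Sx' k) Sy ltr01; rewrite invr1 !mul1r.
  by rewrite /C'; have := x'C k; lra.
pose W w := S w /\ ip w (v k) @[k --> \oo] --> 0.
have W_convex : convexP W.
  move=> a b t [Sa a0] [Sb b0] _ _; split; first exact: S_comb.
  rewrite (_ : (fun k => _) = (fun k => t * ip a (v k) + (1 - t) * ip b (v k))).
    have := cvgD (cvgM (cvg_cst t) a0) (cvgM (cvg_cst (1 - t)) b0); rewrite !mulr0 addr0.
    exact.
  by apply/funext => k; rewrite ip_combl.
have W_lim w (l : R) : S w -> ip w (x' k) @[k --> \oo] --> l -> W w.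
  move=> Sw wl; split => //.
  (* the limit of <w, x'_k> is that of <w, y_m>, since y_m is a convex combination of
     the x'_k for k >= m *)
  suff lE : l = ip w y.
    rewrite (_ : (fun k => _) = (fun k => ip w (x' k) - ip w y)).
      by rewrite -(subrr l) {2}lE; apply: cvgB => //; exact: cvg_cst.
    by apply/funext => k; rewrite ip_subr//.
  have near_l e : 0 < e -> exists N, forall m, (N <= m)%N -> `|ip w (y_ m) - l| <= e.
    move=> e0; have [N _ NP] : \forall k \near \oo, `|l - ip w (x' k)| < e.
      by move/cvgrPdist_lt : wl; exact.
    exists N => m Nm.
    suff [] : S (y_ m) /\ `|ip w (y_ m) - l| <= e by [].
    apply: (hy m (fun z => S z /\ `|ip w z - l| <= e)) => [a b t [Sa a0] [Sb b0] t0 t1|_ [k /= mk <-]].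
      split; first exact: S_comb.
      rewrite ip_combr//.
      have -> : t * ip w a + (1 - t) * ip w b - l =
        t * (ip w a - l) + (1 - t) * (ip w b - l) by lra.
      apply: le_trans (ler_normD _ _) _; rewrite !normrM ger0_norm//.
      rewrite (@ger0_norm _ (1 - t)) ?subr_ge0//.
      have h1 : 0 <= t * (e - `|ip w a - l|) by rewrite mulr_ge0// subr_ge0.
      have h2 : 0 <= (1 - t) * (e - `|ip w b - l|) by rewrite mulr_ge0// subr_ge0.
      lra.
    split => //; rewrite distrC ltW//; apply: NP => /=; exact: leq_trans mk.
  apply/eqP; rewrite -subr_eq0 -normr_eq0 eq_le normr_ge0 andbT.
  apply/ler_addgt0Pl => e e0; rewrite addr0.
  have [N NP] := near_l (e / 2) (divr_gt0 e0 (ltr0Sn _ _)).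
  pose d := e / (2 * (norm2 w + 1)).
  have w1 : 0 < norm2 w + 1 by have := ip_ge0 w; lra.
  have d0 : 0 < d by rewrite divr_gt0// mulr_gt0.
  have [N' NP'] := yc (e * d / 2) (divr_gt0 (mulr_gt0 e0 d0) (ltr0Sn _ _)).
  have := NP _ (leq_maxl N N'); have := NP' _ (leq_maxr N N').
  set m := maxn N N' => h1 h2.
  have hd : d * norm2 w <= e / 2.
    have -> : e / 2 = d * (norm2 w + 1).
      by rewrite /d invfM !mulrA mulfVK// gt_eqF.
    by rewrite ler_pM2l//; lra.
  have hd' : d^-1 * norm2 (y_ m - y) <= e / 2.
    rewrite mulrC ler_pdivrMr//; apply: le_trans h1 _; lra.
  have Sm := S_sub (yS m) Sy.
  have := ip_young Sw Sm d0; have := ip_youngN Sw Sm d0.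
  rewrite (ip_subr (yS m) Sy Sw) => y1 y2.
  move: h2; rewrite ler_norml => /andP[h3 h4].
  have : e / 2 * 2 = e by rewrite divfK.
  move=> ee; rewrite ler_norml; apply/andP; split; lra.
have Wx i : W (x' i) by apply: W_lim (cx' i).
have Wy : W y.
  split=> //; apply/cvgrPdist_le => e e0.
  have C'1 : 0 < C' + 1 by have := vC 0%N; have := ip_ge0 (v 0%N); lra.
  pose d := e / (C' + 1).
  have d0 : 0 < d by rewrite divr_gt0.
  have [N NP] := yc (e * d / 4) (divr_gt0 (mulr_gt0 e0 d0) (ltr0Sn _ _)).
  have [_ yN0] : W (y_ N) by apply: (hy N) => // _ [k _ <-]; exact: Wx.
  have e4 : 0 < e / 4 by rewrite divr_gt0.
  have [M _ MP] : \forall k \near \oo, `|0 - ip (y_ N) (v k)| < e / 4.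
    by move/cvgrPdist_lt : yN0; exact.
  exists M => // k /= Mk; have := MP k Mk; rewrite !sub0r !normrN => h1.
  have Sm := S_sub (yS N) Sy.
  have di0 : 0 < d^-1 by rewrite invr_gt0.
  have := ip_young Sm (Sv k) di0; have := ip_youngN Sm (Sv k) di0.
  rewrite invrK (ip_subl (yS N) Sy (Sv k)) => y1 y2.
  have hd : d * norm2 (v k) <= e.
    have -> : e = d * (C' + 1) by rewrite /d divfK// gt_eqF.
    by rewrite ler_pM2l//; have := vC k; lra.
  have hd' : d^-1 * norm2 (y_ N - y) <= e / 4.
    rewrite mulrC ler_pdivrMr//; apply: le_trans (NP N _) _ => //; lra.
  have : e / 4 * 4 = e by rewrite divfK.
  move: h1; rewrite ltr_norml => /andP[h3 h4].
  move=> ee; rewrite ler_norml; apply/andP; split; lra.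
have v0 i : ip (v i) (v k) @[k --> \oo] --> 0.
  have [_ a0] := Wx i; have [_ b0] := Wy.
  rewrite (_ : (fun k => _) = (fun k => ip (x' i) (v k) - ip y (v k))).
    by have := cvgB a0 b0; rewrite subrr; exact.
  by apply/funext => k; rewrite ip_subl.
move=> Q Qi e e0; have [z hz ze] := weak_null_hull Sv vC v0 Qi e0.
exists (z + y); last by rewrite addrK.
apply: (hz (fun z => hull [set x (j k) | k in Q] (z + y))).
  move=> a b t ha hb t0 t1.
  rewrite addrC convex_comb_add ![y + _]addrC.
  exact: hull_convex.
by move=> _ [k Qk <-]; rewrite /v subrK; apply: sub_hull; exists k.
Qed.

End hilbert.

(** * Weak derivatives of order at most two *)
Lemma LpP (R : realType) n (Om : set 'rV[R]_n) (p : R) f :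
  measurable (Om : set (lebesgue_rV_type R n)) -> 0 < p -> Lp Om p%:E f <->
  measurable_fun (Om : set (lebesgue_rV_type R n)) (f : lebesgue_rV_type R n -> R) /\
  (moment (@lebesgue_rV R n) Om p f < +oo)%E.
Proof. by move=> mOm p0; exact: (@Lfun_moment _ _ _ (@lebesgue_rV R n) Om mOm p f p0). Qed.

Lemma LpooP (R : realType) n (Om : set 'rV[R]_n) f :
  measurable (Om : set (lebesgue_rV_type R n)) -> Lp Om +oo%E f <->
  measurable_fun (Om : set (lebesgue_rV_type R n)) (f : lebesgue_rV_type R n -> R) /\
  exists2 c, 0 <= c & {ae @lebesgue_rV R n, forall x, Om x -> `|f x| <= c}.
Proof. by move=> mOm; exact: (@Lfun_oo _ _ _ (@lebesgue_rV R n) Om mOm f). Qed.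

Definition has_wderiv (R : realType) n (Om : set 'rV[R]_n) u :=
  forall a, (size a <= 2)%N -> weak_deriv Om a u (wderiv Om a u).

(** Equivalent, for smallness and boundedness, to the norm of W^{2,p}; the empty sequence
    of directions contributes the function itself. *)
HB.lock Definition energy (R : realType) n (Om : set 'rV[R]_n) (p : R) u : \bar R :=
  (\sum_(a : 2.-bseq 'I_n) moment (@lebesgue_rV R n) Om p (wderiv Om a u))%E.

Section sobolev_space.
Variables (R : realType) (n : nat).
Notation V := 'rV[R]_n.
Notation L := (lebesgue_rV_type R n).
Notation mu := (@lebesgue_rV R n).
Implicit Types (u v w phi : V -> R) (p : R) (a : seq 'I_n).
Variables (Om : set V) (oO : open Om).
Let mOm := open_lebesgue oO.
Notation D := (wderiv Om).
Local Notation has_wderiv := (@has_wderiv R n Om).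
Local Notation energy := (@energy R n Om).

Lemma wderivP a u v : weak_deriv Om a u v -> weak_deriv Om a u (D a u).
Proof. by move=> h; apply: (@xgetPex _ _ [set v | weak_deriv Om a u v]); exists v. Qed.

Lemma wderiv_ae a u v : weak_deriv Om a u v -> {ae mu, forall x, Om x -> D a u x = v x}.
Proof. by move=> h; apply: weak_deriv_unique (wderivP h) h. Qed.

Lemma measurable_wderiv a u : has_wderiv u -> (size a <= 2)%N ->
  measurable_fun (Om : set L) (D a u : L -> R).
Proof. by move=> h /h[_ + _]; exact: L1loc_measurable. Qed.

Lemma moment_wderiv p u a (f : V -> R) : has_wderiv u -> (size a <= 2)%N ->
  measurable_fun (Om : set L) (f : L -> R) ->
  {ae mu, forall x, Om x -> D a u x = f x} ->
  moment mu Om p (D a u) = moment mu Om p f.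
Proof.
move=> hu a2 mf fE.
exact: (@moment_ae _ _ _ mu (Om : set L) mOm p _ _ (measurable_wderiv hu a2) mf fE).
Qed.

Lemma weak_deriv_nil u : L1loc Om u -> weak_deriv Om [::] u u.
Proof. by move=> uL; split => // phi _; rewrite expr0 mul1r. Qed.

Lemma wderiv_nil u : L1loc Om u -> {ae mu, forall x, Om x -> D [::] u x = u x}.
Proof. by move=> /weak_deriv_nil; exact: wderiv_ae. Qed.

Lemma has_wderiv_L1loc u : has_wderiv u -> L1loc Om u.
Proof. by move=> /(_ [::] isT)[]. Qed.

Lemma has_wderiv_lin c u v : has_wderiv u -> has_wderiv v ->
  has_wderiv (fun x => c * u x + v x).
Proof.
by move=> hu hv a a2; apply: wderivP (weak_deriv_lin c oO (hu a a2) (hv a a2)).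
Qed.

Lemma wderiv_lin c u v a : has_wderiv u -> has_wderiv v -> (size a <= 2)%N ->
  {ae mu, forall x, Om x -> D a (fun x => c * u x + v x) x = c * D a u x + D a v x}.
Proof.
by move=> hu hv a2; apply: wderiv_ae (weak_deriv_lin c oO (hu a a2) (hv a a2)).
Qed.

Lemma has_wderiv_sub u v : has_wderiv u -> has_wderiv v ->
  has_wderiv (fun x => u x - v x).
Proof.
move=> hu hv; have -> : (fun x => u x - v x) = (fun x => -1 * v x + u x).
  by apply/funext => x; rewrite mulN1r addrC.
exact: has_wderiv_lin.
Qed.

Lemma wderiv_sub u v a : has_wderiv u -> has_wderiv v -> (size a <= 2)%N ->
  {ae mu, forall x, Om x -> D a (fun x => u x - v x) x = D a u x - D a v x}.
Proof.
move=> hu hv a2; have E : (fun x => u x - v x) = (fun x => -1 * v x + u x).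
  by apply/funext => x; rewrite mulN1r addrC.
rewrite E; apply: (ae_imp (wderiv_lin (-1) hv hu a2)) => x h Ox.
by rewrite h// mulN1r addrC.
Qed.

Lemma weak_deriv_scale c u v a : weak_deriv Om a u v ->
  weak_deriv Om a (fun x => c * u x) (fun x => c * v x).
Proof.
move=> h; have E (w : V -> R) : (fun x => c * w x) = (fun x => (c - 1) * w x + w x).
  by apply/funext => x; lra.
rewrite !E; exact: weak_deriv_lin.
Qed.

Lemma has_wderiv_comb c d u v : has_wderiv u -> has_wderiv v ->
  has_wderiv (fun x => c * u x + d * v x).
Proof.
move=> hu hv a a2.
exact: wderivP (weak_deriv_lin c oO (hu a a2) (weak_deriv_scale d (hv a a2))).
Qed.

Lemma wderiv_comb c d u v a : has_wderiv u -> has_wderiv v -> (size a <= 2)%N ->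
  {ae mu, forall x, Om x ->
    D a (fun x => c * u x + d * v x) x = c * D a u x + d * D a v x}.
Proof.
move=> hu hv a2.
exact: wderiv_ae (weak_deriv_lin c oO (hu a a2) (weak_deriv_scale d (hv a a2))).
Qed.

Lemma has_wderiv_smooth phi : smooth phi -> has_wderiv phi.
Proof. by move=> sphi a _; apply: wderivP (weak_deriv_smooth a oO sphi). Qed.

Lemma wderiv_smooth a phi : smooth phi ->
  {ae mu, forall x, Om x -> D a phi x = partial a phi x}.
Proof. by move=> sphi; apply: wderiv_ae (weak_deriv_smooth a oO sphi). Qed.

(** The chosen representatives of the two mixed derivatives agree everywhere, because
    they are chosen from the same set, by the symmetry for test functions. *)
Lemma D2_sym u x : symmx (D2 Om u x).
Proof.
rewrite /symmx /=; apply/matrixP => i j; rewrite !mxE /wderiv.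
have E : [set v | weak_deriv Om [:: j; i] u v] = [set v | weak_deriv Om [:: i; j] u v].
  have H (k l : 'I_n) v : weak_deriv Om [:: k; l] u v -> weak_deriv Om [:: l; k] u v.
    move=> [uL vL h]; split; [exact: uL|exact: vL|move=> phi tphi].
    have E : partial [:: l; k] phi = partial [:: k; l] phi.
      by apply: (@smooth_comm _ _ phi l k); case: tphi.
    rewrite E; exact: h.
  by apply/seteqP; split => v; exact: H.
exact: (congr1 (fun S => xget (cst 0) S x) E).
Qed.

Definition sob p u := has_wderiv u /\
  forall a, (size a <= 2)%N -> (moment mu Om p (D a u) < +oo)%E.

Lemma energyE p u : energy p u = (\sum_(a : 2.-bseq 'I_n) moment mu Om p (D a u))%E.
Proof. by rewrite unlock. Qed.

Lemma energy_ge0 p u : (0 <= energy p u)%E.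
Proof. by rewrite energyE; apply: sume_ge0 => a _; exact: moment_ge0. Qed.

Lemma moment_le_energy p u a : (size a <= 2)%N ->
  (moment mu Om p (D a u) <= energy p u)%E.
Proof.
move=> a2; rewrite energyE (bigD1 (Bseq a2))//=.
by rewrite leeDl// sume_ge0// => b _; exact: moment_ge0.
Qed.

Lemma moment_wderiv_sub p u v a : has_wderiv u -> has_wderiv v -> (size a <= 2)%N ->
  moment mu Om p (D a (fun x => u x - v x)) = moment mu Om p (fun x => D a u x - D a v x).
Proof.
move=> hu hv a2.
have mu' := measurable_wderiv hu a2; have mv := measurable_wderiv hv a2.
exact: (moment_wderiv p (has_wderiv_sub hu hv) a2 (measurable_funB mu' mv) (wderiv_sub hu hv a2)).
Qed.

Lemma energy_subC p u v : has_wderiv u -> has_wderiv v ->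
  energy p (fun x => u x - v x) = energy p (fun x => v x - u x).
Proof.
move=> hu hv; rewrite !energyE; apply: eq_bigr => a _; have a2 := size_bseq a.
rewrite (moment_wderiv_sub p hu hv a2) (moment_wderiv_sub p hv hu a2) !momentE.
by apply: eq_integral => x _; rewrite distrC.
Qed.

Lemma sob_energy p u : sob p u <-> has_wderiv u /\ (energy p u < +oo)%E.
Proof.
split=> -[hu uf]; split => //.
  by rewrite energyE; apply: lte_sum_pinfty => a _; apply: uf; exact: size_bseq.
by move=> a a2; apply: le_lt_trans (moment_le_energy _ _ a2) uf.
Qed.

Lemma energy_bseq_le p u (C : R) : (forall a, (size a <= 2)%N ->
  (moment mu Om p (D a u) <= C%:E)%E) -> (energy p u <= (#|{: 2.-bseq 'I_n}|%:R * C)%:E)%E.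
Proof.
move=> h; rewrite energyE; apply: (@le_trans _ _ (\sum_(a : 2.-bseq 'I_n) C%:E)%E).
  by apply: lee_sum => a _; apply: h; exact: size_bseq.
by rewrite sumEFin lee_fin sumr_const mulr_natl.
Qed.

Lemma energy_lin p c u v : 0 <= p -> has_wderiv u -> has_wderiv v ->
  (energy p (fun x => c * u x + v x)%R <=
   ((2 * `|c|) `^ p)%:E * energy p u + (2 `^ p)%:E * energy p v)%E.
Proof.
move=> p0 hu hv; rewrite !energyE; apply: lee_sum_lin.
- by move=> a; exact: moment_ge0.
- by move=> a; exact: moment_ge0.
move=> a; have a2 := size_bseq a.
have mu' := measurable_wderiv hu a2; have mv := measurable_wderiv hv a2.
have huv := has_wderiv_lin c hu hv.
have -> := moment_ae mOm p (measurable_wderiv huv a2) (measurable_lin c mu' mv)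
  (wderiv_lin c hu hv a2).
have H := @moment_linE _ _ _ mu Om mOm p c _ _ p0 mu' mv.
exact: H.
Qed.

Lemma sob_lin p c u v : 0 <= p -> sob p u -> sob p v -> sob p (fun x => c * u x + v x).
Proof.
move=> p0 /sob_energy[hu eu] /sob_energy[hv ev]; apply/sob_energy.
split; first exact: has_wderiv_lin.
apply: le_lt_trans (energy_lin c p0 hu hv) _.
by apply: lte_scaleD; rewrite ?powR_ge0.
Qed.

(** The measure of Om is finite, so that p-integrable functions are locally integrable. *)
Lemma W2P p u : 1 <= p -> (mu Om < +oo)%E -> W2 Om p%:E u <-> sob p u.
Proof.
move=> p1 Omfin; have p0 : 0 < p by lra.
split=> [[/(LpP _ mOm p0)[mu' up] h]|[hu up]].
  have uL : L1loc Om u.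
    have := integrable_moment1 mOm Omfin p1 mu' up.
    by move=> iu K cK KO; apply: integrableS iu => //; exact: compact_lebesgue.
  have wd a : (size a <= 2)%N -> weak_deriv Om a u (D a u) /\ (moment mu Om p (D a u) < +oo)%E.
    case: a => [_|i a a2].
      have h0 := weak_deriv_nil uL; have h1 := wderivP h0; split; first exact: h1.
      rewrite (@moment_ae _ _ _ mu (Om : set L) mOm _ _ _ _ mu' (wderiv_ae h0))//.
      by case: h1 => _ + _; exact: L1loc_measurable.
    have [v wv /(LpP _ mOm p0)[mv vp]] := h (i :: a) a2.
    have h1 := wderivP wv; split; first exact: h1.
    rewrite (@moment_ae _ _ _ mu (Om : set L) mOm _ _ _ _ mv (wderiv_ae wv))//.
    by case: h1 => _ + _; exact: L1loc_measurable.
  by split => a /wd[].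
have uL := has_wderiv_L1loc hu.
have mu' := L1loc_measurable oO uL.
split.
  apply/(LpP _ mOm p0); split => //.
  rewrite -(@moment_ae _ _ _ mu (Om : set L) mOm _ _ _ _ mu' (wderiv_nil uL)); first exact: up.
  exact: measurable_wderiv.
move=> a /andP[_ a2]; exists (D a u); first exact: hu.
by apply/(LpP _ mOm p0); split; [exact: measurable_wderiv|exact: up].
Qed.

Lemma W2ooP u : (mu Om < +oo)%E -> W2 Om +oo%E u <-> has_wderiv u /\
  forall a, (size a <= 2)%N -> exists2 c, 0 <= c & {ae mu, forall x, Om x -> `|D a u x| <= c}.
Proof.
move=> Omfin; split=> [[/(LpooP _ mOm)[mu' [c c0 uc]] h]|[hu hb]].
  have uL : L1loc Om u.
    have := @integrable_moment1 _ _ _ mu (Om : set L) mOm Omfin 1 u (lexx _) mu'.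
    have u1 : (moment mu Om 1 u < +oo)%E.
      exact: (moment_bounded_fin mOm Omfin ler01 c0 mu' uc).
    move=> /(_ u1) iu K cK KO; apply: integrableS iu => //; exact: compact_lebesgue.
  have wd a : (size a <= 2)%N -> weak_deriv Om a u (D a u) /\
      exists2 c, 0 <= c & {ae mu, forall x, Om x -> `|D a u x| <= c}.
    case: a => [_|i a a2].
      have h0 := weak_deriv_nil uL; have h1 := wderivP h0; split; first exact: h1.
      by exists c => //; apply: (ae_imp2 uc (wderiv_ae h0)) => x h2 h3 Ox; rewrite h3// h2.
    have [v wv /(LpooP _ mOm)[mv [c' c'0 vc]]] := h (i :: a) a2.
    have h1 := wderivP wv; split; first exact: h1.
    by exists c' => //; apply: (ae_imp2 vc (wderiv_ae wv)) => x h2 h3 Ox; rewrite h3// h2.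
  by split => a /wd[].
have uL := has_wderiv_L1loc hu.
have mu' := L1loc_measurable oO uL.
split.
  apply/(LpooP _ mOm); split => //; have [c c0 hc] := hb [::] isT; exists c => //.
  by apply: (ae_imp2 hc (wderiv_nil uL)) => x h2 h3 Ox; rewrite -h3// h2.
move=> a /andP[_ a2]; exists (D a u); first exact: hu.
by apply/(LpooP _ mOm); split; [exact: measurable_wderiv|exact: hb].
Qed.

Lemma W2oo_sob p u : (mu Om < +oo)%E -> 0 <= p -> W2 Om +oo%E u -> sob p u.
Proof.
move=> Omfin p0 /(W2ooP _ Omfin)[hu hb]; split => // a a2; have [c c0 hc] := hb a a2.
exact: (moment_bounded_fin mOm Omfin p0 c0 (measurable_wderiv hu a2) hc).
Qed.

End sobolev_space.

(** * Functions vanishing on the boundary *)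
Section test_sob.
Variables (R : realType) (n : nat).
Notation V := 'rV[R]_n.
Notation L := (lebesgue_rV_type R n).
Notation mu := (@lebesgue_rV R n).
Implicit Types (u v w z phi : V -> R) (p : R) (a : seq 'I_n).
Variables (Om : set V) (oO : open Om) (Omfin : (mu Om < +oo)%E).
Let mOm := open_lebesgue oO.
Notation D := (wderiv Om).
Notation N := #|{: 2.-bseq 'I_n}|.

Lemma test_fun_bounded phi : test_fun Om phi ->
  exists2 c : R, 0 <= c & forall x, `|phi x| <= c.
Proof.
move=> [sphi [K [cK KO phi0]]].
have /compact_bounded[M [Mr H]] : compact (phi @` K).
  apply: continuous_compact => //; apply: continuous_subspaceT.
  exact: smooth_continuous.
exists (`|M| + 1) => [|x]; first by rewrite addr_ge0.
have [Kx|Kx] := pselect (K x); last by rewrite phi0// normr0 addr_ge0.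
by apply: (H (`|M| + 1)); [rewrite ltr_pwDr// ler_norm|exists x].
Qed.

Lemma test_fun_moment p phi : 0 <= p -> test_fun Om phi -> (moment mu Om p phi < +oo)%E.
Proof.
move=> p0 tphi; have [c c0 hc] := test_fun_bounded tphi.
apply: (moment_bounded_fin mOm Omfin p0 c0); last by apply: aeW => x _; exact: hc.
apply: measurable_funTS; apply: continuous_lebesgue; apply: smooth_continuous.
by case: tphi.
Qed.

Lemma moment_smooth p phi a : (size a <= 2)%N -> smooth phi ->
  moment mu Om p (D a phi) = moment mu Om p (partial a phi).
Proof.
move=> a2 sphi.
have m1 := measurable_wderiv oO (has_wderiv_smooth oO sphi) a2.
have m2 : measurable_fun (Om : set L) (partial a phi : L -> R).
  apply: measurable_funTS; apply: continuous_lebesgue; apply: smooth_continuous.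
  exact: smooth_partial.
exact: (moment_wderiv oO p (has_wderiv_smooth oO sphi) a2 m2 (wderiv_smooth oO a sphi)).
Qed.

Lemma sob_test p phi : 0 <= p -> test_fun Om phi -> sob Om p phi.
Proof.
move=> p0 tphi; have sphi := test_fun_smooth tphi.
split; first exact: has_wderiv_smooth.
move=> a a2; rewrite moment_smooth//; apply: test_fun_moment => //.
exact: test_fun_partial.
Qed.

Lemma Lp_norm_le_energy p u a f (e : R) : 1 <= p -> 0 < e -> has_wderiv Om u ->
  (size a <= 2)%N -> measurable_fun (Om : set L) (f : L -> R) ->
  {ae mu, forall x, Om x -> D a u x = f x} ->
  (energy Om p u < (e `^ p)%:E)%E -> (Lp_norm Om p%:E f <= e%:E)%E.
Proof.
move=> p1 e0 hu a2 mf fE h; have p0 : 0 < p by lra.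
apply: ltW; apply: (Lnorm_lt_moment p0 e0); apply: le_lt_trans h.
rewrite -(moment_wderiv oO p hu a2 mf fE).
exact: moment_le_energy.
Qed.

Lemma W2_norm_le_energy p (e : R) : 1 <= p -> 0 < e -> exists2 d, 0 < d &
  forall u, has_wderiv Om u -> (energy Om p u <= d%:E)%E -> (W2_norm Om p%:E u <= e%:E)%E.
Proof.
move=> p1 e0; pose K : R := (1 + n + n * n)%:R.
have K0 : 0 < K by rewrite ltr0n.
have eK : 0 < e / K by rewrite divr_gt0.
exists ((e / K) `^ p / 2); first by rewrite divr_gt0// powR_gt0.
move=> u hu h.
have {}h : (energy Om p u < ((e / K) `^ p)%:E)%E.
  apply: le_lt_trans h _; rewrite lte_fin ltr_pdivrMr// ltr_pMr ?powR_gt0//; lra.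
have B a : (size a <= 2)%N -> (Lp_norm Om p%:E (D a u) <= (e / K)%:E)%E.
  move=> a2; apply: (Lp_norm_le_energy p1 eK hu a2 _ _ h).
    exact: measurable_wderiv.
  by apply: aeW.
have B0 : (Lp_norm Om p%:E u <= (e / K)%:E)%E.
  apply: (@Lp_norm_le_energy p u [::] u _ p1 eK hu isT _ _ h).
    by apply: L1loc_measurable => //; exact: has_wderiv_L1loc.
  by apply: wderiv_nil => //; exact: has_wderiv_L1loc.
have -> : e%:E = ((e / K)%:E + \sum_(i < n) (e / K)%:E + \sum_(i < n) \sum_(j < n) (e / K)%:E)%E.
  rewrite sumEFin sumr_const card_ord.
  rewrite sumEFin sumr_const card_ord -!EFinD; congr EFin.
  rewrite -mulrnA -[X in X + _ + _]mulr1n -!mulrnDr -mulr_natr -/K.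
  by rewrite divfK// gt_eqF.
rewrite /W2_norm; apply: leeD; first apply: leeD => //.
  by apply: lee_sum => i _; exact: B.
by apply: lee_sum => i _; apply: lee_sum => j _; exact: B.
Qed.

Lemma energy_le_W2_norm p (e : R) : 1 <= p -> 0 < e -> exists2 d, 0 < d &
  forall u, has_wderiv Om u -> (W2_norm Om p%:E u < d%:E)%E -> (energy Om p u <= e%:E)%E.
Proof.
move=> p1 e0; have p0 : 0 < p by lra.
pose K : R := N%:R + 1; have K0 : 0 < K by rewrite ltr_wpDl.
have eK : 0 < e / K by rewrite divr_gt0.
exists ((e / K) `^ p^-1); first by rewrite powR_gt0.
set s := _ `^ _; have s0 : 0 < s by rewrite powR_gt0.
have sE : s `^ p = e / K by rewrite /s -powRrM mulVf ?gt_eqF// powRr1// ltW.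
move=> u hu h.
have L0 f : (0 <= Lp_norm Om p%:E f)%E by exact: Lnorm_ge0.
have B a : (size a <= 2)%N -> (moment mu Om p (D a u) <= (e / K)%:E)%E.
  case: a => [_|i [|j [|//]] _].
  - have uL := has_wderiv_L1loc hu.
    rewrite (@moment_wderiv _ _ _ oO p u [::] u hu isT (L1loc_measurable oO uL)
      (wderiv_nil oO uL)) -sE; apply: moment_lt_Lnorm => //.
    apply: le_lt_trans h; rewrite /W2_norm -addeA leeDl// adde_ge0// sume_ge0// => i _.
    by rewrite sume_ge0.
  - rewrite -sE; apply: moment_lt_Lnorm => //; apply: le_lt_trans h.
    rewrite /W2_norm (bigD1 i)//= -!addeA; apply: (le_trans _ (leeDr _ (L0 u))).
    by rewrite leeDl// adde_ge0// sume_ge0// => k _; rewrite sume_ge0.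
  - rewrite -sE; apply: moment_lt_Lnorm => //; apply: le_lt_trans h.
    rewrite /W2_norm [X in (_ <= _ + X)%E](bigD1 i)//= [X in (_ <= _ + (X + _))%E](bigD1 j)//=.
    rewrite addeC -!addeA leeDl// ?adde_ge0// ?sume_ge0// => k _; rewrite sume_ge0//.
apply: le_trans (energy_bseq_le B) _.
rewrite lee_fin mulrCA -[leRHS]mulr1 ler_pM2l// ler_pdivrMr// mul1r /K lerDl//.
Qed.

Lemma W20P p u : 1 <= p -> W20 Om p%:E u <-> sob Om p u /\
  forall e : R, 0 < e -> exists2 phi, test_fun Om phi &
    (energy Om p (fun x => u x - phi x)%R <= e%:E)%E.
Proof.
move=> p1; have p0 : 0 <= p by lra.
have hsub v phi : has_wderiv Om v -> test_fun Om phi -> has_wderiv Om (v \- phi).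
  move=> hv tphi; have [hphi _] := sob_test p0 tphi.
  exact: (has_wderiv_sub oO hv hphi).
split=> -[].
  move=> /(W2P oO _ p1 Omfin) su h; split=> // e e0.
  have [d d0 dP] := energy_le_W2_norm p1 e0.
  have [phi tphi phid] := h _ d0; exists phi => //; apply: dP => //.
  by apply: hsub => //; case: su.
move=> su h; split; first exact/(W2P oO _ p1 Omfin).
move=> e e0; have e2 : 0 < e / 2 by rewrite divr_gt0.
have [d d0 dP] := W2_norm_le_energy p1 e2.
have [phi tphi phid] := h _ d0; exists phi => //.
apply: (@le_lt_trans _ _ (e / 2)%:E); last by rewrite lte_fin ltr_pdivrMr//; lra.
by apply: dP => //; apply: hsub => //; case: su.
Qed.

Lemma W20_lin p (c : R) u v : 1 <= p -> W20 Om p%:E u -> W20 Om p%:E v ->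
  W20 Om p%:E (fun x => c * u x + v x).
Proof.
move=> p1; have p0 : 0 <= p by lra.
move=> /(W20P _ p1)[su hu] /(W20P _ p1)[sv hv]; apply/(W20P _ p1).
split; first exact: sob_lin.
move=> e e0; pose A := (2 * `|c|) `^ p + 2 `^ p.
have A0 : 0 <= A by rewrite addr_ge0// powR_ge0.
pose s := e / (A + 1); have s0 : 0 < s by rewrite divr_gt0//; lra.
have [phi tphi hphi] := hu _ s0; have [psi tpsi hpsi] := hv _ s0.
exists (fun x => c * phi x + psi x); first exact: test_funD.
have hs w z : sob Om p w -> sob Om p z -> has_wderiv Om (fun x => w x - z x).
  move=> [hw _] [hz _]; exact: has_wderiv_sub.
have -> : (fun x => c * u x + v x - (c * phi x + psi x)) =
   (fun x => c * (u x - phi x) + (v x - psi x)).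
  by apply/funext => x; lra.
apply: le_trans (energy_lin oO c p0 (hs _ _ su (sob_test p0 tphi)) (hs _ _ sv (sob_test p0 tpsi))) _.
apply: (@le_trans _ _ (((2 * `|c|) `^ p)%:E * s%:E + (2 `^ p)%:E * s%:E)%E).
  by apply: leeD; apply: lee_wpmul2l => //; rewrite lee_fin powR_ge0.
rewrite -!EFinM -EFinD -mulrDl lee_fin -/A /s mulrCA ler_piMr ?ltW// ltr_pdivrMr; lra.
Qed.

(** A diagonal argument: the approximations of the approximations are test functions. *)
Lemma W20_closed p u : 1 <= p -> sob Om p u ->
  (forall e : R, 0 < e -> exists2 z, W20 Om p%:E z &
    (energy Om p (fun x => u x - z x)%R <= e%:E)%E) -> W20 Om p%:E u.
Proof.
move=> p1 su h; have p0 : 0 <= p by lra.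
apply/(W20P _ p1); split => // e e0.
pose A : R := 2 `^ p + 2 `^ p; have A0 : 0 <= A by rewrite addr_ge0// powR_ge0.
pose s := e / (A + 1); have s0 : 0 < s by rewrite divr_gt0//; lra.
have [z /(W20P _ p1)[sz zc] uz] := h _ s0; have [phi tphi zphi] := zc _ s0.
exists phi => //.
have hs w y : sob Om p w -> sob Om p y -> has_wderiv Om (fun x => w x - y x).
  move=> [hw _] [hz _]; exact: has_wderiv_sub.
have -> : (fun x => u x - phi x) = (fun x => 1 * (u x - z x) + (z x - phi x)).
  by apply/funext => x; lra.
apply: le_trans (energy_lin oO 1 p0 (hs _ _ su sz) (hs _ _ sz (sob_test p0 tphi))) _.
rewrite normr1 mulr1.
apply: (@le_trans _ _ ((2 `^ p)%:E * s%:E + (2 `^ p)%:E * s%:E)%E).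
  by apply: leeD; apply: lee_wpmul2l => //; rewrite lee_fin powR_ge0.
rewrite -!EFinM -EFinD -mulrDl lee_fin -/A /s mulrCA ler_piMr ?ltW// ltr_pdivrMr; lra.
Qed.

End test_sob.

(** * The Poincare inequality *)
Section poincare.
Variables (R : realType) (n : nat).
Notation V := 'rV[R]_n.+1.
Notation mu := (@lebesgue_rV R n.+1).
Implicit Types (u v w z phi : V -> R) (a : seq 'I_n.+1).
Variables (Om : set V) (oO : open Om) (Omfin : (mu Om < +oo)%E).
Variables (M : R) (M0 : 0 < M) (OmM : Om `<=` cube M).
Let mOm := open_lebesgue oO.
Notation D := (wderiv Om).
Notation K := (2 * (M + 1)).

Lemma moment_support (k : nat) (h : V -> R) : continuous h -> (forall x, ~ Om x -> h x = 0) ->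
  moment mu Om k.+1%:R h = (\int[lebesgue_borel_rV R n.+1]_x (`|h x| ^+ k.+1)%:E)%E.
Proof.
move=> ch h0.
have E : moment mu Om k.+1%:R h = (\int[mu]_(x in Om) (`|h x| ^+ k.+1)%:E)%E.
  by rewrite momentE; apply: eq_integral => x _; rewrite powR_mulrn.
rewrite E integral_support; last by move=> x /h0 ->; rewrite normr0 expr0n.
apply: integral_borel => //; apply/measurable_EFinP; apply: measurable_funX.
by apply: measurableT_comp => //; exact: continuous_borel.
Qed.

Lemma poincare_test (k : nat) phi : test_fun Om phi ->
  (moment mu Om k.+1%:R phi <=
    (K ^+ k.+1)%:E * moment mu Om k.+1%:R (partial [:: ord0] phi))%E.
Proof.
move=> tphi; have tdphi := test_fun_partial [:: ord0] tphi.
have out z : test_fun Om z -> forall x, ~ Om x -> z x = 0.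
  by move=> [_ [C [_ CO z0]]] x Ox; apply: z0 => /CO.
have sphi := test_fun_smooth tphi; have sdphi := test_fun_smooth tdphi.
have cphi := smooth_continuous sphi; have cdphi := smooth_continuous sdphi.
rewrite (moment_support k cphi (out _ tphi)) (moment_support k cdphi (out _ tdphi)).
apply: poincare_compact_support => //; first by move=> x; exact: smooth_derivable.
by move=> x Mx; apply: (out _ tphi) => /OmM.
Qed.

Lemma ereal_poincare_limit (x y : \bar R) (A B : R) : 0 <= A -> 0 <= B ->
  (forall e : R, 0 < e -> (x <= A%:E * y + B%:E * e%:E)%E) -> (x <= A%:E * y)%E.
Proof.
move=> A0 B0 h; apply/lee_addgt0Pr => e e0.
have B1 : 0 < B + 1 by lra.
apply: le_trans (h (e / (B + 1)) (divr_gt0 e0 B1)) _; apply: leeD => //.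
by rewrite -EFinM lee_fin mulrCA ler_piMr ?ltW// ltr_pdivrMr//; lra.
Qed.

Lemma ereal_poincare_chain (x m1 m2 y E : \bar R) (A B e : R) : 0 <= A -> 0 <= B ->
  (0 <= E)%E -> (0 <= y)%E -> (y < +oo)%E -> (E <= e%:E)%E ->
  (x <= A%:E * E + A%:E * m1)%E -> (m1 <= B%:E * m2)%E ->
  (m2 <= A%:E * E + A%:E * y)%E ->
  (x <= (A * B * A)%:E * y + (A * B * A + A)%:E * e%:E)%E.
Proof.
move=> A0 B0 E0 y0 yoo Ee h1 h2 h3.
have Efin : E \is a fin_num by rewrite ge0_fin_numE// (le_lt_trans Ee)// ltry.
have yfin : y \is a fin_num by rewrite ge0_fin_numE.
move: E0 y0 Ee h1 h2 h3; rewrite -(fineK Efin) -(fineK yfin).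
move: (fine E) (fine y) => r s; rewrite !lee_fin => r0 s0 re h1 h2 h3.
apply: (le_trans h1).
have A0' : (0 <= A%:E)%E by []; have B0' : (0 <= B%:E)%E by [].
apply: (le_trans (leeD (lexx _) (lee_wpmul2l A0' (le_trans h2 (lee_wpmul2l B0' h3))))).
rewrite -!(EFinM, EFinD) lee_fin.
have : 0 <= A * (e - r) by rewrite mulr_ge0// subr_ge0.
have : 0 <= A * B * A * (e - r) by rewrite mulr_ge0// ?subr_ge0// mulr_ge0// mulr_ge0.
lra.
Qed.

(** By density of the test functions. The constant is the (k+1)-th power of a number that
    does not depend on k, at the cost of a factor 2^(k+1) for each use of the triangle
    inequality. *)
Lemma poincare_W20 (k : nat) u a : W20 Om k.+1%:R%:E u -> (size a <= 1)%N ->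
  (moment mu Om k.+1%:R (D a u) <=
   ((4 * K) ^+ k.+1)%:E * moment mu Om k.+1%:R (D (ord0 :: a) u))%E.
Proof.
have p1 : (1 : R) <= k.+1%:R by rewrite ler1n.
have p0 : (0 : R) <= k.+1%:R by lra.
move=> /(W20P oO Omfin _ p1)[su happ] a1.
have a2 : (size a <= 2)%N by exact: leq_trans a1 _.
have a2' : (size (ord0 :: a) <= 2)%N by [].
have [hu _] := su.
set p := k.+1%:R in p1 p0 su happ *.
have K0 : 0 <= K by rewrite mulr_ge0// addr_ge0// ltW.
have pE (x : R) : 0 <= x -> x `^ p = x ^+ k.+1 by move=> x0; rewrite /p powR_mulrn.
pose A : R := 2 `^ p; have A0 : 0 <= A by exact: powR_ge0.
have shift (c : R) v w b : `|c| = 1 -> has_wderiv Om v -> has_wderiv Om w ->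
    (size b <= 2)%N ->
    (moment mu Om p (D b (fun x => c * v x + w x)%R) <=
       A%:E * energy Om p v + A%:E * moment mu Om p (D b w))%E.
  move=> c1 hv hw b2.
  have mw := measurable_wderiv oO hw b2; have mv := measurable_wderiv oO hv b2.
  rewrite (moment_wderiv oO p (has_wderiv_lin oO c hv hw) b2 (measurable_lin c mv mw)
    (wderiv_lin oO c hv hw b2)).
  have H := @moment_linE _ _ _ mu Om mOm p c _ _ p0 mv mw.
  apply: (le_trans H); rewrite c1 mulr1; apply: leeD => //.
  by apply: lee_wpmul2l; [rewrite lee_fin|exact: moment_le_energy].
have -> : (4 * K) ^+ k.+1 = A * K ^+ k.+1 * A.
  have -> : (4 : R) = 2 * 2 by lra.
  by rewrite !exprMn /A pE// mulrAC.
apply: (@ereal_poincare_limit _ _ _ (A * K ^+ k.+1 * A + A)).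
- by rewrite mulr_ge0// mulr_ge0// exprn_ge0.
- by rewrite addr_ge0// mulr_ge0// mulr_ge0// exprn_ge0.
move=> e e0; have [phi tphi uphi] := happ e e0.
have sphi := test_fun_smooth tphi.
have [hphi _] := sob_test oO Omfin p0 tphi.
have hd := has_wderiv_sub oO hu hphi.
have s1 := shift 1 _ _ a (normr1 _) hd hphi a2.
have s2 := shift (-1) _ _ (ord0 :: a) (normrN1 _) hd hu a2'.
have e1 : (fun x => 1 * (u x - phi x) + phi x) = u.
  by apply/funext => x; rewrite mul1r subrK.
have e2 : (fun x => -1 * (u x - phi x) + u x) = phi.
  by apply/funext => x; rewrite mulN1r opprB subrK.
rewrite e1 in s1; rewrite e2 in s2.
have tp := poincare_test k (test_fun_partial a tphi).
rewrite -/p in tp.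
rewrite (moment_smooth oO p a2 sphi) in s1.
rewrite (moment_smooth oO p a2' sphi) in s2.
apply: (ereal_poincare_chain A0 (exprn_ge0 _ K0) (energy_ge0 _ _ _) (moment_ge0 _ _ _ _) _ uphi s1 tp s2).
by case: su => _; exact.
Qed.

End poincare.

(** * Weak compactness in W^{2,2} *)
Section energy_space.
Variables (R : realType) (n : nat).
Notation V := 'rV[R]_n.
Notation L := (lebesgue_rV_type R n).
Notation mu := (@lebesgue_rV R n).
Implicit Types (u v w z phi : V -> R) (a : seq 'I_n).
Variables (Om : set V) (oO : open Om) (Omfin : (mu Om < +oo)%E).
Let mOm := open_lebesgue oO.
Notation D := (wderiv Om).

Definition sob_ip u v : R :=
  \sum_(a : 2.-bseq 'I_n) \int[mu]_(x in Om) (D a u x * D a v x).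

Lemma sob_ipC u v : sob_ip u v = sob_ip v u.
Proof.
by apply: eq_bigr => a _; apply: eq_Rintegral => x _; rewrite mulrC.
Qed.

Lemma sob_ipE u : sob Om 2 u -> (sob_ip u u)%:E = energy Om 2 u.
Proof.
move=> [hu u2]; rewrite energyE /sob_ip -sumEFin; apply: eq_bigr => a _.
have a2 := size_bseq a.
rewrite (@Rintegral_sqr _ _ _ mu (Om : set L) (D a u)) fineK//.
by rewrite ge0_fin_numE ?moment_ge0// u2.
Qed.

Lemma sob_ip_ge0 u : 0 <= sob_ip u u.
Proof.
apply: sumr_ge0 => a _; apply: Rintegral_ge0 => x _; by rewrite -expr2 sqr_ge0.
Qed.

Lemma sob_ip_lin (c : R) u v w : sob Om 2 u -> sob Om 2 v -> sob Om 2 w ->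
  sob_ip (fun x => c * u x + v x) w = c * sob_ip u w + sob_ip v w.
Proof.
move=> [hu u2] [hv v2] [hw w2]; rewrite /sob_ip mulr_sumr -big_split/=.
apply: eq_bigr => a _; have a2 := size_bseq a.
have mu' := measurable_wderiv oO hu a2; have mv := measurable_wderiv oO hv a2.
have mw := measurable_wderiv oO hw a2.
have H := @Rintegral_mul_lin _ _ _ mu (Om : set L) mOm c _ _ _ mu' mv mw (u2 _ a2) (v2 _ a2) (w2 _ a2).
rewrite -H.
have hcuv := has_wderiv_lin oO c hu hv.
have m1 := measurable_funM (measurable_wderiv oO hcuv a2) mw.
have m2 := measurable_funM (measurable_lin c mu' mv) mw.
apply: (@Rintegral_ae _ _ _ mu (Om : set L) mOm _ _ m1 m2).
by apply: (ae_imp (wderiv_lin oO c hu hv a2)) => x h Ox; congr (_ * _); exact: h.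
Qed.

(** The defining identity passes to the limit, being continuous for the L^2 norm. *)
Lemma weak_deriv_cvg a (f_ h_ : nat -> V -> R) f h :
  (forall m, weak_deriv Om a (f_ m) (h_ m)) ->
  (forall m, moment mu Om 2 (f_ m) < +oo)%E -> (forall m, moment mu Om 2 (h_ m) < +oo)%E ->
  measurable_fun (Om : set L) (f : L -> R) -> measurable_fun (Om : set L) (h : L -> R) ->
  (moment mu Om 2 f < +oo)%E -> (moment mu Om 2 h < +oo)%E ->
  (forall e : R, 0 < e -> exists N, forall k, (N <= k)%N ->
     (moment mu Om 2 (fun x => f_ k x - f x)%R <= e%:E)%E) ->
  (forall e : R, 0 < e -> exists N, forall k, (N <= k)%N ->
     (moment mu Om 2 (fun x => h_ k x - h x)%R <= e%:E)%E) ->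
  weak_deriv Om a f h.
Proof.
move=> wfh f_2 h_2 mf mh f2 h2 ff hh.
have two : (1 : R) <= 2 by lra.
have loc (g : V -> R) : measurable_fun (Om : set L) (g : L -> R) ->
    (moment mu Om 2 g < +oo)%E -> L1loc Om g.
  move=> mg g2 K cK KO.
  have ig := @integrable_moment1 _ _ _ mu (Om : set L) mOm Omfin 2 g two mg g2.
  exact: (integrableS mOm (compact_lebesgue cK) KO ig).
have mf_ m : measurable_fun (Om : set L) (f_ m : L -> R).
  by case: (wfh m) => + _ _; exact: L1loc_measurable.
have mh_ m : measurable_fun (Om : set L) (h_ m : L -> R).
  by case: (wfh m) => _ + _; exact: L1loc_measurable.
split; [exact: loc|exact: loc|move=> phi tphi].
have tdphi := test_fun_partial a tphi.
have mphi z : test_fun Om z -> measurable_fun (Om : set L) (z : L -> R).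
  move=> tz; apply: measurable_funTS; apply: continuous_lebesgue.
  exact: (smooth_continuous (test_fun_smooth tz)).
have two0 : (0 : R) <= 2 by lra.
have phi2 z (tz : test_fun Om z) := test_fun_moment oO Omfin two0 tz.
have c1 := @cvg_Rintegral_mul _ _ _ mu (Om : set L) mOm f_ f _ mf_ mf (mphi _ tdphi) f_2 f2 (phi2 _ tdphi) ff.
have c2 := @cvg_Rintegral_mul _ _ _ mu (Om : set L) mOm h_ h _ mh_ mh (mphi _ tphi) h_2 h2 (phi2 _ tphi) hh.
have E : (fun m => \int[mu]_(x in Om) (f_ m x * partial a phi x)) =
    (fun m => (-1) ^+ size a * \int[mu]_(x in Om) (h_ m x * phi x)).
  by apply/funext => m; have [_ _ E] := wfh m; exact: E.
rewrite E in c1.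
exact: (cvg_unique (@norm_hausdorff _ _) c1 (cvgM (cvg_cst ((-1 : R) ^+ size a)) c2)).
Qed.

(** The derivatives converge in L^2, and their limits are the derivatives of the limit. *)
Lemma sob_complete (y_ : nat -> V -> R) : (forall m, sob Om 2 (y_ m)) ->
  (forall e : R, 0 < e -> exists N, forall i j, (N <= i)%N -> (N <= j)%N ->
    (energy Om 2 (fun x => y_ i x - y_ j x)%R <= e%:E)%E) ->
  exists2 y, sob Om 2 y & forall e : R, 0 < e -> exists N, forall i, (N <= i)%N ->
    (energy Om 2 (fun x => y_ i x - y x)%R <= e%:E)%E.
Proof.
move=> sy cy; have two0 : (0 : R) <= 2 by lra.
have hy m : has_wderiv Om (y_ m) by case: (sy m).
have lim a : (size a <= 2)%N -> exists2 g : V -> R, measurable_fun (Om : set L) (g : L -> R) &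
    forall e : R, 0 < e -> exists N, forall i, (N <= i)%N ->
      (moment mu Om 2 (fun x => D a (y_ i) x - g x)%R <= e%:E)%E.
  move=> a2.
  apply: (@moment2_complete _ _ _ mu (Om : set L) mOm Omfin (fun m => D a (y_ m))).
    by move=> m; exact: measurable_wderiv.
  move=> e e0; have [N NP] := cy e e0; exists N => i j Ni Nj.
  rewrite -(moment_wderiv_sub oO 2 (hy i) (hy j) a2); apply: le_trans (NP i j Ni Nj).
  exact: moment_le_energy.
have /choice[g gP] : forall a : 2.-bseq 'I_n, exists g : V -> R,
    measurable_fun (Om : set L) (g : L -> R) /\
    forall e : R, 0 < e -> exists N, forall i, (N <= i)%N ->
      (moment mu Om 2 (fun x => D a (y_ i) x - g x)%R <= e%:E)%E.
  by move=> a; have [g g1 g2] := lim a (size_bseq a); exists g.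
have mg (a : 2.-bseq 'I_n) : measurable_fun (Om : set L) (g a : L -> R) by case: (gP a).
have g2 (a : 2.-bseq 'I_n) : (moment mu Om 2 (g a) < +oo)%E.
  have [_ /(_ 1 ltr01)[N /(_ N (leqnn _)) NP]] := gP a; have a2 := size_bseq a.
  have mD := measurable_wderiv oO (hy N) a2.
  have -> : g a = (fun x => -1 * (D a (y_ N) x - g a x) + D a (y_ N) x).
    by apply/funext => x; lra.
  have H := @moment_linE _ _ _ mu (Om : set L) mOm 2 (-1) _ _ two0 (measurable_funB mD (mg a)) mD.
  apply: le_lt_trans H _; apply: lte_scaleD; rewrite ?powR_ge0//.
    exact: le_lt_trans NP (ltry _).
  by case: (sy N) => _; exact.
pose y := g (Bseq (isT : size ([::] : seq 'I_n) <= 2)%N).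
have wy a (a2 : (size a <= 2)%N) : weak_deriv Om a y (g (Bseq a2)).
  have [_ G0] := gP (Bseq (isT : size ([::] : seq 'I_n) <= 2)%N); rewrite -/y in G0.
  have [_ Ga] := gP (Bseq a2).
  have D0 m : {ae mu, forall x, Om x -> D [::] (y_ m) x = y_ m x}.
    by apply: wderiv_nil => //; exact: has_wderiv_L1loc.
  have my m : measurable_fun (Om : set L) (y_ m : L -> R).
    by apply: L1loc_measurable => //; exact: has_wderiv_L1loc.
  apply: (@weak_deriv_cvg a y_ (fun m => D a (y_ m))).
  - by move=> m; exact: hy.
  - move=> m; rewrite -(@moment_wderiv _ _ _ oO 2 _ [::] _ (hy m) isT (my m) (D0 m)).
    by case: (sy m) => _; exact.
  - by move=> m; case: (sy m) => _; exact.
  - exact: mg.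
  - exact: mg.
  - exact: g2.
  - exact: g2.
  - move=> e e0; have [N NP] := G0 e e0; exists N => k Nk.
    have mD := @measurable_wderiv _ _ _ oO [::] _ (hy k) isT.
    have E := @moment_ae _ _ _ mu (Om : set L) mOm 2 (fun x => D [::] (y_ k) x - y x)
      (fun x => y_ k x - y x) (measurable_funB mD (mg _)) (measurable_funB (my k) (mg _)).
    rewrite -E; first exact: NP.
    by apply: (ae_imp (D0 k)) => x h Ox; rewrite h.
  - exact: Ga.
have hy' : has_wderiv Om y by move=> a a2; exact: wderivP (wy a a2).
have gE a (a2 : (size a <= 2)%N) : {ae mu, forall x, Om x -> D a y x = g (Bseq a2) x}.
  exact: wderiv_ae (wy a a2).
exists y.
  split; first exact: hy'.
  move=> a a2; rewrite (moment_wderiv oO 2 hy' a2 (mg _) (gE a a2)); exact: g2.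
pose N : R := #|{: 2.-bseq 'I_n}|%:R + 1; have N0 : 0 < N by rewrite ltr_wpDl.
move=> e e0; have eN : 0 < e / N by rewrite divr_gt0.
have /choice[k kP] : forall a : 2.-bseq 'I_n, exists k, forall i, (k <= i)%N ->
      (moment mu Om 2 (fun x => D a (y_ i) x - g a x)%R <= (e / N)%:E)%E.
  by move=> a; have [_ /(_ _ eN)] := gP a.
exists (\max_a k a)%N => i ki.
have B a : (size a <= 2)%N -> (moment mu Om 2 (D a (fun x => y_ i x - y x)%R) <= (e / N)%:E)%E.
  move=> a2; rewrite (moment_wderiv_sub oO 2 (hy i) hy' a2).
  have mD := measurable_wderiv oO (hy i) a2.
  have E := @moment_ae _ _ _ mu (Om : set L) mOm 2 (fun x => D a (y_ i) x - D a y x)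
      (fun x => D a (y_ i) x - g (Bseq a2) x) (measurable_funB mD (measurable_wderiv oO hy' a2))
      (measurable_funB mD (mg _)).
  have K0 := kP (Bseq a2) i (leq_trans (leq_bigmax (Bseq a2)) ki).
  have AE : {ae mu, forall x, Om x -> D a (y_ i) x - D a y x = D a (y_ i) x - g (Bseq a2) x}.
    by apply: (ae_imp (gE a a2)) => x h Ox; congr (_ - _); exact: h.
  rewrite (E AE); exact: K0.
apply: le_trans (energy_bseq_le B) _.
rewrite lee_fin mulrCA -[leRHS]mulr1 ler_pM2l// ler_pdivrMr// mul1r /N lerDl//.
Qed.

(** The consequence of weak compactness that is used: whichever infinite set Q of indices
    is of interest, the same limit y is approached strongly by convex combinations of the
    terms with indices in Q. *)
Theorem sob_weak_compactness (x : nat -> V -> R) (C : R) :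
  (forall k, sob Om 2 (x k)) -> (forall k, (energy Om 2 (x k) <= C%:E)%E) ->
  exists2 j : nat -> nat, {homo j : m n / (m < n)%N} &
  exists2 y, sob Om 2 y & forall Q : set nat, (forall m, exists2 k, (m <= k)%N & Q k) ->
    forall e : R, 0 < e -> exists2 z : V -> R, hull [set x (j k) | k in Q] z &
      sob Om 2 z /\ (energy Om 2 (fun t => z t - y t)%R <= e%:E)%E.
Proof.
move=> sx xC; have two0 : (0 : R) <= 2 by lra.
have S0 : sob Om 2 (0 : V -> R) by exact: (sob_test oO Omfin two0 (test_fun0 _)).
have Slin c (u v : V -> R) : sob Om 2 u -> sob Om 2 v -> sob Om 2 (c *: u + v).
  by move=> su sv; exact: (sob_lin oO c two0 su sv).
have iplin c (u v w : V -> R) : sob Om 2 u -> sob Om 2 v -> sob Om 2 w ->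
    sob_ip (c *: u + v) w = c * sob_ip u w + sob_ip v w.
  by move=> su sv sw; exact: sob_ip_lin.
have Ssub (u v : V -> R) : sob Om 2 u -> sob Om 2 v -> sob Om 2 (u - v).
  by move=> su sv; have := Slin (-1) _ _ sv su; rewrite scaleN1r addrC.
have ipx k : sob_ip (x k) (x k) <= C by rewrite -lee_fin sob_ipE.
have comp : forall y_ : nat -> V -> R, (forall m, sob Om 2 (y_ m)) ->
  (forall e : R, 0 < e -> exists N, forall i j, (N <= i)%N -> (N <= j)%N ->
    sob_ip (y_ i - y_ j) (y_ i - y_ j) <= e) ->
  exists2 y, sob Om 2 y & forall e : R, 0 < e -> exists N, forall i, (N <= i)%N ->
    sob_ip (y_ i - y) (y_ i - y) <= e.
  move=> y_ sy cy; have [|y sy' yl] := sob_complete sy.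
    move=> e e0; have [N NP] := cy e e0; exists N => i j Ni Nj.
    by have := NP i j Ni Nj; rewrite -lee_fin sob_ipE//; exact: Ssub.
  exists y => // e e0; have [N NP] := yl e e0; exists N => i Ni.
  by rewrite -lee_fin sob_ipE; [exact: NP|exact: Ssub].
have [j jh [y sy yP]] := weak_compactness S0 Slin sob_ipC iplin sob_ip_ge0 comp sx ipx.
exists j => //; exists y => // Q Qi e e0.
have [z hz ze] := yP Q Qi e e0; exists z => //.
have sz : sob Om 2 z by apply: (S_hull S0 Slin _ hz) => _ [k _ <-]; exact: sx.
by split => //; rewrite -(sob_ipE (Ssub _ _ sz sy)) lee_fin ltW.
Qed.

End energy_space.

(** * Functions of symmetric matrices *)
Section matrices.
Variables (R : realType) (n : nat).
Notation M := 'M[R]_n.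

Lemma cvg_mx_entries (T : Type) (F : set_system T) (FF : Filter F) (f : T -> M) (X : M) :
  (forall i j, f t i j @[t --> F] --> X i j) -> f t @[t --> F] --> X.
Proof.
move=> h; apply/cvg_ballP => e e0.
have H : \forall t \near F, forall i j, `|X i j - f t i j| < e.
  apply: filter_forall => i; apply: filter_forall => j.
  by have /cvgrPdist_lt := h i j; exact.
by apply: filterS H => t ht; split => // i j; exact: ht.
Qed.

(** The projection onto the symmetric matrices extends a function on these, continuously
    and preserving level convexity, to all matrices. *)
Definition symm (X : M) : M := 2^-1 *: (X + X^T).

Lemma symm_symmx X : symmx (symm X).
Proof. by rewrite /symmx /symm/= linearZ/= linearD/= trmxK addrC. Qed.

Lemma symm_id X : symmx X -> symm X = X.
Proof.
move=> sX; have e : X^T = X by exact: sX.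
apply/matrixP => i j; rewrite /symm e !mxE; lra.
Qed.

Lemma symm_comb (c d : R) X Y : symm (c *: X + d *: Y) = c *: symm X + d *: symm Y.
Proof. by apply/matrixP => i j; rewrite !mxE; lra. Qed.

Lemma symm_continuous : continuous symm.
Proof.
move=> X; apply: (@cvg_mx_entries _ (nbhs X) (nbhs_filter X)) => i j.
have E Y : symm Y i j = 2^-1 * (Y i j + Y j i) by rewrite !mxE.
under eq_fun do rewrite E; rewrite E.
apply: cvgM; first exact: cvg_cst.
by apply: cvgD; exact: coord_continuous.
Qed.

Lemma continuous_symm (H : M -> R) : {within @symmx R n, continuous H} ->
  continuous (H \o symm).
Proof.
move=> /subspace_continuousP cH X.
apply: (cvg_comp _ _ _ (cH (symm X) (symm_symmx X))) => A wA.
have := @symm_continuous X _ wA; apply: (@filterS _ _ (nbhs_filter X)) => Y; apply.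
exact: symm_symmx.
Qed.

Lemma continuous_bounded_entries (G : M -> R) (c : R) : continuous G ->
  exists2 C : R, 0 <= C & forall X : M, (forall i j, `|X i j| <= c) -> `|G X| <= C.
Proof.
move=> cG; pose K := [set v : 'rV[R]_(n * n) | forall k, `[- c, c]%classic (v ord0 k)].
have cK : compact K by exact: (@rV_compact R (n * n) (fun=> `[- c, c]%classic) (fun=> segment_compact (a := - c) (b := c))).
have cGv : continuous (G \o (@vec_mx R n n)).
  move=> v; apply: continuous_comp; last exact: cG.
  apply: (@cvg_mx_entries _ (nbhs v) (nbhs_filter v)) => i j; under eq_fun do rewrite mxE; rewrite mxE.
  exact: coord_continuous.
have /compact_bounded[B [Br h]] : compact ((G \o (@vec_mx R n n)) @` K).
  by apply: continuous_compact => //; exact: continuous_subspaceT.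
exists (`|B| + 1) => [|X hX]; first by rewrite addr_ge0.
apply: (h (`|B| + 1)); first by rewrite ltr_pwDr// ler_norm.
exists (mxvec X); last by rewrite /= mxvecK.
move=> k; case/mxvec_indexP: k => i j; rewrite mxvecE /= in_itv/= -ler_norml.
exact: hX.
Qed.

Lemma measurable_continuous_mx d (T : measurableType d) (D : set T) (F : T -> M)
    (G : M -> R) : measurable D -> continuous G ->
  (forall i j, measurable_fun D (fun x => F x i j)) ->
  measurable_fun D (fun x => G (F x)).
Proof.
move=> mD /continuousP cG mF _; apply: (measurability _ (RGenOInfty.measurableE R)) => //.
move=> _ [_ [x ->] <-].
exact: (@measurable_preimage_open R n n _ _ D F _ mD mF (cG _ (interval_open _ _))).
Qed.

Lemma euclid_norm_ge (X : M) i j : `|X i j| <= euclid_norm X.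
Proof.
rewrite -[leLHS]sqrtr_sqr /euclid_norm ler_sqrt; last first.
  by apply: sumr_ge0 => k _; apply: sumr_ge0 => l _; exact: sqr_ge0.
rewrite (bigD1 i)//= (bigD1 j)//= -addrA lerDl addr_ge0//.
  by apply: sumr_ge0 => l _; exact: sqr_ge0.
by apply: sumr_ge0 => k _; apply: sumr_ge0 => l _; exact: sqr_ge0.
Qed.

End matrices.

(** * Approximate minimisers *)
Section ereal_powers.
Variable R : realType.
Implicit Types (x : \bar R) (c : R) (p : nat).

Lemma expe_le x c p : (0 <= x)%E -> (x <= c%:E)%E -> (x ^+ p <= (c ^+ p)%:E)%E.
Proof.
case: x => [r| |]//; rewrite !lee_fin => r0 rc.
by rewrite -EFin_expe lee_fin lerXn2r// nnegrE (le_trans r0).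
Qed.

Lemma le_expe x c p : (0 < p)%N -> 0 <= c -> (0 <= x)%E ->
  (x ^+ p <= (c ^+ p)%:E)%E -> (x <= c%:E)%E.
Proof.
move=> p0 c0; case: x => [r| |]//.
  rewrite -EFin_expe !lee_fin => r0 h.
  by rewrite -(ler_pXn2r p0)// nnegrE.
by move=> _; case: p p0 => // p _; rewrite expeS gt0_mulye ?leNgt ?ltry// expe_gt0.
Qed.

Lemma le_poweR_inv x c p : (0 < p)%N -> 0 <= c -> (0 <= x)%E ->
  ((x `^ (p%:R^-1) <= c%:E)%E <-> (x <= (c ^+ p)%:E)%E).
Proof.
move=> p0 c0 x0; have p0' : (0 : R) < p%:R by rewrite ltr0n.
have pi0 : (0 : R) <= p%:R^-1 by rewrite invr_ge0 ltW.
have cp0 : 0 <= c ^+ p by rewrite exprn_ge0.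
split=> h.
  have e1 : x = ((x `^ (p%:R^-1)) `^ p%:R)%E.
    by rewrite -poweRrM mulVf ?gt_eqF// poweRe1.
  rewrite e1 -powR_mulrn// -poweR_EFin; apply: gt0_ler_poweR => //.
  - by rewrite in_itv/= leey poweR_ge0.
  - by rewrite in_itv/= leey lee_fin c0.
have e1 : c%:E = ((c ^+ p)%:E `^ (p%:R^-1))%E.
  by rewrite poweR_EFin -powR_mulrn// -powRrM mulfV ?gt_eqF// powRr1.
rewrite e1; apply: gt0_ler_poweR => //.
- by rewrite in_itv/= leey x0.
- by rewrite in_itv/= leey lee_fin cp0.
Qed.

Lemma le_inv_mul (m c : R) (x : \bar R) : 0 < m ->
  ((m^-1%:E * x <= c%:E)%E <-> (x <= c%:E * m%:E)%E).
Proof. by move=> m0; rewrite muleC; rewrite (lee_pdivrMr _ _ m0). Qed.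

End ereal_powers.

Section W2oo0.
Variables (R : realType) (n : nat).
Notation V := 'rV[R]_n.
Notation L := (lebesgue_rV_type R n).
Notation mu := (@lebesgue_rV R n).
Variables (Om : set V) (oO : open Om) (Omfin : (mu Om < +oo)%E).
Let mOm := open_lebesgue oO.
Implicit Types (u v : V -> R) (c : R).

Lemma W2oo_lin c u v : W2 Om +oo%E u -> W2 Om +oo%E v ->
  W2 Om +oo%E (fun x => c * u x + v x).
Proof.
move=> /(W2ooP oO _ Omfin)[hu bu] /(W2ooP oO _ Omfin)[hv bv].
apply/(W2ooP oO _ Omfin); split; first exact: has_wderiv_lin.
move=> a a2; have [cu cu0 hcu] := bu a a2; have [cv cv0 hcv] := bv a a2.
exists (`|c| * cu + cv); first by rewrite addr_ge0// mulr_ge0.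
apply: (ae_imp2 (wderiv_lin oO c hu hv a2)); first exact: (ae_imp2 hcu hcv (fun x h h' => conj h h')).
move=> x h [h1 h2] Ox; rewrite h//; apply: le_trans (ler_normD _ _) _.
by rewrite normrM lerD ?ler_wpM2l// ?h1 ?h2.
Qed.

Lemma W2oo_test phi : test_fun Om phi -> W2 Om +oo%E phi.
Proof.
move=> tphi; have sphi := test_fun_smooth tphi.
apply/(W2ooP oO _ Omfin); split; first exact: has_wderiv_smooth.
move=> a a2; have [c c0 hc] := test_fun_bounded (test_fun_partial a tphi).
by exists c => //; apply: (ae_imp (wderiv_smooth oO a sphi)) => x h Ox; rewrite h.
Qed.

Lemma W2oo0_test phi : test_fun Om phi -> W2oo0 Om phi.
Proof.
move=> tphi; split; first exact: W2oo_test.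
move=> p /= p1; apply/(W20P oO Omfin _ (ltW p1)).
have p0 : 0 <= p by lra.
split; first exact: sob_test.
move=> e e0; exists phi => //.
have -> : (fun x => phi x - phi x) = cst 0 by apply/funext => x; rewrite subrr.
apply: (le_trans _ (_ : (0 <= e%:E)%E)); last by rewrite lee_fin ltW.
have H : (energy Om p (cst 0%R : V -> R) <= (#|{: 2.-bseq 'I_n}|%:R * 0)%R%:E)%E.
  apply: energy_bseq_le => a a2.
  have s0 := test_fun_smooth (test_fun0 Om).
  have sphi := test_fun_smooth tphi.
  rewrite (moment_smooth oO p a2 s0).
  have -> : partial a (cst 0 : V -> R) = (fun x => 0 * partial a phi x).
    have -> : (cst 0 : V -> R) = (fun x => -1 * phi x + phi x).
      by apply/funext => x; rewrite mulN1r addNr.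
    rewrite (@partialD _ _ phi phi (-1) a sphi sphi).
    by apply/funext => x; rewrite mulN1r addNr mul0r.
  rewrite (@moment_scale _ _ _ mu (Om : set L) mOm p 0 (partial a phi)).
    have pn0 : p != 0 by rewrite gt_eqF//; lra.
    by rewrite normr0 powR0// mul0e.
  apply: measurable_funTS; apply: continuous_lebesgue; apply: smooth_continuous.
  exact: smooth_partial.
by rewrite mulr0 in H.
Qed.

Lemma W2oo0_lin c u v : W2oo0 Om u -> W2oo0 Om v -> W2oo0 Om (fun x => c * u x + v x).
Proof.
move=> [u1 u2] [v1 v2]; split; first exact: W2oo_lin.
by move=> p /= p1; apply: W20_lin => //; [exact: ltW|exact: u2|exact: v2].
Qed.

Lemma W2oo0_sob p u : 0 <= p -> W2oo0 Om u -> sob Om p u.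
Proof. by move=> p0 [u1 _]; exact: W2oo_sob. Qed.

Lemma W2oo0_wderiv u : W2oo0 Om u -> has_wderiv Om u.
Proof. by move=> /(W2oo0_sob ler01)[]. Qed.

End W2oo0.

Section density.
Variables (R : realType) (n : nat).
Notation V := 'rV[R]_n.
Notation L := (lebesgue_rV_type R n).
Notation mu := (@lebesgue_rV R n).
Variables (Om : set V) (oO : open Om) (Omfin : (mu Om < +oo)%E).
Let mOm := open_lebesgue oO.
Notation D := (wderiv Om).
Variables (G : 'M[R]_n -> R) (cG : continuous G) (G0 : forall X, 0 <= G X).
Implicit Types (u v : V -> R) (c : R) (p : nat) (O : set V).

Definition dens u (x : V) : R := G (D2 Om u x).

Lemma dens_ge0 u x : 0 <= dens u x. Proof. exact: G0. Qed.

Lemma measurable_dens u : has_wderiv Om u -> measurable_fun (Om : set L) (dens u : L -> R).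
Proof.
move=> hu; apply: (@measurable_continuous_mx R n _ L (Om : set L) (D2 Om u) G mOm cG).
move=> i j; have := @measurable_wderiv _ _ _ oO [:: i; j] u hu isT.
by congr (measurable_fun _ _); apply/funext => x; rewrite mxE.
Qed.

Lemma D2_bounded u : W2 Om +oo%E u ->
  exists2 c, 0 <= c & {ae mu, forall x, Om x -> forall i j, `|D2 Om u x i j| <= c}.
Proof.
move=> /(W2ooP oO _ Omfin)[hu bu].
have /choice[c cP] : forall a : 2.-bseq 'I_n, exists c : R, 0 <= c /\
    {ae mu, forall x, Om x -> `|D a u x| <= c}.
  by move=> a; have [c c0 hc] := bu a (size_bseq a); exists c.
exists (\sum_a c a); first by apply: sumr_ge0 => a _; case: (cP a).
have H : {ae mu, forall x, forall a : 2.-bseq 'I_n, Om x -> `|D a u x| <= c a}.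
  apply: (@filter_forall _ _ _ _ (ae_filter_ringOfSetsType mu)) => a.
  by case: (cP a).
apply: (ae_imp H) => x h Ox i j; rewrite mxE.
apply: le_trans (h (Bseq (isT : size [:: i; j] <= 2)%N) Ox) _.
rewrite (bigD1 (Bseq (isT : size [:: i; j] <= 2)%N))//= lerDl.
by apply: sumr_ge0 => a _; case: (cP a).
Qed.

Lemma dens_bounded u : W2 Om +oo%E u ->
  exists2 c, 0 <= c & {ae mu, forall x, Om x -> dens u x <= c}.
Proof.
move=> /D2_bounded[c c0 hc]; have [C C0 hC] := @continuous_bounded_entries R n G c cG.
exists C => //; apply: (ae_imp hc) => x h Ox.
by apply: le_trans (ler_norm _) _; apply: hC; exact: h.
Qed.

(** Bounds on the average are handled as bounds on moments of the density; this covers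
    negligible sets O, on which all moments vanish. *)
Lemma EpP p u O c : (0 < p)%N -> 0 <= c -> measurable (O : set L) -> O `<=` Om ->
  has_wderiv Om u ->
  ((Ep G Om p u O <= c%:E)%E <->
   (moment mu O p%:R (dens u) <= (c ^+ p)%:E * mu O)%E).
Proof.
move=> p0 c0 mO OO hu.
have md : measurable_fun (O : set L) (dens u : L -> R).
  by apply: measurable_funS (measurable_dens hu) => //.
have Ofin : (mu O < +oo)%E.
  by apply: le_lt_trans Omfin; apply: le_measure; rewrite ?inE.
have E : (\int[mu]_(x in O) ((G (D2 Om u x)) ^+ p)%:E = moment mu O p%:R (dens u))%E.
  rewrite momentE; apply: eq_integral => x _.
  by rewrite powR_mulrn// ger0_norm// dens_ge0.
rewrite /Ep E; case: ifPn => [/eqP m0|m0].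
  have -> : moment mu O p%:R (dens u) = 0%E.
    exact: moment_null.
  by rewrite m0 mule0 lexx lee_fin c0.
have m1 : 0 < fine (mu O).
  by rewrite fine_gt0// Ofin andbT lt0e m0 measure_ge0.
rewrite le_poweR_inv//; last first.
  by rewrite mule_ge0 ?moment_ge0// lee_fin invr_ge0 ltW.
rewrite le_inv_mul// fineK// ge0_fin_numE//.
Qed.

Lemma Ep_ge0 p u O : (0 <= Ep G Om p u O)%E.
Proof. by rewrite /Ep; case: ifPn => // _; exact: poweR_ge0. Qed.

Lemma Ep_le_bound p u c : (0 < p)%N -> 0 <= c -> has_wderiv Om u ->
  {ae mu, forall x, Om x -> dens u x <= c} -> (Ep G Om p u Om <= c%:E)%E.
Proof.
move=> p0 c0 hu h; apply/EpP => //.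
rewrite -powR_mulrn//; apply: (moment_bounded mOm) => //; first exact: measurable_dens.
by apply: (ae_imp h) => x hx Ox; rewrite ger0_norm ?dens_ge0// hx.
Qed.

Variables (g : V -> R) (gW : W2 Om +oo%E g).

Lemma W2oo_bd_W2oo u : W2oo_bd Om g u -> W2 Om +oo%E u.
Proof.
move=> [v [v1 _] <-].
have -> : (g \+ v) = (fun x => 1 * g x + v x) by apply/funext => x; rewrite mul1r.
exact: W2oo_lin.
Qed.

Lemma W2oo_bd_wderiv u : W2oo_bd Om g u -> has_wderiv Om u.
Proof. by move=> /W2oo_bd_W2oo/(W2ooP oO _ Omfin)[]. Qed.

Lemma W2oo_bd_g : W2oo_bd Om g g.
Proof.
exists (cst 0); last by apply/funext => x /=; rewrite addr0.
by apply: W2oo0_test => //; exact: test_fun0.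
Qed.

Lemma approximate_minimisers : exists u : nat -> V -> R, forall p, (0 < p)%N ->
  W2oo_bd Om g (u p) /\
  (Ep G Om p (u p) Om ^+ p <= (2 ^- (p ^ 2)%N)%:E +
     ereal_inf [set Ep G Om p v Om ^+ p | v in W2oo_bd Om g])%E.
Proof.
suff /choice[u uP] : forall p, exists u, (0 < p)%N -> W2oo_bd Om g u /\
    (Ep G Om p u Om ^+ p <= (2 ^- (p ^ 2)%N)%:E +
     ereal_inf [set Ep G Om p v Om ^+ p | v in W2oo_bd Om g])%E by exists u.
move=> p; have [->|p0] := posnP p; first by exists g.
set S := [set _ | _ in _].
have S0 : (0 <= ereal_inf S)%E.
  by apply: le_ereal_inf_tmp => _ [v _ <-]; rewrite expe_ge0// Ep_ge0.
have [c c0 hc] := dens_bounded gW.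
have Sc : (ereal_inf S <= (c ^+ p)%:E)%E.
  apply: (@le_trans _ _ (Ep G Om p g Om ^+ p)%E).
    by apply: ereal_inf_lbound; exists g => //; exact: W2oo_bd_g.
  by apply: expe_le; [exact: Ep_ge0|apply: Ep_le_bound => //; exact: W2oo_bd_wderiv W2oo_bd_g].
have Sfin : ereal_inf S \is a fin_num by rewrite ge0_fin_numE// (le_lt_trans Sc)// ltry.
have e0 : 0 < (2 : R) ^- (p ^ 2)%N by rewrite invr_gt0 exprn_gt0.
have [_ [v Wv <-] hv] := lb_ereal_inf_adherent e0 Sfin.
by exists v => _; split => //; rewrite addeC ltW.
Qed.

(** The error 2^(-p^2) is the p-th power of 2^(-p), and a^p + c^p <= (a + c)^p. *)
Lemma approximate_minimiser_le p u psi c : (0 < p)%N -> 0 <= c ->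
  (Ep G Om p u Om ^+ p <= (2 ^- (p ^ 2)%N)%:E +
     ereal_inf [set Ep G Om p v Om ^+ p | v in W2oo_bd Om g])%E ->
  W2oo_bd Om g psi -> {ae mu, forall x, Om x -> dens psi x <= c} ->
  (Ep G Om p u Om <= (2 ^- p + c)%:E)%E.
Proof.
move=> p0 c0 h Wpsi hpsi; have h0 : 0 <= (2 : R) ^- p by rewrite invr_ge0 exprn_ge0.
apply: (le_expe p0); [exact: addr_ge0|exact: Ep_ge0|].
apply: (le_trans h); apply: (@le_trans _ _ ((2 ^- (p ^ 2)%N)%:E + (c ^+ p)%:E)%E).
  apply: leeD => //; apply: (@le_trans _ _ (Ep G Om p psi Om ^+ p)%E).
    by apply: ereal_inf_lbound; exists psi.
  by apply: expe_le; [exact: Ep_ge0|apply: Ep_le_bound => //; exact: W2oo_bd_wderiv].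
rewrite -EFinD lee_fin expnS expn1 exprM -exprVn.
have H (a b : R) : 0 <= a -> 0 <= b -> a ^+ p + b ^+ p <= (a + b) ^+ p.
  move=> a0 b0; case: p p0 {h h0} => // p _; elim: p => [|p IH]; first by rewrite !expr1.
  rewrite exprS (exprS b) (exprS (a + b)).
  have ab : 0 <= a + b by lra.
  apply: le_trans (ler_wpM2l ab IH); rewrite mulrDl !mulrDr.
  have : 0 <= a * b ^+ p.+1 by rewrite mulr_ge0// exprn_ge0.
  have : 0 <= b * a ^+ p.+1 by rewrite mulr_ge0// exprn_ge0.
  lra.
exact: H.
Qed.

End density.

(** * Bounds on the approximate minimisers *)
Section bounds.
Variables (R : realType).

Lemma eventually_bounded (F : nat -> \bar R) (N : nat) (C : R) :
  (forall k, 0 <= F k)%E -> (forall k, F k < +oo)%E ->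
  (forall k, (N <= k)%N -> (F k <= C%:E)%E) ->
  exists2 C' : R, 0 <= C' & forall k, (F k <= C'%:E)%E.
Proof.
move=> F0 Ffin FC; exists (`|C| + \sum_(i < N) fine (F i)).
  by rewrite addr_ge0// sumr_ge0// => i _; exact: fine_ge0.
move=> k; have [kN|Nk] := ltnP k N; last first.
  apply: (le_trans (FC k Nk)); rewrite lee_fin; apply: le_trans (ler_norm C) _.
  by rewrite lerDl sumr_ge0// => i _; exact: fine_ge0.
rewrite -[leLHS]fineK ?ge0_fin_numE// lee_fin (bigD1 (Ordinal kN))//=.
rewrite addrCA lerDl addr_ge0// sumr_ge0// => i _; exact: fine_ge0.
Qed.

Lemma ler_sum2_term (I J : finType) (F : I -> J -> R) i j :
  (forall i j, 0 <= F i j) -> F i j <= \sum_i \sum_j F i j.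
Proof.
move=> F0; rewrite (bigD1 i)//= (bigD1 j)//= -addrA lerDl addr_ge0//.
  exact: sumr_ge0.
by apply: sumr_ge0 => k _; exact: sumr_ge0.
Qed.

(** With M a bound on the p-th mean of x, the right-hand side has the order M^q for all p,
    so that bounds on the p-th means for all p yield bounds on a fixed moment q. *)
Lemma powR_scaled_bound (x M : R) (q p : nat) : 0 <= x -> 0 < M -> (q <= p)%N ->
  x `^ q%:R <= M ^+ q + (M ^+ q * M ^- p) * x `^ p%:R.
Proof.
move=> x0 M0 qp; rewrite !powR_mulrn//.
have xM : 0 <= x / M by rewrite divr_ge0// ltW.
have := @powR_le1D R q%:R p%:R (x / M) (ler0n _ _) _ xM.
rewrite ler_nat => /(_ qp); rewrite !powR_mulrn// !exprMn !exprVn => h.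
have Mq : 0 < M ^+ q by rewrite exprn_gt0.
have := ler_wpM2l (ltW Mq) h; rewrite mulrCA mulrDr mulr1 divff ?gt_eqF// mulr1.
by rewrite (mulrC (x ^+ p)) mulrA.
Qed.

End bounds.

Section minimisation.
Variables (R : realType) (n : nat).
Notation V := 'rV[R]_n.+1.
Notation L := (lebesgue_rV_type R n.+1).
Notation mu := (@lebesgue_rV R n.+1).
Variables (Om : set V) (oO : open Om) (Omfin : (mu Om < +oo)%E).
Variables (M0 : R) (M0_gt0 : 0 < M0) (OmM0 : Om `<=` cube M0).
Let mOm := open_lebesgue oO.
Notation D := (wderiv Om).
Variables (G : 'M[R]_n.+1 -> R) (cG : continuous G) (G0 : forall X, 0 <= G X).
Variables (C1 C2 r : R) (C1_gt0 : 0 < C1) (C2_gt0 : 0 < C2) (r_gt0 : 0 < r).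
Hypothesis G_growth : forall X, symmx X -> forall i j, C1 * `|X i j| `^ r <= G X + C2.
Variables (g : V -> R) (gW : W2 Om +oo%E g).
Notation dens := (dens Om G).
Variable u : nat -> V -> R.
Hypothesis uW : forall k, W2oo_bd Om g (u k).
Hypothesis u_min : forall k psi c, W2oo_bd Om g psi -> 0 <= c ->
  {ae mu, forall x, Om x -> dens psi x <= c} ->
  (Ep G Om k.+1 (u k) Om <= (2 ^- k.+1 + c)%:E)%E.

Let uoo k : W2 Om +oo%E (u k). Proof. exact: (W2oo_bd_W2oo oO Omfin gW (uW k)). Qed.
Let hu k : has_wderiv Om (u k). Proof. exact: (W2oo_bd_wderiv oO Omfin gW (uW k)). Qed.

Let OmE : exists2 m : R, 0 <= m & mu Om = m%:E.
Proof.
exists (fine (mu Om)); first exact: fine_ge0.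
by rewrite fineK// ge0_fin_numE.
Qed.

Lemma dens_moment_fin k q : (moment mu Om q%:R (dens (u k)) < +oo)%E.
Proof.
have [c c0 hc] := dens_bounded oO Omfin cG (uoo k).
apply: (moment_bounded_fin mOm Omfin (ler0n _ q) c0).
  exact: (measurable_dens oO cG (hu k)).
by apply: (ae_imp hc) => x h Ox; rewrite ger0_norm ?h//; exact: G0.
Qed.

Lemma dens_moment_bounded q : exists2 C : R, 0 <= C &
  forall k, (moment mu Om q%:R (dens (u k)) <= C%:E)%E.
Proof.
have [c c0 hc] := dens_bounded oO Omfin cG gW.
have [m m0 mE] := OmE.
pose M := 1 + c; have M_gt0 : 0 < M by rewrite /M; lra.
apply: (@eventually_bounded _ _ q (M ^+ q * m + M ^+ q * m)).
- by move=> k; exact: moment_ge0.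
- by move=> k; exact: dens_moment_fin.
move=> k qk; have md := measurable_dens oO cG (hu k).
have EM : (Ep G Om k.+1 (u k) Om <= M%:E)%E.
  apply: (le_trans (u_min k (W2oo_bd_g oO Omfin g) c0 hc)); rewrite lee_fin /M.
  by rewrite lerD2r invf_le1 ?exprn_gt0// exprn_ege1// ler1n.
have /(EpP oO Omfin cG G0 _ _ _ _ _) := EM.
move=> /(_ isT (ltW M_gt0) mOm (@subset_refl _ _) (hu k)) h.
have a0 : 0 <= M ^+ q by rewrite exprn_ge0// ltW.
have b0 : 0 <= M ^+ q * M ^- k.+1 by rewrite mulr_ge0// invr_ge0 exprn_ge0// ltW.
have pt x : `|dens (u k) x| `^ q%:R <=
    M ^+ q + (M ^+ q * M ^- k.+1) * `|dens (u k) x| `^ k.+1%:R.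
  by apply: powR_scaled_bound => //; exact: leq_trans qk _.
have H : (moment mu Om q%:R (dens (u k)) <= (M ^+ q)%:E * mu Om +
    (M ^+ q * M ^- k.+1)%:E * moment mu Om k.+1%:R (dens (u k)))%E.
  exact: (@moment_le _ _ _ mu (Om : set L) mOm q%:R k.+1%:R _ _ _ _ md md a0 b0 pt).
rewrite mE in h H; apply: (le_trans H).
have b0' : (0 <= (M ^+ q * M ^- k.+1)%:E)%E by rewrite lee_fin.
apply: (le_trans (leeD (lexx _) (lee_wpmul2l b0' h))).
rewrite -!(EFinM, EFinD) lee_fin lerD2l mulrA -(mulrA (M ^+ q)) mulVf ?mulr1//.
by rewrite gt_eqF// exprn_gt0.
Qed.

Lemma hess_moment_bounded s : exists2 C : R, 0 <= C &
  forall k i j, (moment mu Om s%:R (D [:: i; j] (u k)) <= C%:E)%E.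
Proof.
have [q qs] : exists q : nat, s%:R <= r * q%:R.
  have s0 : 0 <= s%:R / r by rewrite divr_ge0// ltW.
  exists (Num.bound (s%:R / r)); rewrite mulrC -ler_pdivrMr// ltW//.
  exact: archi_boundP.
have [C C0 hC] := dens_moment_bounded q; have [m m0 mE] := OmE.
pose A : R := C1 ^- q; have A0 : 0 <= A by rewrite invr_ge0 exprn_ge0// ltW.
pose a := 1 + A * (2 `^ q%:R * C2 ^+ q).
pose b := A * 2 `^ q%:R.
have p0 := powR_ge0 2 (q%:R : R).
have a0 : 0 <= a.
  by rewrite addr_ge0// mulr_ge0// mulr_ge0// exprn_ge0// ltW.
have b0 : 0 <= b by rewrite mulr_ge0.
exists (a * m + b * C).
  by rewrite addr_ge0// mulr_ge0.
move=> k i j; have md := measurable_dens oO cG (hu k).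
have mD := @measurable_wderiv _ _ _ oO [:: i; j] _ (hu k) isT.
have pt x : `|D [:: i; j] (u k) x| `^ s%:R <= a + b * `|dens (u k) x| `^ q%:R.
  have gr := G_growth (D2_sym Om (u k) x) i j; rewrite mxE in gr.
  have d0 : 0 <= dens (u k) x by exact: G0.
  set X := D _ _ x in gr *; rewrite -/(dens (u k) x) in gr.
  have X0 := normr_ge0 X.
  apply: (le_trans (powR_le1D (ler0n _ s) qs X0)).
  rewrite /a -addrA lerD2l powRrM (ger0_norm d0).
  have h1 : `|X| `^ r <= C1^-1 * (dens (u k) x + C2).
    by rewrite mulrC ler_pdivlMr// mulrC.
  apply: le_trans (ler_powR2 (ler0n _ q) (powR_ge0 _ _) h1) _.
  have dC : 0 <= dens (u k) x + C2 by rewrite addr_ge0// ltW.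
  have C1i : 0 <= C1^-1 by rewrite invr_ge0 ltW.
  rewrite powRM// (powR_mulrn q C1i) exprVn -/A /b -mulrA -mulrDr.
  apply: ler_wpM2l => //.
  have := powR_normD (dens (u k) x) C2 (ler0n _ q).
  rewrite (ger0_norm dC) (ger0_norm d0) (ger0_norm (ltW C2_gt0)).
  by rewrite (powR_mulrn q (ltW C2_gt0)) [X in _ <= X -> _]addrC.
have H : (moment mu Om s%:R (D [:: i; j] (u k)) <= a%:E * mu Om +
    b%:E * moment mu Om q%:R (dens (u k)))%E.
  exact: (@moment_le _ _ _ mu (Om : set L) mOm s%:R q%:R _ _ _ _ mD md a0 b0 pt).
rewrite mE in H; apply: (le_trans H).
have b0' : (0 <= b%:E)%E by rewrite lee_fin.
apply: (le_trans (leeD (lexx _) (lee_wpmul2l b0' (hC k)))).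
by rewrite -!(EFinM, EFinD) lexx.
Qed.

Definition diffs k : V -> R := fun x => u k x - g x.

Lemma diffs_W2oo0 k : W2oo0 Om (diffs k).
Proof.
have [v Wv vE] := uW k; have -> : diffs k = v; last exact: Wv.
by apply/funext => x; rewrite /diffs -vE /= addrC addKr.
Qed.

Let hg : has_wderiv Om g. Proof. exact: (W2oo_bd_wderiv oO Omfin gW (W2oo_bd_g oO Omfin g)). Qed.

Lemma diffs_hess_bounded s : exists2 C : R, 0 <= C &
  forall k i j, (moment mu Om s%:R (D [:: i; j] (diffs k)) <= C%:E)%E.
Proof.
have [C C0 hC] := hess_moment_bounded s.
have [_ gfin] := W2oo_sob oO Omfin (ler0n _ s) gW.
pose B := \sum_i \sum_j fine (moment mu Om s%:R (D [:: i; j] g)).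
have f0 i j : 0 <= fine (moment mu Om s%:R (D [:: i; j] g)) by apply: fine_ge0; exact: moment_ge0.
have B0 : 0 <= B by apply: sumr_ge0 => i _; apply: sumr_ge0.
have p0 := powR_ge0 2 (s%:R : R).
exists (2 `^ s%:R * B + 2 `^ s%:R * C).
  by rewrite addr_ge0// mulr_ge0.
move=> k i j; have ij2 : (size [:: i; j] <= 2)%N by [].
have mD := measurable_wderiv oO (hu k) ij2; have mg := measurable_wderiv oO hg ij2.
rewrite /diffs (moment_wderiv_sub oO s%:R (hu k) hg ij2).
have -> : (fun x => D [:: i; j] (u k) x - D [:: i; j] g x) =
   (fun x => -1 * D [:: i; j] g x + D [:: i; j] (u k) x).
  by apply/funext => x; rewrite mulN1r addrC.
have H := @moment_linE _ _ _ mu (Om : set L) mOm s%:R (-1) _ _ (ler0n _ s) mg mD.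
apply: (le_trans H); rewrite normrN1 mulr1 EFinD !EFinM; apply: leeD.
  apply: lee_wpmul2l; first by rewrite lee_fin.
  rewrite -[leLHS]fineK ?ge0_fin_numE ?moment_ge0 ?gfin// lee_fin /B.
  exact: (ler_sum2_term (F := fun i j => fine (moment mu Om s%:R (D [:: i; j] g)))).
by apply: lee_wpmul2l; [rewrite lee_fin|exact: hC].
Qed.

(** The Hessians are bounded in L^s by the growth of the density, and the Poincare
    inequality descends to the lower derivatives, which only the differences with g
    allow. *)
Lemma diffs_moment_bounded s : (1 < s)%N -> exists2 C : R, 0 <= C &
  forall k a, (size a <= 2)%N -> (moment mu Om s%:R (D a (diffs k)) <= C%:E)%E.
Proof.
case: s => [//|s] s1; have [C C0 hC] := diffs_hess_bounded s.+1.
pose P := (4 * (2 * (M0 + 1))) ^+ s.+1.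
have P0 : 0 <= P by rewrite exprn_ge0// !mulr_ge0// addr_ge0// ltW.
have W k : W20 Om s.+1%:R%:E (diffs k).
  by have [_ h] := diffs_W2oo0 k; apply: h; rewrite /= ltr1n.
have poin k a (B : R) : (size a <= 1)%N ->
    (moment mu Om s.+1%:R (D (ord0 :: a) (diffs k)) <= B%:E)%E ->
    (moment mu Om s.+1%:R (D a (diffs k)) <= (P * B)%:E)%E.
  move=> a1 h; apply: (le_trans (poincare_W20 oO Omfin M0_gt0 OmM0 (W k) a1)).
  by rewrite EFinM; apply: lee_wpmul2l; [rewrite lee_fin|exact: h].
exists (C + P * C + P * (P * C)).
  by rewrite !addr_ge0// !mulr_ge0.
have PC : 0 <= P * C by exact: mulr_ge0.
have PPC : 0 <= P * (P * C) by exact: mulr_ge0.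
move=> k [|i [|j [|//]]] _.
- apply: (le_trans (@poin k [::] _ isT (@poin k [:: ord0] _ isT (hC k ord0 ord0)))).
  rewrite lee_fin; lra.
- apply: (le_trans (@poin k [:: i] _ isT (hC k ord0 i))); rewrite lee_fin; lra.
- apply: (le_trans (hC k i j)); rewrite lee_fin; lra.
Qed.

End minimisation.

(** * Sets of functions bounded in every W^{2,s} *)
Section bounded_class.
Variables (R : realType) (n : nat).
Notation V := 'rV[R]_n.
Notation L := (lebesgue_rV_type R n).
Notation mu := (@lebesgue_rV R n).
Variables (Om : set V) (oO : open Om) (Omfin : (mu Om < +oo)%E).
Let mOm := open_lebesgue oO.
Notation D := (wderiv Om).
Variables (B : nat -> R) (B0 : forall s, 0 <= B s).
Implicit Types (z y : V -> R).

(** Convex, and for suitable bounds B it contains the differences of the approximate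
    minimisers with g, hence their convex combinations. *)
Definition moment_class : set (V -> R) := [set z | W2oo0 Om z /\
  forall s a, (1 < s)%N -> (size a <= 2)%N ->
    (moment mu Om s%:R (D a z) <= (B s)%:E)%E].

Lemma moment_class_convex : convexP moment_class.
Proof.
move=> u v t [Wu Bu] [Wv Bv] t0 t1.
have E : (t *: u + (1 - t) *: v) = (fun x => t * u x + (1 - t) * v x) by [].
have hu := W2oo0_wderiv oO Omfin Wu; have hv := W2oo0_wderiv oO Omfin Wv.
rewrite E; split.
  have -> : (fun x => t * u x + (1 - t) * v x) = (fun x => t * u x + (- t * v x + v x)).
    by apply/funext => x; lra.
  exact: (W2oo0_lin oO Omfin t Wu (W2oo0_lin oO Omfin (- t) Wv Wv)).
move=> s a s1 a2.
have mu' := measurable_wderiv oO hu a2; have mv := measurable_wderiv oO hv a2.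
have mc : measurable_fun (Om : set L) (fun x => t * D a u x + (1 - t) * D a v x).
  exact: (measurable_comb t (1 - t) mu' mv).
rewrite (moment_wderiv oO s%:R (has_wderiv_comb oO t (1 - t) hu hv) a2 mc
  (wderiv_comb oO t (1 - t) hu hv a2)).
have s1' : (1 : R) <= s%:R by rewrite ler1n ltnW.
exact: (@moment_convex _ _ _ mu (Om : set L) mOm _ _ _ _ _ s1' t0 t1 mu' mv (Bu s a s1 a2) (Bv s a s1 a2)).
Qed.

Lemma hull_moment_class A : A `<=` moment_class -> hull A `<=` moment_class.
Proof. by move=> AZ z; apply => //; exact: moment_class_convex. Qed.

Lemma moment_class_wderiv z : moment_class z -> has_wderiv Om z.
Proof. by move=> [Wz _]; exact: (W2oo0_wderiv oO Omfin Wz). Qed.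

Section limit.
Variables (y : V -> R) (hy : has_wderiv Om y).

Lemma energy_cvg_ae (z_ : nat -> V -> R) : (forall m, has_wderiv Om (z_ m)) ->
  (forall m, (energy Om 2 (fun x => z_ m x - y x)%R <= ((2^-1) ^+ m)%:E)%E) ->
  {ae mu, forall x, forall a : 2.-bseq 'I_n, Om x ->
    D a (z_ m) x @[m --> \oo] --> D a y x}.
Proof.
move=> hz zy; apply: (@filter_forall _ _ _ _ (ae_filter_ringOfSetsType mu)) => a.
have a2 := size_bseq a.
have h2 : (2^-1 : R) < 1 by lra.
have h0 : (0 : R) <= 2^-1 by rewrite invr_ge0.
have h20 : (0 : R) < 2 by [].
apply: (@cvg_moment_ae _ _ _ mu (Om : set L) mOm 2 (fun m => D a (z_ m)) (D a y) 1 2^-1 h20 ler01 h0 h2).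
- by move=> m; exact: (measurable_wderiv oO (hz m) a2).
- exact: (measurable_wderiv oO hy a2).
move=> m; rewrite mul1r -(moment_wderiv_sub oO 2 (hz m) hy a2).
by apply: le_trans (zy m); exact: moment_le_energy.
Qed.

Hypothesis y_lim : forall e : R, 0 < e -> exists2 z, moment_class z &
  (energy Om 2 (fun x => z x - y x)%R <= e%:E)%E.

Lemma moment_class_limit s a : (1 < s)%N -> (size a <= 2)%N ->
  (moment mu Om s%:R (D a y) <= (B s)%:E)%E.
Proof.
move=> s1 a2.
have /choice[z_ zP] : forall m, exists z, moment_class z /\
    (energy Om 2 (fun x => z x - y x)%R <= ((2^-1) ^+ m)%:E)%E.
  move=> m; have h0 : (0 : R) < 2^-1 ^+ m by rewrite exprn_gt0// invr_gt0.
  by have [z h1 h2] := y_lim h0; exists z.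
have hz m : has_wderiv Om (z_ m) by apply: moment_class_wderiv; case: (zP m).
have c : {ae mu, forall x, Om x -> D a (z_ m) x @[m --> \oo] --> D a y x}.
  have zy m : (energy Om 2 (fun x => z_ m x - y x)%R <= ((2^-1) ^+ m)%:E)%E.
    by case: (zP m).
  by apply: (ae_imp (energy_cvg_ae hz zy)) => x h Ox; exact: (h (Bseq a2) Ox).
apply: (@moment_fatou _ _ _ mu (Om : set L) mOm s (fun m => D a (z_ m)) (D a y) (B s) _ _ c).
- by move=> m; exact: (measurable_wderiv oO (hz m) a2).
- exact: (measurable_wderiv oO hy a2).
- by exists 0%N => m _; have [[_ h] _] := zP m; exact: h.
Qed.

Lemma moment_class_limit_sob (p : R) : 0 <= p -> sob Om p y.
Proof.
move=> p0; split; first exact: hy.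
move=> a a2; pose s := (Num.bound p).+2.
have ps : p <= s%:R.
  apply: le_trans (ltW (archi_boundP p0)) _; rewrite ler_nat /s; exact: leqW (leqnSn _).
have my := measurable_wderiv oO hy a2.
have H : (moment mu Om p (D a y) <= mu Om + moment mu Om s%:R (D a y))%E.
  exact: (@moment_exponent _ _ _ mu (Om : set L) mOm p s%:R _ p0 ps my).
apply: (le_lt_trans H); apply: lte_add_pinfty; first exact: Omfin.
exact: (le_lt_trans (@moment_class_limit s a isT a2) (ltry _)).
Qed.

Lemma ereal_interpolation (x f2 m fk : \bar R) (e K d : R) : 0 < e -> 0 <= K ->
  (f2 <= d%:E)%E -> (m + fk <= K%:E)%E -> (0 <= f2)%E ->
  (x <= e^-1%:E * f2 + e%:E * (m + fk))%E -> (x <= (e^-1 * d + e * K)%:E)%E.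
Proof.
move=> e0 K0 h1 h2 f20 h3; apply: (le_trans h3); rewrite EFinD !EFinM; apply: leeD.
  by apply: lee_wpmul2l => //; rewrite lee_fin invr_ge0 ltW.
by apply: lee_wpmul2l => //; rewrite lee_fin ltW.
Qed.

(** By interpolation between L^2 and an exponent s = 2 k for which the set is bounded;
    hence convex combinations that tend to y in W^{2,2} do so in every W^{2,p}. *)
Lemma moment_class_interpolation (p e : R) : 1 <= p -> 0 < e -> exists2 d : R, 0 < d &
  forall z, moment_class z -> (energy Om 2 (fun x => z x - y x)%R <= d%:E)%E ->
    (energy Om p (fun x => z x - y x)%R <= e%:E)%E.
Proof.
move=> p1 e0; have p0 : 0 <= p by lra.
pose k := (Num.bound p).+1.
have pk : p <= k%:R + 1.
  apply: (@le_trans _ _ k%:R); last by rewrite lerDl.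
  by apply: le_trans (ltW (archi_boundP p0)) _; rewrite ler_nat.
have [m m0 mE] : exists2 m : R, 0 <= m & mu Om = m%:E.
  exists (fine (mu Om)); first exact: fine_ge0.
  by rewrite fineK// ge0_fin_numE.
pose s := (2 * k)%N; have s1 : (1 < s)%N by rewrite /s mul2n -addnn addSn ltnS addnS.
pose c := (2 : R) `^ s%:R; have c0 : 0 <= c by exact: powR_ge0.
pose K := m + (c * B s + c * B s).
have K0 : 0 <= K by rewrite addr_ge0// addr_ge0// mulr_ge0.
pose N : R := #|{: 2.-bseq 'I_n}|%:R + 1; have N0 : 0 < N by rewrite ltr_wpDl.
have K1 : 0 < K + 1 by lra.
(* the two terms of the interpolation inequality are at most e / (2 N) for this weight h
   and the squared distance d *)
pose h := e / (2 * N) / (K + 1).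
have h0 : 0 < h by rewrite !divr_gt0// mulr_gt0.
pose d := h * (e / (2 * N)); have d0 : 0 < d by rewrite mulr_gt0// divr_gt0// mulr_gt0.
exists d => // z Zz zd; have hz := moment_class_wderiv Zz.
have bound a : (size a <= 2)%N ->
    (moment mu Om p (D a (fun x => z x - y x)%R) <= (e / N)%:E)%E.
  move=> a2; have hzy := has_wderiv_sub oO hz hy.
  have mD := measurable_wderiv oO hzy a2.
  have mz := measurable_wderiv oO hz a2; have my := measurable_wderiv oO hy a2.
  have b1 := le_trans (moment_le_energy Om 2 _ a2) zd.
  have b2 : (moment mu Om s%:R (D a (fun x => z x - y x)%R) <= (c * B s + c * B s)%:E)%E.
    rewrite (moment_wderiv_sub oO s%:R hz hy a2).
    have -> : (fun x => D a z x - D a y x) = (fun x => -1 * D a y x + D a z x).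
      by apply/funext => x; rewrite mulN1r addrC.
    have H := @moment_linE _ _ _ mu (Om : set L) mOm s%:R (-1) _ _ (ler0n _ s) my mz.
    have c0' : (0 <= c%:E)%E by [].
    apply: (le_trans H); rewrite normrN1 mulr1 -/c EFinD !EFinM.
    apply: leeD; apply: (lee_wpmul2l c0'); first exact: moment_class_limit.
    by case: Zz => _; exact.
  have b3 : (mu Om + moment mu Om (2 * k%:R) (D a (fun x => z x - y x)%R) <= K%:E)%E.
    by rewrite -natrM -/s mE EFinD leeD.
  have H := @moment_interpolation _ _ _ mu (Om : set L) mOm p k _ h p1 pk h0 mD.
  apply: (le_trans (ereal_interpolation h0 K0 b1 b3 (moment_ge0 _ _ _ _) H)).
  have e1 : h^-1 * d = e / (2 * N) by rewrite /d mulKf// gt_eqF.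
  have e2 : h * K <= e / (2 * N).
    have -> : e / (2 * N) = h * (K + 1).
      by rewrite /h divfK// gt_eqF.
    by rewrite ler_pM2l//; lra.
  have e3 : e / N = e / (2 * N) + e / (2 * N).
    have -> : e / (2 * N) = e / N * 2^-1 by rewrite invfM mulrA mulrAC.
    lra.
  by rewrite lee_fin e3 e1 lerD2l.
apply: le_trans (energy_bseq_le bound) _.
by rewrite lee_fin mulrCA -[leRHS]mulr1 ler_pM2l// ler_pdivrMr// mul1r /N lerDl.
Qed.

Lemma moment_class_limit_W20 (p : R) : 1 < p -> W20 Om p%:E y.
Proof.
move=> p1; have p1' := ltW p1; have p0 : 0 <= p by lra.
apply: (W20_closed oO Omfin p1' (moment_class_limit_sob p0)) => e e0.
have [d d0 dP] := moment_class_interpolation p1' e0.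
have [z Zz zd] := y_lim d0.
exists z; first by case: Zz => -[_ h] _; exact: h.
rewrite (energy_subC oO p hy (moment_class_wderiv Zz)); exact: dP.
Qed.

End limit.
End bounded_class.

(** * Lower semicontinuity *)
Lemma limn_einf_frequent (R : realType) (F : (\bar R)^nat) (t : \bar R) :
  (limn_einf F < t)%E -> forall m, exists2 k, (m <= k)%N & (F k < t)%E.
Proof.
move=> Ft m; have : (einfs F m < t)%E.
  apply: le_lt_trans Ft; rewrite limn_einf_lim.
  by rewrite (cvg_lim (@ereal_hausdorff R) (@cvg_einfs_sup R F)); apply: ereal_sup_ubound; exists m.
by move=> /ereal_inf_lt[_ [k /= mk <-] h]; exists k.
Qed.

Lemma limn_einf_ge0 (R : realType) (F : (\bar R)^nat) :
  (forall k, 0 <= F k)%E -> (0 <= limn_einf F)%E.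
Proof.
move=> F0; rewrite leNgt; apply/negP => /limn_einf_frequent/(_ 0%N)[k _].
by rewrite ltNge F0.
Qed.

Section hessians.
Variables (R : realType) (n : nat).
Notation V := 'rV[R]_n.
Notation mu := (@lebesgue_rV R n).
Variables (Om : set V) (oO : open Om).
Implicit Types (u v : V -> R).

Lemma ae_hess (F : 'I_n -> 'I_n -> V -> Prop) :
  (forall i j, {ae mu, forall x, Om x -> F i j x}) ->
  {ae mu, forall x, Om x -> forall i j, F i j x}.
Proof.
move=> h; have H : {ae mu, forall x, forall i, Om x -> forall j, F i j x}.
  apply: (@filter_forall _ _ _ _ (ae_filter_ringOfSetsType mu)) => i.
  have H : {ae mu, forall x, forall j, Om x -> F i j x}.
    by apply: (@filter_forall _ _ _ _ (ae_filter_ringOfSetsType mu)) => j; exact: h.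
  by apply: (ae_imp H) => x hx Ox j; exact: hx.
by apply: (ae_imp H) => x hx Ox i j; exact: hx.
Qed.

Lemma D2_comb (c d : R) u v : has_wderiv Om u -> has_wderiv Om v ->
  {ae mu, forall x, Om x ->
    D2 Om (fun x => c * u x + d * v x) x = c *: D2 Om u x + d *: D2 Om v x}.
Proof.
move=> hu hv; have H := ae_hess (fun i j => @wderiv_comb _ _ _ oO c d u v [:: i; j] hu hv isT).
by apply: (ae_imp H) => x hx Ox; apply/matrixP => i j; rewrite !mxE hx.
Qed.

Lemma D2_add u v : has_wderiv Om u -> has_wderiv Om v ->
  {ae mu, forall x, Om x -> D2 Om (fun x => u x + v x) x = D2 Om u x + D2 Om v x}.
Proof.
move=> hu hv; have -> : (fun x => u x + v x) = (fun x => 1 * u x + 1 * v x).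
  by apply/funext => x; rewrite !mul1r.
by apply: (ae_imp (D2_comb 1 1 hu hv)) => x hx Ox; rewrite hx// !scale1r.
Qed.

Lemma D2_sub u v : has_wderiv Om u -> has_wderiv Om v ->
  {ae mu, forall x, Om x -> D2 Om (fun x => u x - v x) x = D2 Om u x - D2 Om v x}.
Proof.
move=> hu hv; have -> : (fun x => u x - v x) = (fun x => 1 * u x + (-1) * v x).
  by apply/funext => x; rewrite mul1r mulN1r.
by apply: (ae_imp (D2_comb 1 (-1) hu hv)) => x hx Ox; rewrite hx// scale1r scaleN1r.
Qed.

End hessians.

Section lower_semicontinuity.
Variables (R : realType) (n : nat).
Notation V := 'rV[R]_n.
Notation L := (lebesgue_rV_type R n).
Notation mu := (@lebesgue_rV R n).
Variables (Om : set V) (oO : open Om) (Omfin : (mu Om < +oo)%E).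
Let mOm := open_lebesgue oO.
Notation D := (wderiv Om).
Variables (G : 'M[R]_n -> R) (cG : continuous G) (G0 : forall X, 0 <= G X).
Hypothesis G_level_convex : forall (s t : R) X Y, 0 <= t -> t <= 1 ->
  G X <= s -> G Y <= s -> G (t *: X + (1 - t) *: Y) <= s.
Notation dens := (dens Om G).
Variables (g y : V -> R) (hg : has_wderiv Om g) (hy : has_wderiv Om y).
Variables (u : nat -> V -> R) (p : nat -> nat).
Hypothesis p_ge : forall k, (k < p k)%N.
Hypothesis hu : forall k, has_wderiv Om (u k).
Hypothesis u_hull : forall Q : set nat, (forall m, exists2 k, (m <= k)%N & Q k) ->
  forall e : R, 0 < e -> exists2 z, hull [set (fun x => u k x - g x) | k in Q] z &
    has_wderiv Om z /\ (energy Om 2 (fun x => z x - y x)%R <= e%:E)%E.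

(** At a given point x, the condition on D^2 z is convex in z and holds for the functions
    u k - g with k in Q, by level convexity. *)
Lemma dens_hull (t : R) (Q : set nat) z :
  hull [set (fun x => u k x - g x) | k in Q] z ->
  {ae mu, forall x, Om x -> (forall k, Q k -> dens (u k) x <= t) ->
    G (D2 Om g x + D2 Om z x) <= t}.
Proof.
move=> hz.
pose C (z : V -> R) := has_wderiv Om z /\
  {ae mu, forall x, Om x -> (forall k, Q k -> dens (u k) x <= t) ->
    G (D2 Om g x + D2 Om z x) <= t}.
suff : C z by case.
apply: hz => [v w s [hv Cv] [hw Cw] s0 s1|_ [k Qk <-]].
  have -> : s *: v + (1 - s) *: w = (fun x => s * v x + (1 - s) * w x) by [].
  split; first exact: (has_wderiv_comb oO s (1 - s) hv hw).
  apply: (ae_imp2 (D2_comb oO s (1 - s) hv hw) (ae_imp2 Cv Cw (fun x h h' => conj h h'))).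
  move=> x h1 [h2 h3] Ox A; rewrite h1//.
  have -> : D2 Om g x + (s *: D2 Om v x + (1 - s) *: D2 Om w x) =
      s *: (D2 Om g x + D2 Om v x) + (1 - s) *: (D2 Om g x + D2 Om w x).
    exact: convex_comb_add.
  by apply: G_level_convex => //; [exact: h2|exact: h3].
split; first exact: (has_wderiv_sub oO (hu k) hg).
apply: (ae_imp (D2_sub oO (hu k) hg)) => x h Ox A.
by rewrite h// addrC subrK; exact: A.
Qed.

(** Let t exceed the lower limit l, and s lie strictly between l and t. On the infinite
    set Q of indices with E_p <= s, Chebyshev's inequality and the Borel-Cantelli lemma
    show that almost every point of B is in all but finitely many sublevel sets
    {G(D^2 u_k) <= t}, as the powers (s / t)^(p_k) with p_k > k are summable. At such a
    point, convex combinations of the tails of Q eventually stay in the sublevel set, and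
    so does the limit of their Hessians by continuity. *)
Theorem Eoo_le_liminf (B : set V) : measurable (B : set L) -> B `<=` Om ->
  (Eoo G Om (fun x => g x + y x)%R B <= limn_einf (fun k => Ep G Om (p k) (u k) B))%E.
Proof.
move=> mB BOm; set F := fun k : nat => Ep G Om (p k) (u k) B.
have F0 k : (0 <= F k)%E by exact: Ep_ge0.
have := limn_einf_ge0 F0.
case lE : (limn_einf F) => [l| |] // l0; last exact: leey.
rewrite lee_fin in l0.
apply/lee_addgt0Pr => e e0; rewrite -EFinD.
set t := l + e; have t0 : 0 < t by rewrite /t; lra.
apply/(@Lnorm_oo_le _ _ _ mu (B : set L) (dens (fun x => g x + y x)) t (ltW t0)).
pose s := l + e / 2; have s0 : 0 <= s by rewrite addr_ge0// divr_ge0// ltW.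
have st : s < t by rewrite ltrD2l ltr_pdivrMr//; lra.
pose Q : set nat := [set k | (F k <= s%:E)%E].
have Qi m : exists2 k, (m <= k)%N & Q k.
  have [|k mk kt] := @limn_einf_frequent _ F s%:E _ m; last by exists k => //; exact: ltW.
  by rewrite lE lte_fin ltrDl divr_gt0.
have [mBr mBr0 mBE] : exists2 m : R, 0 <= m & mu B = m%:E.
  have Bfin : (mu B < +oo)%E by apply: le_lt_trans Omfin; apply: le_measure; rewrite ?inE.
  by exists (fine (mu B)); [exact: fine_ge0|rewrite fineK// ge0_fin_numE].
have md k : measurable_fun (B : set L) (dens (u k) : L -> R).
  exact: (measurable_funS mOm BOm (measurable_dens oO cG (hu k))).
have H1 : {ae mu, forall x, B x -> exists N, forall k, (N <= k)%N -> Q k -> dens (u k) x <= t}.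
  pose f k x := if `[< Q k >] then `|t^-1 * dens (u k) x| `^ (p k)%:R else 0.
  have q0 : 0 <= s / t by rewrite divr_ge0// ltW.
  have q1 : s / t < 1 by rewrite ltr_pdivrMr// mul1r.
  have mf k : measurable_fun (B : set L) (f k : L -> R).
    rewrite /f; case: asboolP => _; last exact: measurable_cst.
    exact: (measurable_powR_norm _ (measurable_scale t^-1 (md k))).
  have f0 k x : B x -> 0 <= f k x by rewrite /f; case: ifPn => // _ _; exact: powR_ge0.
  have fC k : (\int[mu]_(x in B) (f k x)%:E <= (mBr * (s / t) ^+ k)%:E)%E.
    rewrite /f; case: asboolP => Qk; last first.
      by rewrite integral0 lee_fin mulr_ge0// exprn_ge0.
    rewrite -(@momentE _ _ _ mu (B : set L)).
    rewrite (@moment_scale _ _ _ mu (B : set L) mB (p k)%:R t^-1 (dens (u k)) (md k)).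
    have pk0 : (0 < p k)%N by exact: leq_ltn_trans (p_ge k).
    have /(EpP oO Omfin cG G0 pk0 s0 mB BOm (hu k)) h := Qk.
    have t1 : 0 <= t^-1 by rewrite invr_ge0 ltW.
    rewrite (ger0_norm t1) (powR_mulrn (p k) t1); rewrite mBE in h.
    have t2 : (0 <= (t^-1 ^+ p k)%:E)%E by rewrite lee_fin exprn_ge0.
    apply: (le_trans (lee_wpmul2l t2 h)).
    rewrite -!EFinM lee_fin mulrA -exprMn mulrC ler_wpM2l// [t^-1 * s]mulrC.
    by apply: ler_wiXn2l => //; [exact: ltW|exact: ltnW].
  have := @ae_series_geometric _ _ _ mu (B : set L) mB f mBr (s / t) mBr0 q0 q1 mf f0 fC.
  move/ae_imp; apply => x h Bx.
  have /cvgrPdist_lt/(_ 1 ltr01)[N _ NP] := cvg_series_cvg_0 (h Bx).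
  exists N => k Nk Qk; have := NP k Nk; rewrite sub0r normrN /f asboolT//.
  have pk0 : (0 < p k)%N by exact: leq_ltn_trans (p_ge k).
  rewrite ger0_norm ?powR_ge0// powR_mulrn// expr_lt1//.
  rewrite normrM gtr0_norm ?invr_gt0// mulrC ltr_pdivrMr// mul1r => /ltW.
  by rewrite ger0_norm//; exact: G0.
have /choice[z zP] : forall m, exists z,
    hull [set (fun x => u k x - g x) | k in [set k | (m <= k)%N /\ Q k]] z /\
    has_wderiv Om z /\ (energy Om 2 (fun x => z x - y x)%R <= ((2^-1) ^+ m)%:E)%E.
  move=> m; have e1 : (0 : R) < 2^-1 ^+ m by rewrite exprn_gt0// invr_gt0.
  have [|z h1 h2] := @u_hull [set k | (m <= k)%N /\ Q k] _ _ e1; last by exists z.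
  move=> m'; have [k] := Qi (maxn m' m); rewrite geq_max => /andP[k1 k2] Qk.
  by exists k.
have zh m : hull [set (fun x => u k x - g x) | k in [set k | (m <= k)%N /\ Q k]] (z m).
  by case: (zP m).
have hz m : has_wderiv Om (z m) by case: (zP m) => _ [].
have zy m : (energy Om 2 (fun x => z m x - y x)%R <= ((2^-1) ^+ m)%:E)%E.
  by case: (zP m) => _ [].
have H2 : {ae mu, forall x, forall m, Om x ->
    (forall k, (m <= k)%N /\ Q k -> dens (u k) x <= t) ->
    G (D2 Om g x + D2 Om (z m) x) <= t}.
  have h m : {ae mu, forall x, Om x ->
      (forall k, (m <= k)%N /\ Q k -> dens (u k) x <= t) ->
      G (D2 Om g x + D2 Om (z m) x) <= t} by exact: (dens_hull t (zh m)).
  by apply: ae_foralln => m; exact: h.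
have H3 : {ae mu, forall x, forall a : 2.-bseq 'I_n, Om x ->
    D a (z m) x @[m --> \oo] --> D a y x}.
  by apply: energy_cvg_ae => // m; case: (zP m) => _ [].
have H4 := D2_add oO hg hy.
have H12 := ae_imp2 H1 H2 (fun x h h' => conj h h').
have H34 := ae_imp2 H3 H4 (fun x h h' => conj h h').
apply: (ae_imp2 H12 H34) => x [h1 h2] [h3 h4] Bx; have Ox := BOm x Bx.
rewrite ger0_norm; last exact: G0.
rewrite /dens h4//.
have c : G (D2 Om g x + D2 Om (z m) x) @[m --> \oo] --> G (D2 Om g x + D2 Om y x).
  have c1 : (D2 Om g x + D2 Om (z m) x) @[m --> \oo] --> (D2 Om g x + D2 Om y x).
    apply: cvg_mx_entries => i j.
    rewrite mxE [X in _ --> _ + X]mxE.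
    have c2 := h3 (Bseq (isT : size [:: i; j] <= 2)%N) Ox.
    rewrite (_ : (fun m => _) = (fun m => D2 Om g x i j + D [:: i; j] (z m) x)).
      exact: (cvgD (cvg_cst _) c2).
    by apply/funext => m; rewrite mxE [X in _ + X]mxE.
  exact: (cvg_comp _ _ c1 (@cG _)).
have [N NP] := h1 Bx.
rewrite -(cvg_lim (@norm_hausdorff _ _) c).
apply: limr_le; first by apply/cvg_ex; exists (G (D2 Om g x + D2 Om y x)).
by exists N => // m /= Nm; apply: h2 => // k [mk Qk]; apply: NP => //; exact: leq_trans mk.
Qed.

End lower_semicontinuity.

(** * Weak convergence *)
Lemma limn_einf_le (R : realType) (F : (\bar R)^nat) (c : R) :
  (forall (e : R) m, 0 < e -> exists2 k, (m <= k)%N & (F k <= (c + e)%:E)%E) ->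
  (limn_einf F <= c%:E)%E.
Proof.
move=> h; rewrite limn_einf_lim (cvg_lim (@ereal_hausdorff R) (@cvg_einfs_sup R F)).
apply: ge_ereal_sup => _ [m _ <-]; apply/lee_addgt0Pr => e e0; rewrite -EFinD.
have [k mk Fk] := h e m e0; apply: le_trans Fk.
by apply: ereal_inf_lbound; exists k.
Qed.

Section weak_convergence.
Variables (R : realType) (n : nat).
Notation V := 'rV[R]_n.
Notation mu := (@lebesgue_rV R n).
Variables (Om : set V) (oO : open Om) (Omfin : (mu Om < +oo)%E).
Variables (g : V -> R) (gW : W2 Om +oo%E g).
Variables (B : nat -> R) (B0 : forall s, 0 <= B s).
Variables (x : nat -> V -> R) (y : V -> R) (hy : has_wderiv Om y).
Hypothesis xB : forall k, moment_class Om B (x k).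
Hypothesis x_hull : forall Q : set nat, (forall m, exists2 k, (m <= k)%N & Q k) ->
  forall e : R, 0 < e -> exists2 z, hull [set x k | k in Q] z &
    moment_class Om B z /\ (energy Om 2 (fun t => z t - y t)%R <= e%:E)%E.

Lemma hull_limit_class (e : R) : 0 < e -> exists2 z, moment_class Om B z &
  (energy Om 2 (fun t => z t - y t)%R <= e%:E)%E.
Proof.
move=> e0; have [|z _ [h1 h2]] := @x_hull setT _ _ e0; last by exists z.
by move=> m; exists m.
Qed.

Lemma W2_norm_ge0 (p : \bar R) u : (0 <= W2_norm Om p u)%E.
Proof.
apply: adde_ge0; last by apply: sume_ge0 => i _; apply: sume_ge0 => j _; exact: Lnorm_ge0.
by apply: adde_ge0; [exact: Lnorm_ge0|apply: sume_ge0 => i _; exact: Lnorm_ge0].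
Qed.

(** If a bounded functional l stayed away from its value at the limit along an infinite
    set Q of indices, with a fixed sign, it would do so on the convex combinations of
    the terms in Q, some of which converge strongly. *)
Lemma hull_weak_cvg (q : R) : 1 <= q ->
  W2_weak_cvg Om q%:E (fun k t => g t + x k t) (fun t => g t + y t).
Proof.
move=> q1; have q0 : 0 <= q by lra.
have sg : sob Om q g by exact: (W2oo_sob oO Omfin q0 gW).
have sz z : moment_class Om B z -> sob Om q z.
  by move=> [Wz _]; exact: (W2oo0_sob oO Omfin q0 Wz).
have sy : sob Om q y by exact: (moment_class_limit_sob oO Omfin hy hull_limit_class q0).
have W v : sob Om q v -> W2 Om q%:E v by move=> /(W2P oO _ q1 Omfin).
have addE v : (fun t => g t + v t) = (fun t => 1 * g t + v t).
  by apply/funext => t; rewrite mul1r.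
have sgv v : sob Om q v -> sob Om q (fun t => g t + v t).
  by move=> sv; rewrite addE; exact: (sob_lin oO 1 q0 sg sv).
split; [by move=> k; exact: W (sgv _ (sz _ (xB k)))|exact: W (sgv _ sy)|].
move=> l [lin [C lC]].
have lg v : sob Om q v -> l (fun t => g t + v t) = l g + l v.
  by move=> sv; rewrite addE lin ?mul1r//; exact: W.
suff H (b : bool) (e : R) : 0 < e ->
    exists N, forall k, (N <= k)%N -> (-1) ^+ b * (l (x k) - l y) < e.
  apply/cvgrPdist_lt => e e0.
  have [N0 h0] := H false e e0; have [N1 h1] := H true e e0.
  exists (maxn N0 N1) => // k /=; rewrite geq_max => /andP[k0 k1].
  rewrite lg// lg; last exact: sz.
  have := h0 k k0; have := h1 k k1; rewrite expr0 expr1 => a1 a2.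
  by rewrite ltr_norml; apply/andP; split; lra.
move=> e0; apply: contrapT => /forallNP h.
pose Q : set nat := [set k | e <= (-1) ^+ b * (l (x k) - l y)].
have Qi m : exists2 k, (m <= k)%N & Q k.
  have /existsNP[k /not_implyP[mk /negP]] := h m.
  by rewrite -leNgt => Qk; exists k.
pose K : set (V -> R) := [set z | moment_class Om B z /\ e <= (-1) ^+ b * (l z - l y)].
have cK : convexP K.
  move=> v w t [Zv Lv] [Zw Lw] t0 t1; split.
    exact: (moment_class_convex oO Omfin Zv Zw t0 t1).
  have sv := sz _ Zv; have sw := sz _ Zw.
  have -> : t *: v + (1 - t) *: w = (fun z => t * v z + (- t * w z + w z)).
    transitivity (fun z => t * v z + (1 - t) * w z); first by [].
    by apply/funext => z; lra.
  have s1 : sob Om q (fun z => - t * w z + w z) by exact: (sob_lin oO (- t) q0 sw sw).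
  rewrite (lin t _ _ (W _ sv) (W _ s1)) (lin (- t) _ _ (W _ sw) (W _ sw)).
  have t1' : 0 <= 1 - t by rewrite subr_ge0.
  move: Lv Lw => /(ler_wpM2l t0) Lv /(ler_wpM2l t1') Lw.
  have := lerD Lv Lw; set s := (-1) ^+ b; move=> hh; lra.
have C1 : 0 < `|C| + 1 by rewrite ltr_wpDl.
have d0 : 0 < e / (`|C| + 1) by rewrite divr_gt0.
have [d1 d1_gt0 d1P] := W2_norm_le_energy oO q1 d0.
have [d2 d2_gt0 d2P] := moment_class_interpolation oO Omfin B0 hy hull_limit_class q1 d1_gt0.
have [z hz [Zz zd]] := x_hull Qi d2_gt0.
have [_ ez] : K z by apply: hz => // _ [k Qk <-]; split; [exact: xB|exact: Qk].
have szy : sob Om q (fun t => -1 * y t + z t) by exact: (sob_lin oO (-1) q0 sy (sz _ Zz)).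
have yzE : (fun t => -1 * y t + z t) = (fun t => z t - y t).
  by apply/funext => t; rewrite mulN1r addrC.
have lE : l (fun t => -1 * y t + z t) = l z - l y.
  by rewrite lin ?mulN1r 1?addrC//; [exact: W|exact: W (sz _ Zz)].
have nz : (W2_norm Om q%:E (fun t => -1 * y t + z t)%R <= (e / (`|C| + 1))%:E)%E.
  rewrite yzE; apply: d1P; last exact: d2P.
  by rewrite -yzE; case: szy.
have := lC _ (W _ szy); rewrite lE => lb.
have Cn : (C%:E * W2_norm Om q%:E (fun t => -1 * y t + z t)%R <= (`|C| * (e / (`|C| + 1)))%:E)%E.
  apply: (@le_trans _ _ (`|C|%:E * W2_norm Om q%:E (fun t => -1 * y t + z t)%R)%E).
    by apply: lee_wpmul2r; [exact: W2_norm_ge0|rewrite lee_fin ler_norm].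
  by rewrite EFinM; apply: lee_wpmul2l; [rewrite lee_fin|exact: nz].
have := le_trans lb Cn; rewrite lee_fin => lb2.
have lt1 : `|C| * (e / (`|C| + 1)) < e.
  by rewrite mulrCA -[ltRHS]mulr1 ltr_pM2l// ltr_pdivrMr// mul1r ltrDl.
have := ler_norm ((-1) ^+ b * (l z - l y)); rewrite normrMsign => lb3.
by have := lt_le_trans (le_lt_trans (le_trans lb3 lb2) lt1) ez; rewrite ltxx.
Qed.

End weak_convergence.

(** * The minimiser *)
Section minimiser.
Variables (R : realType) (n : nat).
Notation V := 'rV[R]_n.+1.
Notation L := (lebesgue_rV_type R n.+1).
Notation mu := (@lebesgue_rV R n.+1).
Variables (Om : set V) (oO : open Om) (Omfin : (mu Om < +oo)%E).
Variables (M0 : R) (M0_gt0 : 0 < M0) (OmM0 : Om `<=` cube M0).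
Let mOm := open_lebesgue oO.
Notation D := (wderiv Om).

(** The constants in the Poincare inequality grow geometrically with the exponent, so the
    bounds on all moments give bounds almost everywhere. *)
Lemma hess_bounded_W2oo0 y (c : R) : has_wderiv Om y ->
  (forall p, 1 < p -> W20 Om p%:E y) -> 0 <= c ->
  {ae mu, forall x, Om x -> forall i j, `|D2 Om y x i j| <= c} -> W2oo0 Om y.
Proof.
move=> hy Wy c0 hc.
pose K := 4 * (2 * (M0 + 1)); have K0 : 0 <= K by rewrite !mulr_ge0// addr_ge0// ltW.
have poin a (b : R) : (size a <= 1)%N -> 0 <= b ->
    {ae mu, forall x, Om x -> `|D (ord0 :: a) y x| <= b} ->
    {ae mu, forall x, Om x -> `|D a y x| <= K * b}.
  move=> a1 b0 hb; have a2 : (size a <= 2)%N by exact: leqW.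
  have ma := measurable_wderiv oO hy a2.
  have m0a := @measurable_wderiv _ _ _ oO (ord0 :: a) y hy a1.
  have [m m0 mE] : exists2 m : R, 0 <= m & mu Om = m%:E.
    exists (fine (mu Om)); first exact: fine_ge0.
    by rewrite fineK// ge0_fin_numE.
  have Kb : 0 <= K * b by exact: mulr_ge0.
  apply: (@ae_bounded_moments _ _ _ mu (Om : set L) mOm (D a y) (K * b) m Kb m0 ma).
  case=> [//|k] k1; have k1' : (1 : R) < k.+1%:R by rewrite ltr1n.
  have h := poincare_W20 oO Omfin M0_gt0 OmM0 (Wy _ k1') a1.
  apply: (le_trans h).
  have h2 : (moment mu Om k.+1%:R (D (ord0 :: a) y) <= (b `^ k.+1%:R)%:E * mu Om)%E.
    exact: (@moment_bounded _ _ _ mu (Om : set L) mOm k.+1%:R _ b (ler0n _ _) b0 m0a hb).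
  rewrite mE (powR_mulrn _ b0) in h2.
  have K0' : (0 <= (K ^+ k.+1)%:E)%E by rewrite lee_fin exprn_ge0.
  apply: (le_trans (lee_wpmul2l K0' h2)).
  by rewrite -!EFinM lee_fin (exprMn _ K b) mulrA [leLHS]mulrC.
have h2 i j : {ae mu, forall x, Om x -> `|D [:: i; j] y x| <= c}.
  by apply: (ae_imp hc) => x h Ox; have := h Ox i j; rewrite mxE.
have Kc : 0 <= K * c by exact: mulr_ge0.
have h1 i := poin [:: i] c isT c0 (h2 ord0 i).
have h0 := poin [::] (K * c) isT Kc (h1 ord0).
split; last exact: Wy.
apply/(W2ooP oO _ Omfin); split; first exact: hy.
case=> [|i [|j [|//]]] _.
- by exists (K * (K * c)) => //; exact: mulr_ge0.
- by exists (K * c).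
- by exists c.
Qed.

Variables (G : 'M[R]_n.+1 -> R) (cG : continuous G) (G0 : forall X, 0 <= G X).
Variables (C1 C2 r : R) (C1_gt0 : 0 < C1) (C2_gt0 : 0 < C2) (r_gt0 : 0 < r).
Hypothesis G_growth : forall X, symmx X -> forall i j, C1 * `|X i j| `^ r <= G X + C2.
Hypothesis G_level_convex : forall (s t : R) X Y, 0 <= t -> t <= 1 ->
  G X <= s -> G Y <= s -> G (t *: X + (1 - t) *: Y) <= s.
Variables (g : V -> R) (gW : W2 Om +oo%E g).
Notation dens := (dens Om G).

Lemma dens_bounded_hess u (c : R) : has_wderiv Om u -> 0 <= c ->
  {ae mu, forall x, Om x -> dens u x <= c} -> exists2 b, 0 <= b &
  {ae mu, forall x, Om x -> forall i j, `|D2 Om u x i j| <= b}.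
Proof.
move=> hu c0 hc; exists (((c + C2) / C1) `^ r^-1); first exact: powR_ge0.
apply: (ae_imp hc) => x h Ox i j.
have gr := G_growth (D2_sym Om u x) i j.
have X0 := normr_ge0 (D2 Om u x i j).
have e1 : `|D2 Om u x i j| = (`|D2 Om u x i j| `^ r) `^ r^-1.
  by rewrite -powRrM mulfV ?gt_eqF// powRr1.
rewrite e1; apply: ler_powR2.
- by rewrite invr_ge0 ltW.
- exact: powR_ge0.
rewrite ler_pdivlMr// mulrC; apply: (le_trans gr).
by rewrite lerD2r; exact: h.
Qed.

Lemma Eoo_ge0 u (A : set V) : (0 <= Eoo G Om u A)%E.
Proof. exact: Lnorm_ge0. Qed.

(** The approximate minimisers are indexed from p = 1, so the k-th term of the sequence
    that is extracted from has exponent k+1. The limit is first only known to lie in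
    every W^{2,p}; its Hessian is bounded because its supremal energy does not exceed
    that of g. *)
Theorem level_convex_minimiser :
  exists (uoo : V -> R) (u : nat -> V -> R) (pj : nat -> nat),
  [/\ W2oo_bd Om g uoo,
      forall p, (0 < p)%N -> W2oo_bd Om g (u p),
      (forall j, (0 < pj j)%N) /\ {homo pj : i j / (i < j)%N} &
  [/\ forall psi, W2oo_bd Om g psi -> (Eoo G Om uoo Om <= Eoo G Om psi Om)%E,
      (forall p, (0 < p)%N ->
        (Ep G Om p (u p) Om ^+ p <=
         (2 ^- (p ^ 2)%N)%:E +
         ereal_inf [set Ep G Om p v Om ^+ p | v in W2oo_bd Om g])%E) /\
      (forall q : R, 1 <= q ->
        W2_weak_cvg Om q%:E (fun j => u (pj j)) uoo) &
      forall B : set L, measurable B -> B `<=` Om ->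
        (Eoo G Om uoo B <=
         limn_einf (fun j => Ep G Om (pj j) (u (pj j)) B))%E]].
Proof.
have [u_ u_P] := approximate_minimisers oO Omfin cG G0 gW.
pose u k := u_ k.+1.
have uW k : W2oo_bd Om g (u k) by have [] := u_P k.+1 isT.
have u_min k psi c : W2oo_bd Om g psi -> 0 <= c ->
    {ae mu, forall x, Om x -> dens psi x <= c} ->
    (Ep G Om k.+1 (u k) Om <= (2 ^- k.+1 + c)%:E)%E.
  move=> Wpsi c0 hc; have [_ h] := u_P k.+1 isT.
  exact: (@approximate_minimiser_le R n.+1 Om oO Omfin G cG G0 g gW k.+1 (u k) psi c isT c0 h Wpsi hc).
have /choice[B BP] : forall s, exists B : R, 0 <= B /\ ((1 < s)%N -> forall k a,
    (size a <= 2)%N -> (moment mu Om s%:R (D a (diffs g u k)) <= B%:E)%E).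
  move=> s; have [s1|_] := ltnP 1 s; last by exists 0.
  have [C C0 h] := diffs_moment_bounded oO Omfin M0_gt0 OmM0 cG G0 C1_gt0 C2_gt0
    r_gt0 G_growth gW uW u_min s1.
  by exists C.
have B0 s : 0 <= B s by case: (BP s).
pose x := diffs g u.
have xB k : moment_class Om B (x k).
  split; first exact: diffs_W2oo0.
  by move=> s a s1 a2; have [_ h] := BP s; exact: h.
have xs k : sob Om 2 (x k).
  by have [Wx _] := xB k; exact: (W2oo0_sob oO Omfin (ler0n _ 2) Wx).
have xe k : (energy Om 2 (x k) <= (#|{: 2.-bseq 'I_n.+1}|%:R * B 2)%:E)%E.
  by apply: energy_bseq_le => a a2; have [_ h] := xB k; exact: (h 2 a isT a2).
have [j hj [y sy yh]] := sob_weak_compactness oO Omfin xs xe.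
have hy : has_wderiv Om y by case: sy.
have xjB k : moment_class Om B (x (j k)) by exact: xB.
have x_hull Q : (forall m, exists2 k, (m <= k)%N & Q k) ->
    forall e : R, 0 < e -> exists2 z, hull [set x (j k) | k in Q] z &
    moment_class Om B z /\ (energy Om 2 (fun t => z t - y t)%R <= e%:E)%E.
  move=> Qi e e0; have [z hz [_ ze]] := yh Q Qi e e0.
  have Zz : moment_class Om B z.
    by apply: (hull_moment_class oO Omfin _ hz) => _ [k _ <-]; exact: xjB.
  exact: (ex_intro2 _ _ z hz (conj Zz ze)).
have hg : has_wderiv Om g.
  exact: (W2oo_bd_wderiv oO Omfin gW (W2oo_bd_g oO Omfin g)).
pose p k := (j k).+1.
have p_ge k : (k < p k)%N by rewrite ltnS; exact: increasing_ge_id.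
have huj k : has_wderiv Om (u (j k)) by exact: (W2oo_bd_wderiv oO Omfin gW (uW _)).
pose uoo := fun t => g t + y t.
have hc A : measurable (A : set L) -> A `<=` Om ->
    (Eoo G Om uoo A <= limn_einf (fun k => Ep G Om (p k) (u (j k)) A))%E.
  apply: (Eoo_le_liminf oO Omfin cG G0 G_level_convex hg hy p_ge huj).
  move=> Q Qi e e0; have [z hz [Zz ze]] := x_hull Q Qi e e0.
  exact: (ex_intro2 _ _ z hz (conj (moment_class_wderiv oO Omfin Zz) ze)).
have ha psi : W2oo_bd Om g psi -> (Eoo G Om uoo Om <= Eoo G Om psi Om)%E.
  move=> Wpsi; have E0 := Eoo_ge0 psi Om; case E : (Eoo G Om psi Om) => [c| |]; last 2 first.
  - exact: leey.
  - by rewrite E in E0.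
  have c0 : 0 <= c.
    by rewrite E lee_fin in E0.
  have hpsi : {ae mu, forall x, Om x -> dens psi x <= c}.
    have h : (Eoo G Om psi Om <= c%:E)%E by rewrite E.
    have := (@Lnorm_oo_le _ _ _ mu (Om : set L) (dens psi) c c0).1 h.
    move/ae_imp; apply => t ht Ot; exact: le_trans (ler_norm _) (ht Ot).
  apply: (le_trans (hc Om mOm (@subset_refl _ _))); apply: limn_einf_le => e m e0.
  have [N _ NP] := near_infty_natSinv_lt (PosNum e0).
  exists (maxn m N); first exact: leq_maxl.
  apply: (le_trans (u_min (j (maxn m N)) _ _ Wpsi c0 hpsi)).
  rewrite lee_fin addrC lerD2l; apply: le_trans (ltW (NP N (leqnn N))).
  rewrite lef_pV2 ?posrE ?exprn_gt0// -natrX ler_nat.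
  apply: leq_trans (ltn_expl _ _) => //; rewrite ltnS.
  by apply: leqW; apply: leq_trans (increasing_ge_id hj (maxn m N)); exact: leq_maxr.
have Wy0 q : 1 < q -> W20 Om q%:E y.
  by move=> q1; exact: (moment_class_limit_W20 oO Omfin B0 hy (hull_limit_class x_hull) q1).
(* the density of uoo is bounded by comparison with g, and controls the Hessian *)
have Wy : W2oo0 Om y.
  have [c c0 hgc] := dens_bounded oO Omfin cG gW.
  have Eg : (Eoo G Om g Om <= c%:E)%E.
    apply/(@Lnorm_oo_le _ _ _ mu (Om : set L) (dens g) c c0).
    by apply: (ae_imp hgc) => t ht Ot; rewrite ger0_norm; [exact: ht|exact: G0].
  have Eu := le_trans (ha g (W2oo_bd_g oO Omfin g)) Eg.
  have huoo : {ae mu, forall x, Om x -> dens uoo x <= c}.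
    have := (@Lnorm_oo_le _ _ _ mu (Om : set L) (dens uoo) c c0).1 Eu.
    move/ae_imp; apply => t ht Ot; exact: le_trans (ler_norm _) (ht Ot).
  have hwu : has_wderiv Om uoo.
    have -> : uoo = (fun t => 1 * g t + y t) by apply/funext => t; rewrite mul1r.
    exact: (has_wderiv_lin oO 1 hg hy).
  have [b1 b10 h1] := dens_bounded_hess hwu c0 huoo.
  have [b2 b20 h2] := D2_bounded oO Omfin gW.
  apply: (@hess_bounded_W2oo0 y (b1 + b2) hy Wy0); first exact: addr_ge0.
  apply: (ae_imp2 (D2_add oO hg hy) (ae_imp2 h1 h2 (fun x h h' => conj h h'))).
  move=> t e [k1 k2] Ot i k; have := e Ot => {}e.
  have -> : D2 Om y t i k = D2 Om uoo t i k - D2 Om g t i k.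
    by rewrite /uoo e; move: (D2 Om g t) (D2 Om y t) => P Q; rewrite mxE; lra.
  by apply: le_trans (ler_normB _ _) _; rewrite lerD ?k1 ?k2.
exists uoo, u_, p; split.
- by exists y.
- by move=> k k0; have [] := u_P k k0.
- by split => // i k ik; rewrite ltnS; exact: hj.
split; [exact: ha| |exact: hc].
split; first by move=> k k0; have [] := u_P k k0.
move=> q q1.
have -> : (fun k => u_ (p k)) = (fun k t => g t + x (j k) t).
  by apply/funext => k; apply/funext => t; rewrite /x /diffs addrC subrK.
exact: (hull_weak_cvg oO Omfin gW B0 hy xjB x_hull q1).
Qed.

End minimiser.

Theorem theorem5 (R : realType) (n : nat) (n_gt0 : (0 < n)%N)
    (Om : set 'rV[R]_n) (Om_bounded : bounded_set Om) (Om_open : open Om)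
    (H : 'M[R]_n -> R)
    (H_continuous : {within @symmx R n, continuous H})
    (H_ge0 : forall X, symmx X -> 0 <= H X)
    (H_level_convex : level_convex H)
    (C1 C2 r : R) (C1_gt0 : 0 < C1) (C2_gt0 : 0 < C2) (r_gt0 : 0 < r)
    (H_growth : forall X, symmx X -> C1 * euclid_norm X `^ r - C2 <= H X)
    (g : 'rV[R]_n -> R) (gW : W2 Om +oo%E g) :
  exists (uoo : 'rV[R]_n -> R) (u : nat -> 'rV[R]_n -> R) (pj : nat -> nat),
  [/\ W2oo_bd Om g uoo,
      forall p, (0 < p)%N -> W2oo_bd Om g (u p),
      (forall j, (0 < pj j)%N) /\ {homo pj : i j / (i < j)%N} &
  [/\ (* (a) *)
      forall psi, W2oo_bd Om g psi -> (Eoo H Om uoo Om <= Eoo H Om psi Om)%E,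
      (* (b) *)
      (forall p, (0 < p)%N ->
        (Ep H Om p (u p) Om ^+ p <=
         (2 ^- (p ^ 2)%N)%:E +
         ereal_inf [set Ep H Om p v Om ^+ p | v in W2oo_bd Om g])%E) /\
      (forall q : R, 1 <= q ->
        W2_weak_cvg Om q%:E (fun j => u (pj j)) uoo) &
      (* (c) *)
      forall B : set (lebesgue_rV_type R n), measurable B -> B `<=` Om ->
        (Eoo H Om uoo B <=
         limn_einf (fun j => Ep H Om (pj j) (u (pj j)) B))%E]].
Proof.
case: n n_gt0 Om Om_bounded Om_open H H_continuous H_ge0 H_level_convex H_growth g gW
  => [//|n] _ Om bO oO H cH H0 lcH grH g gW.
pose G := H \o @symm R n.+1.
have cG : continuous G by exact: continuous_symm.
have G0 X : 0 <= G X by apply: H0; exact: symm_symmx.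
have GH u x : G (D2 Om u x) = H (D2 Om u x) by rewrite /G /= symm_id//; exact: D2_sym.
have GE : Eoo G Om = Eoo H Om.
  apply/funext => u; apply/funext => A; rewrite /Eoo; congr (Lp_norm A +oo _).
  by apply/funext => x; exact: GH.
have GEp : Ep G Om = Ep H Om.
  apply/funext => p; apply/funext => u; apply/funext => A; rewrite /Ep.
  by under eq_integral do rewrite GH.
have G_growth X : symmx X -> forall i j, C1 * `|X i j| `^ r <= G X + C2.
  move=> sX i j; rewrite /G /= symm_id//; have := grH X sX; rewrite lerBlDr.
  apply: le_trans; rewrite ler_pM2l//; apply: ler_powR2; [exact: ltW|exact: normr_ge0|].
  exact: euclid_norm_ge.
have G_lc (s t : R) X Y : 0 <= t -> t <= 1 ->
    G X <= s -> G Y <= s -> G (t *: X + (1 - t) *: Y) <= s.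
  move=> t0 t1 Xs Ys; have s0 : 0 <= s by exact: le_trans (G0 X) Xs.
  have t01 : 0 <= t <= 1 by rewrite t0 t1.
  have := lcH s s0 (symm X) (symm Y) (Itv01 t0 t1).
  rewrite !inE => /(_ (conj (symm_symmx X) Xs) (conj (symm_symmx Y) Ys)) [_ /=].
  rewrite /G /=; congr (H _ <= _).
  by rewrite symm_comb.
have [M M0 OM] := bounded_cube bO.
have Omfin : (@lebesgue_rV R n.+1 Om < +oo)%E by exact: bounded_lebesgue_fin.
rewrite -GE -GEp.
exact: (level_convex_minimiser oO Omfin M0 OM cG G0 C1_gt0 C2_gt0 r_gt0 G_growth G_lc gW).
Qed.
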